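(* Let $\varphi:\mathbb{R}\to\mathbb{R}$ be continuous and nondecreasing with $\varphi(0)=0$, let $\mu\ge0$ be an even Radon measure on $\mathbb{R}^N\setminus\{0\}$ with $\int_{|z|\le1}|z|^2\mu(\mathrm{d}z)+\int_{|z|>1}\mu(\mathrm{d}z)<\infty$, and let $u_0\in L^1(\mathbb{R}^N)\cap L^\infty(\mathbb{R}^N)$. Define $\Phi(w)=\int_0^w\varphi(\xi)\,\mathrm{d}\xi$. Then the (unique) distributional solution $u\in L^1(Q_T)\cap L^\infty(Q_T)\cap C([0,T];L^1_{\mathrm{loc}}(\mathbb{R}^N))$ of $\partial_tu-\mathcal{L}^\mu[\varphi(u)]=0$ in $Q_T$, $u(\cdot,0)=u_0$ on $\mathbb{R}^N$, satisfies $$\int_{\mathbb{R}^N}\Phi(u(x,\tau))\,\mathrm{d}x+|\varphi(u)|_{\tau,E_\mu}^2\le\int_{\mathbb{R}^N}\Phi(u_0(x))\,\mathrm{d}x\qquad\text{for }\tau\in(0,T].$$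
   Context: $T>0$, $Q_T:=\mathbb{R}^N\times(0,T)$; $\mu$ even means $\mu(B)=\mu(-B)$ for all Borel $B$. The operator is $$\mathcal{L}^\mu[\phi](x)=\int_{\mathbb{R}^N\setminus\{0\}}\big(\phi(x+z)-\phi(x)-z\cdot D\phi(x)\mathbf{1}_{|z|\le1}\big)\mu(\mathrm{d}z).$$ Set $|f|_{E_\mu}^2:=\frac12\int_{\mathbb{R}^N}\int_{|z|>0}|f(x+z)-f(x)|^2\,\mu(\mathrm{d}z)\mathrm{d}x$ and $|f|_{\tau,E_\mu}^2:=\int_0^\tau|f(\cdot,t)|_{E_\mu}^2\,\mathrm{d}t$. Distributional solution: $u\in L^1_{\mathrm{loc}}(Q_T)$ such that, for all $\psi\in C_c^\infty(\mathbb{R}^N\times[0,T))$, $\iint_{Q_T}\big(u\,\partial_t\psi+\varphi(u)\mathcal{L}^\mu[\psi]\big)\mathrm{d}x\mathrm{d}t+\int_{\mathbb{R}^N}u_0(x)\psi(x,0)\,\mathrm{d}x=0$. Existence and uniqueness of a distributional solution in the class $L^1(Q_T)\cap L^\infty(Q_T)\cap C([0,T];L^1_{\mathrm{loc}}(\mathbb{R}^N))$ is known. *)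

(* Defs.v *)
From HB Require Import structures.
From mathcomp Require Import all_boot all_order all_algebra.
From mathcomp Require Import all_classical all_reals all_analysis.

Set Implicit Arguments.
Unset Strict Implicit.
Unset Printing Implicit Defensive.

Import Order.TTheory GRing.Theory Num.Theory.
Import numFieldNormedType.Exports.

Local Open Scope classical_set_scope.
Local Open Scope ring_scope.

Definition borel_mx_display : measure_display. Proof. exact. Qed.

Section borel_mx.
Context (R : realType) (m n : nat).

Definition borel_mx : set (set 'M[R]_(m, n)) := <<s [set U | open U] >>.

Let borel_mx0 : borel_mx set0.
Proof. exact: sigma_algebra0. Qed.

Let borel_mxC A : borel_mx A -> borel_mx (~` A).
Proof. exact: sigma_algebraC. Qed.

Let borel_mx_bigcup (F : (set 'M[R]_(m, n))^nat) :
  (forall i, borel_mx (F i)) -> borel_mx (\bigcup_i F i).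
Proof. exact: sigma_algebra_bigcup. Qed.

HB.instance Definition _ := @isMeasurable.Build borel_mx_display
  'M[R]_(m, n) borel_mx borel_mx0 borel_mxC borel_mx_bigcup.

End borel_mx.

Section borel_mx_theory.
Context (R : realType) (m n : nat).

Lemma open_mx_measurable (U : set 'M[R]_(m, n)) : open U -> measurable U.
Proof. by move=> oU; apply: sub_sigma_algebra. Qed.

Lemma measurable_coord (i : 'I_m) (j : 'I_n) :
  measurable_fun [set: 'M[R]_(m, n)] (fun A => A i j : R).
Proof.
apply: (measurability _ (measurable_realfun.RGenOpens.measurableE R)).
move=> _ [_ [a [b ->] <-]]; rewrite setTI; apply: open_mx_measurable.
apply: open_comp; last exact: interval_open.
by move=> x _; exact: coord_continuous.
Qed.

Let box (q : 'M[rat]_(m, n) * rat) : set 'M[R]_(m, n) :=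
  [set A | forall i j, `|A i j - ratr (q.1 i j)| < ratr q.2].

Let open_bigcup_box (U : set 'M[R]_(m, n)) : open U ->
  U = \bigcup_(q in [set q | box q `<=` U]) box q.
Proof.
move=> oU; apply/seteqP; split=> [A UA|A [q + /=]]; last by exact.
have /nbhs_ballP[e /= e0 eU] : nbhs A U by exact: open_nbhs_nbhs.
have [r] := rat_in_itvoo (divr_gt0 e0 (ltr0n R 2)).
rewrite in_itv/= => /andP[r0 re].
have q_ i j : {q : rat | `|A i j - ratr q| < ratr r :> R}.
  apply: cid.
  have : A i j - ratr r < A i j + ratr r by rewrite ltrD2l gt0_cp.
  by move=> /rat_in_itvoo[q]; rewrite in_itv/= -ltr_distlC => qA; exists q.
exists (\matrix_(i, j) sval (q_ i j), r) => [B /= Bq|i j] /=; last first.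
  by rewrite mxE; exact: (svalP (q_ i j)).
apply: eU; split=> // i j; rewrite /ball/=.
have := Bq i j; rewrite mxE; case: (q_ i j) => q /= Aq Bqr.
rewrite (le_lt_trans (ler_distD (ratr q) _ _))// (splitr e).
by rewrite ltrD// ?(lt_trans Aq)// distrC (lt_trans Bqr).
Qed.

Lemma measurable_fun_mx d (T : measurableType d) (f : T -> 'M[R]_(m, n)) :
  (forall i j, measurable_fun setT (fun x => f x i j : R)) ->
  measurable_fun setT f.
Proof.
move=> mf; apply: (@measurability _ _ _ _ _ _ [set U : set 'M[R]_(m, n) | open U]) => //.
move=> _ [U /open_bigcup_box -> <-].
rewrite setTI preimage_bigcup bigcup_mkcond.
apply: countable_bigcupT_measurable => [|q]; first exact: countableP.
case: ifPn => // _.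
rewrite (_ : _ @^-1` _ = \bigcap_i \bigcap_j (fun x => f x i j) @^-1`
    `]ratr (q.1 i j) - ratr q.2, ratr (q.1 i j) + ratr q.2[%classic).
  apply: fin_bigcap_measurable => // i _; apply: fin_bigcap_measurable => // j _.
  by rewrite -[X in measurable X]setTI; exact: mf.
apply/seteqP; split=> [x qx i _ j _|x qx i j] /=.
  by rewrite in_itv/= -ltr_distl; exact: qx.
by have := qx i I j I; rewrite /= in_itv/= -ltr_distl.
Qed.

End borel_mx_theory.

Lemma product_measure_sigma_finite d1 d2 (T1 : measurableType d1)
    (T2 : measurableType d2) (R : realType)
    (m1 : {sigma_finite_measure set T1 -> \bar R})
    (m2 : {sigma_finite_measure set T2 -> \bar R}) :
  sigma_finite setT (m1 \x m2)%E.
Proof.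
have /sigma_finiteP[F [TF ndF Foo]] := sigma_finiteT m1.
have /sigma_finiteP[G [TG ndG Goo]] := sigma_finiteT m2.
exists (fun n => F n `*` G n).
  rewrite -setXTT TF TG predeqE => -[x y]; split.
    move=> [/= [n _ Fnx] [k _ Gky]]; exists (maxn n k) => //; split.
    - by move: x Fnx; exact/subsetPset/ndF/leq_maxl.
    - by move: y Gky; exact/subsetPset/ndG/leq_maxr.
  by move=> [n _ []/= ? ?]; split; exists n.
move=> k; have [? ?] := Foo k; have [? ?] := Goo k.
split; first exact: measurableX.
by rewrite product_measure1E// lte_mul_pinfty// ge0_fin_numE.
Qed.

Section lebesgue_rV_succ.
Context (R : realType) (n : nat).
Variable nu : {sigma_finite_measure set 'rV[R]_n -> \bar R}.

Definition rV_cons (p : measurableTypeR R * 'rV[R]_n) : 'rV[R]_n.+1 :=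
  \row_j if unlift ord0 j is Some i then p.2 0 i else p.1.

Lemma measurable_rV_cons : measurable_fun setT rV_cons.
Proof.
apply: measurable_fun_mx => i j.
case: (unliftP ord0 j) => [k ->|->].
  rewrite (_ : (fun _ => _) = (fun v : 'rV[R]_n => v 0 k : R) \o snd).
    by apply: measurableT_comp => //; exact: measurable_coord.
  by apply/funext => p /=; rewrite mxE liftK.
rewrite (_ : (fun _ => _) = fst); first exact: measurable_fst.
by apply/funext => p /=; rewrite mxE unlift_none.
Qed.

Definition lebesgue_rV_succ : set 'rV[R]_n.+1 -> \bar R :=
  pushforward (lebesgue_measure \x nu)%E rV_cons.

Let lebesgue_rV_succ0 : lebesgue_rV_succ set0 = 0%E.
Proof. by rewrite /lebesgue_rV_succ /pushforward preimage_set0 measure0. Qed.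

Let lebesgue_rV_succ_ge0 A : (0 <= lebesgue_rV_succ A)%E.
Proof. by rewrite /lebesgue_rV_succ /pushforward; apply: measure_ge0. Qed.

Let lebesgue_rV_succ_sigma_additive : semi_sigma_additive lebesgue_rV_succ.
Proof.
move=> F mF tF mUF; rewrite /lebesgue_rV_succ /pushforward preimage_bigcup.
have mpre A : measurable A -> measurable (rV_cons @^-1` A).
  by move=> mA; rewrite -[X in measurable X]setTI; exact: measurable_rV_cons.
apply: measure_semi_sigma_additive => [k||]; first exact: mpre.
  apply/trivIsetP => i j _ _ ij; rewrite -preimage_setI.
  by move/trivIsetP : tF => /(_ _ _ _ _ ij) ->//; rewrite preimage_set0.
by rewrite -preimage_bigcup; exact: mpre.
Qed.

HB.instance Definition _ := isMeasure.Build _ _ _ lebesgue_rV_succ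
  lebesgue_rV_succ0 lebesgue_rV_succ_ge0 lebesgue_rV_succ_sigma_additive.

Let lebesgue_rV_succ_sigma_finite : sigma_finite setT lebesgue_rV_succ.
Proof.
have [F FT mF] := product_measure_sigma_finite (@lebesgue_measure R) nu.
pose g (v : 'rV[R]_n.+1) : measurableTypeR R * 'rV[R]_n :=
  (v 0 ord0, \row_i v 0 (lift ord0 i)).
have mg : measurable_fun setT g.
  apply: measurable_fun_pair; first exact: measurable_coord.
  apply: measurable_fun_mx => i j.
  rewrite (_ : (fun _ => _) = (fun v : 'rV[R]_n.+1 => v 0 (lift ord0 j) : R)).
    exact: measurable_coord.
  by apply/funext => v; rewrite mxE.
have rV_consK : cancel rV_cons g.
  move=> [x v]; rewrite /g mxE unlift_none; congr pair.
  by apply/rowP => i; rewrite !mxE liftK.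
exists (fun k => g @^-1` F k); first by rewrite -preimage_bigcup -FT.
move=> k; have [mFk Fk] := mF k; split.
  by rewrite -[X in measurable X]setTI; exact: mg.
rewrite /lebesgue_rV_succ /pushforward -comp_preimage.
by rewrite (_ : g \o rV_cons = id)//; apply/funext.
Qed.

HB.instance Definition _ := Measure_isSigmaFinite.Build _ _ _
  lebesgue_rV_succ lebesgue_rV_succ_sigma_finite.

End lebesgue_rV_succ.

Fixpoint lebesgue_rV {R : realType} (n : nat) :
    {sigma_finite_measure set 'rV[R]_n -> \bar R} :=
  match n with
  | 0 => \d_(0 : 'rV[R]_0)
  | n'.+1 => lebesgue_rV_succ (lebesgue_rV n')
  end.

Lemma lebesgue_rV_box (R : realType) n (a b : 'rV[R]_n) :
  (forall i, a 0 i <= b 0 i) ->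
  lebesgue_rV n [set v : 'rV[R]_n | forall i, v 0 i \in `[a 0 i, b 0 i]] =
  (\prod_i (b 0 i - a 0 i))%:E.
Proof.
elim: n a b => [|n IHn] a b ab /=.
  by rewrite big_ord0 diracE mem_set//= => -[].
pose tl (v : 'rV[R]_n.+1) := \row_i v 0 (lift ord0 i).
rewrite /lebesgue_rV_succ /pushforward.
rewrite (_ : _ @^-1` _ = `[a 0 0, b 0 0] `*`
    [set v : 'rV[R]_n | forall i, v 0 i \in `[tl a 0 i, tl b 0 i]]); last first.
  apply/seteqP; split=> [[x v] /= H|[x v] /= [xab vab] j].
    split=> [|i]; first by have := H ord0; rewrite mxE unlift_none.
    by have := H (lift ord0 i); rewrite !mxE liftK.
  rewrite mxE; case: unliftP => [i ->|->] //=.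
  by have := vab i; rewrite !mxE.
have mbox : measurable
    [set v : 'rV[R]_n | forall i, v 0 i \in `[tl a 0 i, tl b 0 i]].
  rewrite (_ : mkset _ = \bigcap_i (fun v : 'rV[R]_n => v 0 i) @^-1`
      `[tl a 0 i, tl b 0 i]%classic); last first.
    by apply/seteqP; split=> [v H i _|v H i]; [exact: H|exact: (H i I)].
  apply: fin_bigcap_measurable => // i _.
  by rewrite -[X in measurable X]setTI; exact: measurable_coord.
rewrite product_measure1E//= IHn; last by move=> i; rewrite !mxE.
rewrite lebesgue_measure_itv/= lte_fin big_ord_recl EFinM.
congr (_ * _)%E.
  have := ab ord0; rewrite le_eqVlt => /predU1P[->|->]; rewrite ?ltxx ?subrr//.
by congr EFin; apply: eq_bigr => i _; rewrite !mxE.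
Qed.

Section function_classes.
Context d (T : measurableType d) (R : realType) (mu : {measure set T -> \bar R}).

Definition in_L1 (D : set T) (f : T -> R) : Prop :=
  mu.-integrable D (EFin \o f).

Definition in_Linfty (D : set T) (f : T -> R) : Prop :=
  measurable_fun D f /\ exists M : R, {ae mu, forall x, D x -> `|f x| <= M}.

End function_classes.

Section smooth_functions.
Context (R : realType) (V : normedModType R).

Definition iter_derive (f : V -> R) (vs : seq V) : V -> R :=
  foldr (fun v g => fun x => 'D_v g x) f vs.

Definition smooth (f : V -> R) : Prop := forall vs : seq V,
  continuous (iter_derive f vs) /\
  forall x v, derivable (iter_derive f vs) x v.

End smooth_functions.

Section nonlocal_diffusion.
Context (R : realType) (N : nat).
Implicit Types (x z : 'rV[R]_N) (mu : {measure set 'rV[R]_N -> \bar R}).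

(* The library norm on ['rV[R]_N] is the maximum norm. *)
Definition enorm x : R := Num.sqrt (\sum_i x 0 i ^+ 2).

(* A measure on the punctured space is represented by its extension by zero. *)
Definition radon_punctured mu : Prop :=
  [/\ mu [set 0] = 0%E,
      forall K : set 'rV[R]_N, compact K -> K `<=` ~` [set 0] ->
        (mu K < +oo)%E &
      forall B : set 'rV[R]_N, measurable B -> B `<=` ~` [set 0] ->
        mu B = ereal_sup [set mu K | K in [set K | compact K /\ K `<=` B]]].

Definition even_measure mu : Prop :=
  forall B : set 'rV[R]_N, measurable B -> mu B = mu (-%R @` B).

Definition levy_integrable mu : Prop :=
  (\int[mu]_(z in [set z | (enorm z <= 1)%R]) (enorm z ^+ 2)%:E +
   mu [set z | (1 < enorm z)%R] < +oo)%E.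

Definition levy_op mu (phi : 'rV[R]_N -> R) x : R :=
  \int[mu]_(z in ~` [set 0])
    (phi (x + z) - phi x -
     (\sum_i z 0 i * 'D_('e_i) phi x) * \1_[set z | enorm z <= 1] z).

Definition energy mu (f : 'rV[R]_N -> R) : \bar R :=
  ((2^-1)%:E * \int[lebesgue_rV N]_x
     \int[mu]_(z in [set z | (0 < enorm z)%R])
       (`|f (x + z)%R - f x| ^+ 2)%:E)%E.

Definition energy_upto mu (tau : R) (f : 'rV[R]_N * R -> R) : \bar R :=
  (\int[lebesgue_measure]_(t in `]0%R, tau[) energy mu (fun x => f (x, t)))%E.

Definition QT (T : R) : set ('rV[R]_N * R) := setT `*` `]0, T[.

(* Elements of C_c^oo(R^N x [0, T)) are represented as restrictions of smooth
   functions on R^N x R. *)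
Definition test_function (T : R) (psi : 'rV[R]_N * R -> R) : Prop :=
  [/\ smooth psi,
      compact (closure [set p | psi p != 0]) &
      closure [set p | psi p != 0] `<=` [set p | p.2 < T]].

Definition L1_loc_QT (T : R) (u : 'rV[R]_N * R -> R) : Prop :=
  forall K : set ('rV[R]_N * R), compact K -> K `<=` QT T ->
    in_L1 (lebesgue_rV N \x lebesgue_measure)%E K u.

Definition distributional_solution mu (phi : R -> R) (T : R)
    (u0 : 'rV[R]_N -> R) (u : 'rV[R]_N * R -> R) : Prop :=
  L1_loc_QT T u /\
  forall psi : 'rV[R]_N * R -> R, test_function T psi ->
    \int[(lebesgue_rV N \x lebesgue_measure)%E]_(p in QT T)
      (u p * derive1 (fun t => psi (p.1, t)) p.2 +
       phi (u p) * levy_op mu (fun x => psi (x, p.2)) p.1) +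
    \int[lebesgue_rV N]_x (u0 x * psi (x, 0)) = 0.

(* [u] is the representative whose time slices form the continuous curve, so
   that [u (x, t)] is meaningful for every [t] in [0, T]. *)
Definition C_L1_loc (T : R) (u : 'rV[R]_N * R -> R) : Prop :=
  forall K : set 'rV[R]_N, compact K ->
    (forall t, t \in `[0, T] -> in_L1 (lebesgue_rV N) K (fun x => u (x, t))) /\
    forall t0, t0 \in `[0, T] ->
      (\int[lebesgue_rV N]_(x in K) `|u (x, t) - u (x, t0)|%:E)%E
        @[t --> within `[0, T] (nbhs t0)] --> 0%E.

Definition solution_class (T : R) (u : 'rV[R]_N * R -> R) : Prop :=
  [/\ in_L1 (lebesgue_rV N \x lebesgue_measure)%E (QT T) u,
      in_Linfty (lebesgue_rV N \x lebesgue_measure)%E (QT T) u &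
      C_L1_loc T u].

End nonlocal_diffusion.

Definition primitive0 (R : realType) (phi : R -> R) (w : R) : R :=
  if 0 <= w then \int[lebesgue_measure]_(xi in `[0, w]) phi xi
  else - \int[lebesgue_measure]_(xi in `[w, 0]) phi xi.

(* Main.v *)
(** Integrating the equation in time yields pairs [(U, W)] with [U = L W] weakly,
    where [U(t) = u(t) - u_0] and [W(t)] is the integral of [phi(u)] over [(0, t)];
    since [W] is not regular, [L W] is only known through its convolutions with a
    compactly supported kernel.  Testing a mollified pair with the soft threshold
    of [W] and passing to the limit gives [|W|_E^2 <= - int U W] for every such
    pair, with no regularity of [phi(u)] involved.

    Freeze [u] at [u_0] for negative times and at [u(tau)] after [tau], and let
    [dU], [dW] be the increments over a time step [s].  Then
    [|dW(t)|_E^2 <= G(t) := - int dU dW], where, because [int U W'] is symmetric in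
    the two pairs, the time integral of [G] can be summed by parts; the convexity
    inequality [phi(a) (b - a) <= Phi(b) - Phi(a)] then bounds it by
    [s^2 (int Phi(u_0) - inf int Phi(u))], the infimum being over times just
    before [tau].  Dividing by [s^2] and letting [s] tend to 0, [dW / s] tends to
    [phi(u)] locally in L^1, and the energy is lower semicontinuous by Fatou's
    lemma.  Fatou's lemma again, with the L^1_loc continuity of [u], compares that
    infimum with [int Phi(u(tau))]. *)
Require Import Defs.
From HB Require Import structures.
From mathcomp Require Import all_boot all_order all_algebra.
From mathcomp Require Import all_classical all_reals all_analysis.
From mathcomp Require Import measurable_realfun.
From mathcomp Require Import ring lra.

Set Implicit Arguments.
Unset Strict Implicit.
Unset Printing Implicit Defensive.

Import Order.TTheory GRing.Theory Num.Theory.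
Import numFieldNormedType.Exports.

Local Open Scope classical_set_scope.
Local Open Scope ring_scope.

(** * Real-valued integrals *)

Section real_integrals.
Context d (T : measurableType d) (R : realType).
Variable m : {measure set T -> \bar R}.
Implicit Types f g h : T -> R.

(** The obstacle is that nothing here is regular enough to serve as a test function: [u] is bounded
    and integrable, [phi] is only continuous, so [phi(u)] need not even be integrable in space and
    no chain rule is available for [int Phi(u)]. Working with time increments leaves only sums,
    shifts and the convexity of [Phi]. Formally [dU] is [s] times the time derivative of [u] and
    [dW] is [s phi(u)], so that [G] is [- s^2] times the derivative of [int Phi(u)]. The identity
    [d/dt int U W = 2 int U W'] cannot be differentiated either. Only one half of it is used,
    [2 int int U phi(u) <= int U(tau) W(tau)], and this follows from [G >= 0], that is, from the
    energy estimate itself. Freezing makes the boundary terms explicit: [int U W] vanishes before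
    time 0 and is constant after [tau], so its shifts telescope. Two weaknesses of the data explain
    the remaining bookkeeping. A slice of [u] is known to be integrable only at almost every time,
    so [tau] is approached through good freezing times; and bounds that hold almost everywhere are
    made to hold everywhere by clipping. *)

Definition integ f := m.-integrable setT (EFin \o f).

Lemma integ_meas f : integ f -> measurable_fun setT f.
Proof. by move=> /(measurable_int m) /measurable_EFinP. Qed.

Lemma integD f g : integ f -> integ g -> integ (fun x => f x + g x).
Proof. by move=> fi gi; apply: (integrableD _ fi gi). Qed.

Lemma integB f g : integ f -> integ g -> integ (fun x => f x - g x).
Proof. by move=> fi gi; apply: (integrableB _ fi gi). Qed.

Lemma integZ c f : integ f -> integ (fun x => c * f x).
Proof. by move=> fi; apply: (integrableZl _ _ fi). Qed.

Lemma integ_norm f : integ f -> integ (fun x => `|f x|).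
Proof. by move=> *; exact: integrable_norm. Qed.

Lemma integ0 : integ (fun=> 0).
Proof. exact: integrable0. Qed.

Lemma integ_dom f g : measurable_fun setT f -> (forall x, `|f x| <= g x) ->
  integ g -> integ f.
Proof.
move=> mf fg; apply: le_integrable => //; first exact/measurable_EFinP.
by move=> x _ /=; rewrite lee_fin (le_trans (fg x))// ler_norm.
Qed.

Lemma integMb f h C : measurable_fun setT h -> (forall x, `|h x| <= C) ->
  integ f -> integ (fun x => h x * f x).
Proof.
move=> mh hC fi; apply: (@integ_dom _ (fun x => C * `|f x|)); last first.
- exact/integZ/integ_norm.
- by move=> x; rewrite normrM ler_wpM2r.
- by apply: measurable_funM => //; exact: integ_meas.
Qed.

Lemma integ_ge0 f : measurable_fun setT f -> (forall x, 0 <= f x) ->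
  (\int[m]_x (f x)%:E < +oo)%E -> integ f.
Proof.
move=> mf f0 foo; apply/integrableP; split; first exact/measurable_EFinP.
by under eq_integral => x _ do rewrite /= ger0_norm//.
Qed.

Lemma integ_indic A : measurable A -> (m A < +oo)%E -> integ \1_A.
Proof.
move=> mA Aoo; apply: integ_ge0 => //; rewrite integral_indic//.
by rewrite setIT.
Qed.

Lemma Int_EFin f : integ f -> (\int[m]_x f x)%:E = (\int[m]_x (f x)%:E)%E.
Proof. by move=> fi; rewrite /Rintegral fineK//; exact: integrable_fin_num. Qed.

Lemma integ_lty f : integ f -> (\int[m]_x (f x)%:E < +oo)%E.
Proof. by move=> fi; rewrite -Int_EFin// ltry. Qed.

Lemma IntD f g : integ f -> integ g ->
  \int[m]_x (f x + g x) = \int[m]_x f x + \int[m]_x g x.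
Proof. by move=> fi gi; rewrite RintegralD. Qed.

Lemma IntB f g : integ f -> integ g ->
  \int[m]_x (f x - g x) = \int[m]_x f x - \int[m]_x g x.
Proof. by move=> fi gi; rewrite RintegralB. Qed.

Lemma IntZ c f : integ f -> \int[m]_x (c * f x) = c * \int[m]_x f x.
Proof. by move=> fi; rewrite RintegralZl. Qed.

Lemma IntN f : integ f -> \int[m]_x (- f x) = - \int[m]_x f x.
Proof.
by move=> fi; rewrite -mulN1r -IntZ//; apply: eq_Rintegral => x _; rewrite mulN1r.
Qed.

Lemma integN f : integ f -> integ (fun x => - f x).
Proof. by move=> /(integZ (-1)); under eq_fun do rewrite mulN1r. Qed.

Lemma eq_Int f g : f =1 g -> \int[m]_x f x = \int[m]_x g x.
Proof. by move=> fg; apply: eq_Rintegral => x _. Qed.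

Lemma Int0 f : (forall x, f x = 0) -> \int[m]_x f x = 0.
Proof. by move=> f0; rewrite /Rintegral integral0_eq// => x _; rewrite f0. Qed.

Lemma Int_le f g : integ f -> integ g -> (forall x, f x <= g x) ->
  \int[m]_x f x <= \int[m]_x g x.
Proof. by move=> fi gi fg; apply: le_Rintegral. Qed.

Lemma Int_ge0 f : (forall x, 0 <= f x) -> 0 <= \int[m]_x f x.
Proof. by move=> f0; apply: Rintegral_ge0. Qed.

Lemma Int_norm f : integ f -> `|\int[m]_x f x| <= \int[m]_x `|f x|.
Proof. by move=> fi; apply: le_normr_Rintegral. Qed.

Lemma Int_norm_le f g : integ f -> integ g -> (forall x, `|f x| <= g x) ->
  `|\int[m]_x f x| <= \int[m]_x g x.
Proof.
by move=> fi gi fg; rewrite (le_trans (Int_norm fi))// Int_le//; exact: integ_norm.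
Qed.

Lemma Int_ae f g : measurable_fun setT f -> measurable_fun setT g ->
  {ae m, forall x, f x = g x} -> \int[m]_x f x = \int[m]_x g x.
Proof.
move=> mf mg fg; rewrite /Rintegral; congr fine.
apply: ae_eq_integral => //; [exact/measurable_EFinP|exact/measurable_EFinP|].
by apply: filterS fg => x fgx _ /=; rewrite fgx.
Qed.

Lemma integ_ae f g : measurable_fun setT f -> measurable_fun setT g ->
  {ae m, forall x, f x = g x} -> integ f -> integ g.
Proof.
move=> mf mg fg /integrableP[_ foo]; apply/integrableP; split.
  exact/measurable_EFinP.
apply: le_lt_trans foo; rewrite le_eqVlt; apply/orP; left; apply/eqP.
apply: ge0_ae_eq_integral => //; try by apply: measurableT_comp => //; exact/measurable_EFinP.
by apply: filterS fg => x fgx _ /=; rewrite fgx.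
Qed.

(** Replacing [g] by the maximum of [f] and [g] changes it only on a null set and makes the
    inequality hold everywhere. *)
Lemma ae_Int_le f g : integ f -> integ g -> {ae m, forall x, f x <= g x} ->
  \int[m]_x f x <= \int[m]_x g x.
Proof.
move=> fi gi fg; have mf := integ_meas fi; have mg := integ_meas gi.
have im : integ (fun x => Num.max (f x) (g x)).
  apply: (integ_dom _ _ (integD (integ_norm fi) (integ_norm gi))).
    exact: measurable_maxr.
  by move=> x; case: (leP (f x) (g x)) => _; rewrite ?lerDr ?lerDl.
rewrite (_ : \int[m]_x g x = \int[m]_x Num.max (f x) (g x)).
  by apply: Int_le => // x; rewrite le_max lexx.
apply: Int_ae => //; first exact: integ_meas.
by apply: filterS fg => x /max_idPr.
Qed.

Lemma Int_cvg (f_ : nat -> T -> R) f g :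
  (forall n, measurable_fun setT (f_ n)) -> measurable_fun setT f ->
  {ae m, forall x, f_ ^~ x @ \oo --> f x} -> integ g ->
  {ae m, forall x, forall n, `|f_ n x| <= g x} ->
  (fun n => \int[m]_x f_ n x) @ \oo --> \int[m]_x f x.
Proof.
move=> mf_ mf f_f gi f_g.
have [||||fi _ cf] := @dominated_convergence _ _ _ m setT measurableT
  (fun n => EFin \o f_ n) (EFin \o f) (EFin \o g) _ _ _ gi _.
- by move=> n; exact/measurable_EFinP.
- exact/measurable_EFinP.
- apply: filterS f_f => x h _; apply: cvg_EFin => //.
  by apply: nearW => n.
- by apply: filterS f_g => x h n _ /=; rewrite lee_fin.
apply: fine_cvg; move: cf; rewrite /Rintegral fineK//.
exact: integrable_fin_num.
Qed.

(** The integral of a nonnegative function is a supremum over the simple functions below it, and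
    this supremum is monotone by itself. So integrals of functions of unknown measurability, such as
    the energy of a slice as a function of time, can be compared as well. *)
Lemma ge0_le_int (D : set T) (f g : T -> \bar R) :
  (forall x, D x -> (0 <= f x)%E) -> (forall x, D x -> (f x <= g x)%E) ->
  (\int[m]_(x in D) f x <= \int[m]_(x in D) g x)%E.
Proof.
move=> f0 fg.
rewrite !ge0_integralE//; last by move=> x Dx; exact: le_trans (f0 x Dx) (fg x Dx).
apply: le_ereal_sup => _ /= [h hf <-]; exists h => // x.
apply: (le_trans (hf x)); rewrite /patch; case: ifPn => // /set_mem; exact: fg.
Qed.

End real_integrals.

(** * Fubini and Tonelli for real-valued integrals *)

Section fubini_real.
Context d1 d2 (T1 : measurableType d1) (T2 : measurableType d2) (R : realType).
Variable m1 : {sigma_finite_measure set T1 -> \bar R}.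
Variable m2 : {sigma_finite_measure set T2 -> \bar R}.
Implicit Types F : T1 * T2 -> R.

Lemma measurable_slice1 d (T : measurableType d) (F : T1 * T2 -> T) x :
  measurable_fun setT F -> measurable_fun setT (fun y => F (x, y)).
Proof. by move=> mF; apply: measurableT_comp => //; exact: measurable_pair1. Qed.

Lemma measurable_slice2 d (T : measurableType d) (F : T1 * T2 -> T) y :
  measurable_fun setT F -> measurable_fun setT (fun x => F (x, y)).
Proof. by move=> mF; apply: measurableT_comp => //; exact: measurable_pair2. Qed.

(** [Rintegral] takes the value 0 where the inner integral is infinite, so in absolute value it
    never exceeds the extended partial integral, which is integrable. *)
Lemma integ_fubini1 F : integ (m1 \x m2)%E F -> integ m1 (fun x => \int[m2]_y F (x, y)).
Proof.
move=> Fi; have iF := integrable_fubini_F Fi.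
apply: le_integrable iF => //.
  apply/measurable_EFinP; apply: measurableT_comp => //.
  exact: (measurable_fubini_F Fi).
move=> x _ /=; rewrite /Rintegral /fubini_F.
by case: integral => [r| |] //=; rewrite ?lexx ?normr0 ?leey.
Qed.

Lemma integ_fubini2 F : integ (m1 \x m2)%E F -> integ m2 (fun y => \int[m1]_x F (x, y)).
Proof.
move=> Fi; have mF := measurable_int _ Fi.
apply/integrableP; split.
  apply/measurable_EFinP; apply: measurableT_comp => //.
  exact: (measurable_fubini_G Fi).
have Foo : (\int[m2]_y \int[m1]_x `|(F (x, y))%:E| < +oo)%E.
  by apply/(@integrable21ltyP _ _ _ _ _ m1 m2 (EFin \o F)).
apply: le_lt_trans Foo; apply: ge0_le_int => y _ //.
apply: le_trans (le_abse_integral _ _ _) => //.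
  by rewrite /Rintegral /=; case: integral => [r| |] //=; rewrite ?lexx ?normr0 ?leey.
exact: (measurable_slice2 y mF).
Qed.

Lemma Int_fubini1 F : integ (m1 \x m2)%E F ->
  \int[m1]_x \int[m2]_y F (x, y) = \int[(m1 \x m2)%E]_p F p.
Proof.
move=> Fi; rewrite [RHS]/Rintegral -integral12_prod_meas1// /fubini_F.
rewrite [LHS]/Rintegral; congr fine.
apply: ae_eq_integral => //.
- exact: (measurable_int _ (integ_fubini1 Fi)).
- exact: (measurable_fubini_F Fi).
- apply: filterS (ae_integrable1 Fi) => x xi _.
  by rewrite Int_EFin.
Qed.

Lemma Int_fubini2 F : integ (m1 \x m2)%E F ->
  \int[m2]_y \int[m1]_x F (x, y) = \int[(m1 \x m2)%E]_p F p.
Proof.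
move=> Fi; rewrite [RHS]/Rintegral -integral21_prod_meas1// /fubini_G.
rewrite [LHS]/Rintegral; congr fine.
apply: ae_eq_integral => //.
- exact: (measurable_int _ (integ_fubini2 Fi)).
- exact: (measurable_fubini_G Fi).
- apply: filterS (ae_integrable2 Fi) => x xi _.
  by rewrite Int_EFin.
Qed.

Lemma Int_fubini F : integ (m1 \x m2)%E F ->
  \int[m1]_x \int[m2]_y F (x, y) = \int[m2]_y \int[m1]_x F (x, y).
Proof. by move=> Fi; rewrite Int_fubini1// Int_fubini2. Qed.

Lemma integ_prod1 F (g : T1 -> R) : measurable_fun setT F -> integ m1 g ->
  (forall x, (\int[m2]_y `|F (x, y)|%:E <= (g x)%:E)%E) -> integ (m1 \x m2)%E F.
Proof.
move=> mF gi Fg; apply/integrable12ltyP; first exact/measurable_EFinP.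
apply: le_lt_trans (integ_lty gi).
by apply: ge0_le_int => x _; [exact: integral_ge0|exact: Fg].
Qed.

Lemma integ_prod2 F (g : T2 -> R) : measurable_fun setT F -> integ m2 g ->
  (forall y, (\int[m1]_x `|F (x, y)|%:E <= (g y)%:E)%E) -> integ (m1 \x m2)%E F.
Proof.
move=> mF gi Fg; apply/integrable21ltyP; first exact/measurable_EFinP.
apply: le_lt_trans (integ_lty gi).
by apply: ge0_le_int => x _; [exact: integral_ge0|exact: Fg].
Qed.

Lemma integ_ae2 F : integ (m1 \x m2)%E F ->
  {ae m2, forall y, integ m1 (fun x => F (x, y))}.
Proof. by move=> Fi; exact: (ae_integrable2 Fi). Qed.

Lemma integ_tensor (f : T1 -> R) (g : T2 -> R) : integ m1 f -> integ m2 g ->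
  integ (m1 \x m2)%E (fun p => f p.1 * g p.2).
Proof.
move=> fi gi.
apply: (@integ_prod1 _ (fun x => `|f x| * \int[m2]_y `|g y|)).
- apply: measurable_funM.
    exact: (measurableT_comp (integ_meas fi) measurable_fst).
  exact: (measurableT_comp (integ_meas gi) measurable_snd).
- under eq_fun do rewrite mulrC; exact/integZ/integ_norm.
- move=> x; under eq_integral do rewrite /= normrM EFinM.
  rewrite ge0_integralZl//; last exact/measurable_EFinP/(integ_meas (integ_norm gi)).
  by rewrite EFinM Int_EFin//; exact: integ_norm.
Qed.

End fubini_real.

(** Passes from an integrand known only on [D] to a globally measurable version vanishing outside
    [D]; it serves for integrals over [QT T] and over intervals. *)
Lemma Int_ae_dom d (T : measurableType d) (R : realType) (m : {measure set T -> \bar R})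
    (D : set T) (f g : T -> R) : measurable D -> measurable_fun D f -> measurable_fun setT g ->
  (forall x, ~ D x -> g x = 0) -> {ae m, forall x, D x -> f x = g x} ->
  \int[m]_(x in D) f x = \int[m]_x g x.
Proof.
move=> mD mf mg g0 fg; rewrite /Rintegral; congr fine.
rewrite [RHS](_ : _ = \int[m]_(x in D) (g x)%:E)%E; last first.
  rewrite [RHS]integral_mkcond; apply: eq_integral => x _; rewrite patchE.
  by case: ifPn => // /negP; rewrite inE => /g0 ->.
apply: ae_eq_integral => //.
- exact/measurable_EFinP.
- by apply/measurable_EFinP; exact: measurable_funTS.
- by move: fg; apply: filterS => x h Dx; rewrite h.
Qed.

Section parametric.
Context d1 d2 (T1 : measurableType d1) (T2 : measurableType d2) (R : realType).
Variable m2 : {sigma_finite_measure set T2 -> \bar R}.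

(** [F] need not be integrable, so Tonelli is applied to its positive and negative parts; [fine] is
    measurable and turns the difference back into the real integral. *)
Lemma measurable_Int (F : T1 * T2 -> R) : measurable_fun setT F ->
  measurable_fun setT (fun x => \int[m2]_y F (x, y)).
Proof.
move=> mF; have mE : measurable_fun setT (EFin \o F) by exact/measurable_EFinP.
rewrite (_ : (fun x => _) = fun x : T1 => fine (\int[m2]_y ((EFin \o F)^\+ (x, y)) -
    \int[m2]_y ((EFin \o F)^\- (x, y)))%E); last first.
  apply/funext => x; rewrite [LHS]/Rintegral integralE.
  by congr (fine (_ - _)%E); apply: eq_integral => y _; rewrite ?funeposE ?funenegE.
apply: (@measurableT_comp _ _ _ T1 _ _ (fine : \bar R -> R)); first exact: fine_measurable.
apply: emeasurable_funB.
- apply: (measurable_fun_fubini_tonelli_F (m2 := m2) ((EFin \o F)^\+)%E) => //.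
  exact: measurable_funepos.
- apply: (measurable_fun_fubini_tonelli_F (m2 := m2) ((EFin \o F)^\-)%E) => //.
  exact: measurable_funeneg.
Qed.

End parametric.

Section parametric2.
Context d1 d2 (T1 : measurableType d1) (T2 : measurableType d2) (R : realType).
Variable m1 : {sigma_finite_measure set T1 -> \bar R}.

Lemma measurable_Int2 (F : T1 * T2 -> R) : measurable_fun setT F ->
  measurable_fun setT (fun y => \int[m1]_x F (x, y)).
Proof.
move=> mF; apply: (measurable_Int m1 (F := fun q : T2 * T1 => F (q.2, q.1))).
apply: (measurableT_comp (g := fun q : T2 * T1 => (q.2, q.1)) mF).
exact: measurable_fun_pair measurable_snd measurable_fst.
Qed.

End parametric2.

Section product_sigma_finite.
Context d1 d2 (T1 : measurableType d1) (T2 : measurableType d2) (R : realType).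
Variable m1 : {sigma_finite_measure set T1 -> \bar R}.
Variable m2 : {sigma_finite_measure set T2 -> \bar R}.

(* The library's canonical sigma-finite structure on products is only found
   for products of subprobabilities. *)
Definition prod_sf : {sigma_finite_measure set (T1 * T2)%type -> \bar R} :=
  HB.pack (m1 \x m2)%E
    (Measure_isSigmaFinite.Build _ _ _ (m1 \x m2)%E (product_measure_sigma_finite m1 m2)).

Lemma Int_prod_sf (f : T1 * T2 -> R) : \int[prod_sf]_p f p = \int[(m1 \x m2)%E]_p f p.
Proof. by []. Qed.

Lemma integ_prod_sf (f : T1 * T2 -> R) : integ prod_sf f = integ (m1 \x m2)%E f.
Proof. by []. Qed.

End product_sigma_finite.

Section boolean_functions.
Context d (T : measurableType d) (R : realType).

Lemma measurable_natb (b : T -> bool) : measurable_fun setT b ->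
  measurable_fun setT (fun x => (b x)%:R : R).
Proof.
move=> mb; rewrite (_ : (fun x => _) = \1_[set x | b x]).
  by apply: measurable_indic; rewrite -[X in measurable X]setTI; exact: mb.
apply/funext => x; rewrite indicE; congr (nat_of_bool _)%:R.
by apply/idP/idP; rewrite inE.
Qed.

(** The indicator of []a, b]], taken as a function of its endpoints too, because they become
    integration variables. Half-open windows make [win r (r + sigma) t] the indicator of []r, r +
    sigma]] in [t] and of [[t - sigma, t[] in [r]. *)
Definition win (a b t : R) : R := ((a < t) && (t <= b))%:R.

Lemma measurable_win (f g h : T -> R) : measurable_fun setT f -> measurable_fun setT g ->
  measurable_fun setT h -> measurable_fun setT (fun x => win (f x) (g x) (h x)).
Proof.
move=> mf mg mh; apply: measurable_natb; apply: measurable_and.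
  exact: measurable_fun_ltr.
exact: measurable_fun_ler.
Qed.

End boolean_functions.

(** * Translations, cubes and continuity in L^1 *)

Section measure_preserving.
Context d (T : measurableType d) (R : realType).
Variables (m : {measure set T -> \bar R}) (tau : T -> T).
Hypothesis mtau : measurable_fun setT tau.
Hypothesis tauP : forall A, measurable A -> m (tau @^-1` A) = m A.

Lemma ge0_integral_mp (f : T -> \bar R) : measurable_fun setT f ->
  (forall x, (0 <= f x)%E) -> (\int[m]_x f (tau x) = \int[m]_x f x)%E.
Proof.
move=> mf f0.
have mix := isMeasurableFun.Build _ _ _ _ _ mtau.
pose t : {mfun T >-> T} := HB.pack tau mix.
rewrite -[RHS](@eq_measure_integral _ _ _ _ m (pushforward m t)); last first.
  by move=> A mA _; rewrite -(tauP mA).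
have /= -> := ge0_integral_pushforward mtau m measurableT mf (fun x _ => f0 x).
by rewrite preimage_setT.
Qed.

Lemma integ_mp (f : T -> R) : integ m f -> integ m (fun x => f (tau x)).
Proof.
move=> /integrableP[mf foo]; apply/integrableP; split.
  exact: (measurableT_comp mf mtau).
rewrite (ge0_integral_mp (f := fun x => `|(f x)%:E|%E))//.
exact: measurableT_comp.
Qed.

Lemma Int_mp (f : T -> R) : measurable_fun setT f ->
  \int[m]_x f (tau x) = \int[m]_x f x.
Proof.
move=> mf; rewrite /Rintegral; congr fine.
rewrite integralE [RHS]integralE; congr (_ - _)%E.
  rewrite -(ge0_integral_mp (f := (fun x => (f x)%:E)^\+%E))//.
    by apply: eq_integral => x _; rewrite !funeposE.
  by apply: (measurable_funepos (f := fun x => (f x)%:E)); exact/measurable_EFinP.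
rewrite -(ge0_integral_mp (f := (fun x => (f x)%:E)^\-%E))//.
  by apply: eq_integral => x _; rewrite !funenegE.
by apply: (measurable_funeneg (f := fun x => (f x)%:E)); exact/measurable_EFinP.
Qed.

End measure_preserving.

Section lebesgue_shift.
Context {R : realType}.
Local Notation mu := (@lebesgue_measure R).

Local Notation TR := (measurableTypeR R).

Lemma measurable_addr (a : R) :
  measurable_fun setT ((fun x : R => x + a) : TR -> TR).
Proof.
have : measurable_fun (setT : set R) (fun x : R => x + a) by exact: measurable_funD.
by [].
Qed.

(** The pushforward under the translation gives half-open intervals their length, which
    characterises Lebesgue measure. *)
Lemma lebesgue_shift (a : R) (A : set R) : measurable A ->
  mu ((fun x => x + a) @^-1` A) = mu A.
Proof.
have mix := isMeasurableFun.Build _ _ _ _ _ (measurable_addr a).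
pose t : {mfun TR >-> TR} :=
  HB.pack (fun x : R => x + a) mix.
move=> mA; rewrite [RHS](@lebesgue_measure_unique _ (pushforward mu t))//.
move=> X /ocitvP[->|[[x y]/= xy ->]]; first by rewrite !measure0.
rewrite /pushforward/= (_ : _ @^-1` _ = `]x - a, y - a]%classic); last first.
  by apply/seteqP; split => r /=; rewrite !in_itv/= ltrBlDr lerBrDr.
rewrite !lebesgue_measure_itv/= !lte_fin ltrD2r xy.
by rewrite -!EFinD opprB addrA subrK.
Qed.

End lebesgue_shift.

Section rV_shift.
Context {R : realType}.

Lemma measurable_addmx N (a : 'rV[R]_N) : measurable_fun setT (fun x : 'rV[R]_N => x + a).
Proof.
apply: measurable_fun_mx => i j.
under eq_fun do rewrite mxE; apply: measurable_funD => //.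
exact: measurable_coord.
Qed.

(** Induction on the dimension. A translation acts separately on the two components of [rV_cons];
    the sections are handled by the induction hypothesis, the remaining coordinate by the
    one-dimensional case. *)
Lemma lebesgue_rV_shift N (a : 'rV[R]_N) (A : set 'rV[R]_N) : measurable A ->
  lebesgue_rV N ((fun x => x + a) @^-1` A) = lebesgue_rV N A.
Proof.
elim: N a A => [a A _|n IHn a A mA].
  by congr (lebesgue_rV 0 _); apply/seteqP; split => x /=; rewrite (_ : x + a = x)//;
    apply/rowP => -[].
rewrite /= /lebesgue_rV_succ /pushforward.
have mB : measurable (@rV_cons R n @^-1` A).
  by rewrite -[X in measurable X]setTI; exact: measurable_rV_cons.
set B := @rV_cons R n @^-1` A in mB *.
pose a' := \row_i a 0 (lift ord0 i) : 'rV[R]_n.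
rewrite (_ : _ @^-1` _ = (fun p => (p.1 + a 0 0, p.2 + a')) @^-1` B); last first.
  have E p : @rV_cons R n p + a = rV_cons (p.1 + a 0 0, p.2 + a').
    apply/rowP => j; rewrite !mxE; case: unliftP => [i ->|->] //=.
    by rewrite !mxE.
  by apply/seteqP; split => p; rewrite /B /preimage /= E.
rewrite /product_measure1/=.
transitivity (\int[@lebesgue_measure R]_x (lebesgue_rV n (xsection B (x + a 0 0)%R)))%E.
  apply: eq_integral => x _; rewrite -(IHn a' (xsection B _)); last exact: measurable_xsection.
  by congr (lebesgue_rV n _); apply/seteqP; split => v; rewrite /xsection /= !inE.
apply: (ge0_integral_mp (measurable_addr _) (@lebesgue_shift R (a 0 0))
  (f := lebesgue_rV n \o xsection B)) => //.
exact: measurable_fun_xsection.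
Qed.

Lemma Int_shift N (a : 'rV[R]_N) (f : 'rV[R]_N -> R) : measurable_fun setT f ->
  \int[lebesgue_rV N]_x f (x + a) = \int[lebesgue_rV N]_x f x.
Proof. exact: (Int_mp (measurable_addmx a) (@lebesgue_rV_shift N a)). Qed.

Lemma integ_shift N (a : 'rV[R]_N) (f : 'rV[R]_N -> R) :
  integ (lebesgue_rV N) f -> integ (lebesgue_rV N) (fun x => f (x + a)).
Proof. exact: (integ_mp (measurable_addmx a) (@lebesgue_rV_shift N a)). Qed.

Lemma Int_shift1 (a : R) (f : R -> R) :
  measurable_fun (setT : set (measurableTypeR R)) f ->
  \int[lebesgue_measure]_x f (x + a) = \int[lebesgue_measure]_x f x.
Proof. by move=> mf; apply: (Int_mp (measurable_addr a) (@lebesgue_shift R a) (f := f)). Qed.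

Lemma integ_shift1 (a : R) (f : R -> R) :
  integ (@lebesgue_measure R) f -> integ (@lebesgue_measure R) (fun x => f (x + a)).
Proof. by move=> fi; apply: (integ_mp (measurable_addr a) (@lebesgue_shift R a) fi). Qed.

End rV_shift.

Section cubes.
Context {R : realType} (N : nat).
Implicit Types (x z : 'rV[R]_N) (r : R).

Definition cube r : set 'rV[R]_N := [set x | forall i, `|x 0 i| < r].

Lemma rV_norm_lt x r : 0 < r -> (`|x| < r) <-> cube r x.
Proof.
move=> r0; split=> [xr i|H]; last first.
  rewrite [ltLHS]/Num.norm /= mx_normrE; apply/bigmax_ltP; split => // -[i j] _ /=.
  by rewrite (ord1 i); exact: H.
apply: le_lt_trans xr; rewrite [leRHS]/Num.norm /= mx_normrE.
by apply/bigmax_geP; right => /=; exists (0, i).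
Qed.

Lemma coord_le_norm x i : `|x 0 i| <= `|x|.
Proof.
rewrite [leRHS]/Num.norm /= mx_normrE.
by apply/bigmax_geP; right => /=; exists (0, i).
Qed.

Lemma cube_open r : open (cube r).
Proof.
have [r0|r0] := ltP 0 r.
  rewrite (_ : cube r = ball 0 r); last first.
    rewrite mx_norm_ball; apply/seteqP; split => x; rewrite /ball_/= sub0r normrN.
    - by move/rV_norm_lt; exact.
    - by move/rV_norm_lt; exact.
  exact: ball_open.
(* For [r <= 0] the cube is empty, except in dimension 0, where it is the whole space. *)
have [[i _]|noi] := pselect (exists i : 'I_N, True); last first.
  rewrite (_ : cube r = setT); first exact: openT.
  by apply/seteqP; split => // x _ i; exfalso; apply: noi; exists i.
rewrite (_ : cube r = set0); first exact: open0.
by apply/seteqP; split => // x /(_ i); rewrite ltNge (le_trans r0).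
Qed.

Lemma cube_measurable r : measurable (cube r).
Proof. by apply: open_mx_measurable; exact: cube_open. Qed.

Definition cbox (a b : 'rV[R]_N) : set 'rV[R]_N :=
  [set v | forall i, v 0 i \in `[a 0 i, b 0 i]].

Lemma cbox_measurable a b : measurable (cbox a b).
Proof.
rewrite (_ : cbox a b = \bigcap_i (fun v : 'rV[R]_N => v 0 i) @^-1`
    `[a 0 i, b 0 i]%classic); last first.
  by apply/seteqP; split=> [v H i _|v H i]; [exact: H|exact: (H i I)].
apply: fin_bigcap_measurable => // i _.
by rewrite -[X in measurable X]setTI; exact: measurable_coord.
Qed.

Lemma cube_fin r : (lebesgue_rV N (cube r) < +oo)%E.
Proof.
apply: (@le_lt_trans _ _ (lebesgue_rV N (cbox (const_mx (- `|r|)) (const_mx `|r|)))).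
  apply: le_measure; rewrite ?inE; [exact: cube_measurable|exact: cbox_measurable|].
  move=> x H i; rewrite !mxE in_itv/= -ler_norml.
  by rewrite (le_trans (ltW (H i)))// ler_norm.
rewrite lebesgue_rV_box ?ltry// => i; rewrite !mxE.
by rewrite (le_trans _ (normr_ge0 r))// oppr_le0.
Qed.

Lemma measurable_continuous (f : 'rV[R]_N -> R) : continuous f -> measurable_fun setT f.
Proof.
move=> cf; apply: (measurability _ (measurable_realfun.RGenOpens.measurableE R)).
move=> _ [_ [a [b ->] <-]]; rewrite setTI; apply: open_mx_measurable.
by apply: open_comp; [move=> x _; exact: cf|exact: interval_open].
Qed.

End cubes.

Import HBSimple.

(** * Continuity of translations in L^1 *)

Section L1_continuity.
Context {R : realType} (N : nat).
Local Notation X := 'rV[R]_N.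
Local Notation lam := (@lebesgue_rV R N).
Implicit Types (f g : X -> R) (U : set X).

Definition L1_continuous f := integ lam f /\
  forall e : R, 0 < e -> exists2 d : R, 0 < d &
    forall z : X, `|z| < d -> \int[lam]_x `|f (x + z) - f x| <= e.

Lemma integ_diff f z : integ lam f -> integ lam (fun x => `|f (x + z) - f x|).
Proof. by move=> fi; apply: integ_norm; apply: integB => //; exact: integ_shift. Qed.

Lemma L1_continuousD f g : L1_continuous f -> L1_continuous g ->
  L1_continuous (fun x => f x + g x).
Proof.
move=> [fi fc] [gi gc]; split; first exact: integD.
move=> e e0; have e20 : 0 < e / 2 by rewrite divr_gt0.
have [d1 d10 h1] := fc _ e20; have [d2 d20 h2] := gc _ e20.
exists (Num.min d1 d2); first by rewrite lt_min d10.
move=> z; rewrite lt_min => /andP[z1 z2].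
rewrite [e in leRHS]splitr (le_trans _ (lerD (h1 z z1) (h2 z z2)))//.
rewrite -IntD; [|exact: integ_diff..].
apply: Int_le; first exact/integ_diff/integD.
  by apply: integD; exact: integ_diff.
by move=> x; rewrite (_ : _ - _ = (f (x + z) - f x) + (g (x + z) - g x)) ?ler_normD//; ring.
Qed.

Lemma L1_continuousZ c f : L1_continuous f -> L1_continuous (fun x => c * f x).
Proof.
move=> [fi fc]; split; first exact: integZ.
move=> e e0; have [|d d0 h] := fc (e / (`|c| + 1)); first by rewrite divr_gt0// ltr_wpDl.
exists d => // z /h; rewrite ler_pdivlMr ?ltr_wpDl// => H.
under eq_Int do rewrite -mulrBr normrM.
rewrite IntZ; last exact: integ_diff.
apply: le_trans H; rewrite mulrC ler_wpM2l//; last by rewrite lerDl.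
by apply: Int_ge0 => x.
Qed.

Lemma L1_continuous_lim f : integ lam f ->
  (forall e : R, 0 < e -> exists2 g, L1_continuous g & \int[lam]_x `|f x - g x| <= e) ->
  L1_continuous f.
Proof.
move=> fi H; split => // e e0; have e30 : 0 < e / 3 by rewrite divr_gt0.
have [g [gi gc] fg] := H _ e30; have [d d0 gd] := gc _ e30.
exists d => // z zd.
have i1 : integ lam (fun x => `|f x - g x|) by apply/integ_norm/integB.
have i2 := integ_shift z i1.
have i3 : integ lam (fun x => `|g (x + z) - g x|) by exact: integ_diff.
apply: (@le_trans _ _ (\int[lam]_x (`|f (x + z) - g (x + z)| +
   `|g (x + z) - g x| + `|f x - g x|))).
  apply: Int_le; [exact: integ_diff|by apply: integD => //; exact: integD|].
  move=> x; rewrite (_ : f (x + z) - f x =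
    (f (x + z) - g (x + z)) + (g (x + z) - g x) - (f x - g x)); last by ring.
  by rewrite (le_trans (ler_normB _ _))// lerD2r ler_normD.
rewrite !IntD//; last exact: integD.
rewrite (Int_shift z (f := fun x => `|f x - g x|)); last exact: (integ_meas i1).
by have := gd _ zd; lra.
Qed.

Lemma inv_succ_cvg0 : (fun n => n.+1%:R^-1 : R) @ \oo --> (0 : R).
Proof. exact: cvg_harmonic. Qed.

(** Only the positive part of [\1_U x - \1_U (x + z)] has to be controlled: it vanishes outside [U],
    and at a point of [U] it vanishes for small [z] because [U] is open. Translation invariance
    makes the integral of the difference 0, so the integral of the absolute value is twice that of
    the positive part. The argument runs by contradiction along a sequence [z n], as dominated
    convergence is sequential. *)
Lemma L1_continuous_open U : open U -> (lam U < +oo)%E -> L1_continuous \1_U.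
Proof.
move=> oU Uoo; have mU : measurable U by exact: open_mx_measurable.
have iU : integ lam (\1_U : X -> R) by exact: integ_indic.
split => // e e0; apply: contrapT => H.
have /choice[z zP] : forall n, exists z : X, `|z| < n.+1%:R^-1 /\
    e < \int[lam]_x `|\1_U (x + z) - \1_U x : R|.
  move=> n; apply: contrapT => Hn; apply: H; exists n.+1%:R^-1 => // z zn.
  by rewrite leNgt; apply/negP => ez; apply: Hn; exists z.
have z0 : z @ \oo --> (0 : X).
  apply/cvgr0Pnorm_lt => r r0; near=> n.
  have [zn _] := zP n; apply: (lt_trans zn).
  near: n; have /cvgr0Pnorm_lt/(_ _ r0) := inv_succ_cvg0.
  by apply: filterS => n; rewrite ger0_norm.
pose p n x : R := Num.max 0 (\1_U x - \1_U (x + z n)).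
have ip n : integ lam (p n).
  apply: (integ_dom _ _ (integ_diff (z n) iU)).
  - apply: measurable_maxr => //; exact: integ_meas (integB iU (integ_shift (z n) iU)).
  - move=> x; rewrite ger0_norm ?le_max ?lexx//.
    by rewrite ge_max normr_ge0/= distrC ler_norm.
have : (fun n => \int[lam]_x p n x) @ \oo --> \int[lam]_x (fun=> 0 : R) x.
  apply: (Int_cvg (g := \1_U)) => //.
  - by move=> n; exact: integ_meas (ip n).
  - apply: aeW => x; apply: (@cvg_near_cst _ _ _ _ _).
    have [xU|xU] := pselect (U x); last first.
      apply: nearW => n; rewrite /p indicE memNset// sub0r.
      by apply/max_idPl; rewrite oppr_le0 indicE ler0n.
    have cx : (fun n => x + z n) @ \oo --> x.
      by rewrite -[X in _ --> X]addr0; apply: cvgD => //; exact: cvg_cst.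
    have nU : nbhs x U by exact: open_nbhs_nbhs.
    have : \forall n \near \oo, U (x + z n) by exact: (cx _ nU).
    apply: filterS => n /= Un; rewrite /p !indicE !mem_set//= subrr.
    by rewrite maxxx.
  - apply: aeW => x n; rewrite ger0_norm ?le_max ?lexx// ge_max indicE ler0n/=.
    by rewrite gerBl indicE ler0n.
rewrite (_ : \int[lam]_x _ = 0); last first.
  by rewrite /Rintegral integral0_eq.
move=> /cvgr0Pnorm_lt/(_ (e / 2)); rewrite divr_gt0// => /(_ isT)[n _ /(_ _ (leqnn _))].
rewrite ger0_norm; last by apply: Int_ge0 => x; rewrite /p le_max lexx.
move=> pn; have [_] := zP n; apply/negP; rewrite -leNgt.
rewrite (_ : \int[lam]_x _ = 2 * \int[lam]_x p n x); last first.
  transitivity (\int[lam]_x (2 * p n x - (\1_U x - \1_U (x + z n)))).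
    apply: eq_Int => x; rewrite /p distrC; case: (leP 0 (\1_U x - \1_U (x + z n) : R)) => h.
      by rewrite ger0_norm//; ring.
    by rewrite ltr0_norm//; ring.
  rewrite IntB; [|exact: integZ|by apply: integB => //; exact: (integ_shift (z n) iU)].
  rewrite IntZ// IntB//; last exact: (integ_shift (z n) iU).
  by rewrite (Int_shift (z n) (f := \1_U)) ?subrr ?subr0//; exact: integ_meas.
by rewrite -ler_pdivlMl// ltW// mulrC.
Unshelve. all: by end_near. Qed.

Lemma cube_bigcup : \bigcup_n cube n%:R = [set: X].
Proof.
apply/seteqP; split => // x _.
have [n xn] : exists n, `|x| < n%:R.
  by exists (Num.truncn `|x|).+1; exact: truncnS_gt.
exists n => //=; apply/rV_norm_lt => //.
by rewrite (le_lt_trans _ xn).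
Qed.

Lemma L1_continuous_sum I (r : seq I) (F : I -> X -> R) :
  (forall i, L1_continuous (F i)) -> L1_continuous (fun x => \sum_(i <- r) F i x).
Proof.
move=> cF; elim: r => [|i r IH]; last first.
  by under eq_fun do rewrite big_cons; exact: L1_continuousD.
under eq_fun do rewrite big_nil; split => [|e e0]; first exact: integ0.
exists 1 => // z _; under eq_Int do rewrite subrr normr0.
by rewrite /Rintegral integral0_eq//= ltW.
Qed.

(** Dynkin's theorem: open sets are stable under intersection and generate the Borel sets, and
    intersecting with a cube of finite measure lets complements and disjoint unions stay inside the
    class. *)
Lemma L1_continuous_set (A : set X) n : measurable A ->
  L1_continuous \1_(A `&` cube n%:R).
Proof.
have fin (B : set X) : measurable B -> integ lam (\1_(B `&` cube n%:R) : X -> R).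
  move=> mB; apply: integ_indic; first by apply: measurableI => //; exact: cube_measurable.
  apply: le_lt_trans (cube_fin N n%:R); apply: le_measure; rewrite ?inE//.
    by apply: measurableI => //; exact: cube_measurable.
  exact: cube_measurable.
have c1 : L1_continuous \1_(cube n%:R).
  by apply: L1_continuous_open; [exact: cube_open|exact: cube_fin].
move=> mA; apply: (@dynkin_induction _ X [set U | open U]
  (fun A => L1_continuous \1_(A `&` cube n%:R))) => //.
- by move=> B C; exact: openI.
- by rewrite setTI.
- move=> U oU; apply: L1_continuous_open; first by apply: openI => //; exact: cube_open.
  apply: le_lt_trans (cube_fin N n%:R); apply: le_measure; rewrite ?inE//.
    by apply: open_mx_measurable; apply: openI => //; exact: cube_open.
  exact: cube_measurable.
- move=> B mB cB.
  rewrite (_ : \1_(~` B `&` _) = fun x => \1_(cube n%:R) x + (-1) * \1_(B `&` cube n%:R) x :> R).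
    by apply: L1_continuousD => //; exact: L1_continuousZ.
  apply/funext => x; rewrite !indicE !in_setI in_setC.
  by case: (x \in B); case: (x \in cube _) => /=; rewrite ?mulr0 ?mulr1 ?addr0 ?subrr.
- move=> F mF tF cF.
  have mB : measurable (\bigcup_k F k) by exact: bigcup_measurable.
  apply: L1_continuous_lim; first exact: fin.
  pose S k : X -> R := fun x => \sum_(i < k) \1_(F i `&` cube n%:R) x.
  have cS k : L1_continuous (S k).
    exact: L1_continuous_sum.
  (* A point of the union lies in exactly one [F j], so its partial sums jump from 0 to 1 at
     [k = j + 1]; elsewhere all of them vanish. *)
  have SE x : (exists j, [/\ \1_(cube n%:R) x = 1 :> R,
      \1_(\bigcup_k F k `&` cube n%:R) x = 1 :> R &
      forall k, S k x = (j < k)%N%:R]) \/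
    (\1_(\bigcup_k F k `&` cube n%:R) x = 0 :> R /\ forall k, S k x = 0).
    have [[[j _ Fj] xc]|Nx] := pselect ((\bigcup_k F k `&` cube n%:R) x); [left|right].
      exists j; split; [by rewrite indicE mem_set|by rewrite indicE mem_set//; split => //; exists j|].
      move=> k; transitivity (\sum_(i < k) (i == j :> nat)%:R : R).
        apply: eq_bigr => i _; rewrite indicE; congr (_%:R); congr nat_of_bool.
        apply/idP/eqP => [|ij]; last by rewrite inE ij.
        rewrite inE => -[Fi _]; apply: contrapT => /eqP ij.
        move/trivIsetP : tF => /(_ _ _ I I ij)/seteqP[+ _].
        by move=> /(_ x); apply.
      elim: k => [|k IH]; first by rewrite big_ord0.
      rewrite big_ord_recr/= IH [in RHS]ltnS [in RHS]leq_eqVlt eq_sym.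
      by case: (eqVneq j k) => [->|_]; rewrite ?ltnn ?addr0 ?add0r.
    split => [|k]; first by rewrite indicE memNset.
    apply: big1 => i _; rewrite indicE memNset// => -[Fi xc].
    by apply: Nx; split => //; exists i.
  have : (fun k => \int[lam]_x `|\1_(\bigcup_k F k `&` cube n%:R) x - S k x|)
      @ \oo --> \int[lam]_x (fun=> 0 : R) x.
    apply: (Int_cvg (g := \1_(cube n%:R))).
    + move=> k; apply: integ_meas; apply/integ_norm/integB; first exact: fin.
      by case: (cS k).
    + by [].
    + apply: aeW => x; apply: cvg_near_cst.
      have [[j [_ -> Sx]]|[-> Sx]] := SE x.
        by exists j.+1 => // k /= jk; rewrite Sx jk subrr normr0.
      by apply: nearW => k; rewrite Sx subrr normr0.
    + by case: c1.
    + apply: aeW => x k; have [[j [-> -> Sx]]|[-> Sx]] := SE x.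
        by rewrite Sx; case: ltnP => _; rewrite ?subrr ?subr0 ?normr0 ?normr1.
      by rewrite Sx subrr !normr0 indicE ler0n.
  rewrite (_ : \int[lam]_x _ = 0); last by rewrite /Rintegral integral0_eq.
  move=> /cvgr0Pnorm_lt H e /H[k _ /(_ _ (leqnn _)) Hk]; exists (S k) => //.
  by rewrite ltW// (le_lt_trans (ler_norm _)).
Qed.

Lemma L1_continuous_sfun (g : {sfun X >-> R}) n :
  L1_continuous (fun x => g x * \1_(cube n%:R) x).
Proof.
under eq_fun do rewrite (fimfunEord g) mulr_suml.
apply: L1_continuous_sum => i.
under eq_fun do rewrite -mulrA; apply: L1_continuousZ.
rewrite (_ : (fun x => _) = \1_(g @^-1` [set (finmap.enum_fset (fset_set (range g)))`_i] `&` cube n%:R)).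
  by apply: L1_continuous_set; exact: measurable_sfunP.
by apply/funext => x; rewrite !indicE in_setI -mulnb natrM.
Qed.

(** By density: [f] is approximated in L^1 by a simple function, and the simple function by its
    restriction to a large cube. *)
Lemma integ_L1_continuous f : integ lam f -> L1_continuous f.
Proof.
move=> fi; apply: L1_continuous_lim => // e e0.
have e20 : 0 < e / 2 by rewrite divr_gt0.
have [g_ [gi _ gf]] := approximation_sfun_integrable measurableT fi.
have : (fun n => \int[lam]_x `|f x - g_ n x|) @ \oo --> (0 : R).
  by apply: fine_cvg.
move=> /cvgr0Pnorm_lt/(_ _ e20)[n _ /(_ _ (leqnn _))].
rewrite ger0_norm; last by apply: Int_ge0.
set g := g_ n => fg; have ig : integ lam g by exact: gi.
have : (fun k => \int[lam]_x `|g x - g x * \1_(cube k%:R) x|) @ \oo -->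
    \int[lam]_x (fun=> 0 : R) x.
  apply: (Int_cvg (g := fun x => `|g x|)) => //.
  - move=> k; apply/measurableT_comp => //; apply: measurable_funB => //.
    by apply: measurable_funM => //; apply: measurable_indic; exact: cube_measurable.
  - apply: aeW => x; apply: cvg_near_cst.
    have [k0 _ xk] : (\bigcup_n cube n%:R) x by rewrite cube_bigcup.
    exists k0 => // k /= kk; rewrite indicE mem_set ?mulr1 ?subrr ?normr0// => i.
    by apply: lt_le_trans (xk i) _; rewrite ler_nat.
  - exact: integ_norm.
  - apply: aeW => x k; rewrite normr_id indicE.
    by case: (_ \in _); rewrite ?mulr1 ?subrr ?normr0// mulr0 subr0.
rewrite (_ : \int[lam]_x _ = 0); last by rewrite /Rintegral integral0_eq.
move=> /cvgr0Pnorm_lt/(_ _ e20)[k _ /(_ _ (leqnn _))].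
rewrite ger0_norm; last by apply: Int_ge0.
move=> gk; exists (fun x => g x * \1_(cube k%:R) x); first exact: L1_continuous_sfun.
have ig' : integ lam (fun x => g x * \1_(cube k%:R) x).
  by case: (L1_continuous_sfun g k).
apply: (@le_trans _ _ (\int[lam]_x (`|f x - g x| + `|g x - g x * \1_(cube k%:R) x|))).
  apply: Int_le; first exact/integ_norm/integB.
    by apply: integD; apply/integ_norm/integB.
  move=> x; rewrite (_ : f x - _ = (f x - g x) + (g x - g x * \1_(cube k%:R) x)) ?ler_normD//.
  by ring.
by rewrite IntD; [lra|apply/integ_norm/integB..].
Qed.

End L1_continuity.

(** * Smooth bumps and the mollifier *)

Section smooth_real_functions.
Context {R : realType}.
Implicit Types (f g : R -> R) (p : {poly R}).

(** Derivatives are read off from quadratic remainders; both [flat] at the origin and the expansions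
    of [taylor2] provide such remainders. *)
Lemma is_derive_quad (V : normedModType R) (f : V -> R) (x v : V) (a C : R) :
  (forall h : R, `|f (h *: v + x) - f x - h * a| <= C * h ^+ 2) -> is_derive x v f a.
Proof.
move=> fC.
have C0 : 0 <= C by have := fC 1; rewrite expr1n mulr1; exact: le_trans.
have cf : (fun h : R => h^-1 *: (f (h *: v + x) - f x)) @ 0^' --> a.
  apply/cvgrPdist_le => e e0; near=> h.
  have h0 : h != 0 by near: h; exact: nbhs_dnbhs_neq.
  rewrite (_ : a - _ = - (h^-1 * (f (h *: v + x) - f x - h * a))); last first.
    by rewrite -[_ *: _]/(_ * _) [in RHS]mulrBr mulrA mulVf// mul1r; ring.
  rewrite normrN normrM normfV ler_pdivrMl ?normr_gt0//.
  rewrite (le_trans (fC h))// -real_normK ?num_real// expr2 mulrA [leRHS]mulrC.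
  rewrite ler_wpM2r//.
  have : `|h| < e / (C + 1) by near: h; apply: dnbhs0_lt; rewrite divr_gt0// ltr_wpDl.
  rewrite ltr_pdivlMr ?ltr_wpDl// => /ltW; apply: le_trans.
  by rewrite mulrC ler_wpM2l// lerDl.
by apply: DeriveDef; [exact: (cvgP _ cf)|exact/cvg_lim].
Unshelve. all: by end_near. Qed.

(** [F] lists the successive derivatives, so that smoothness is proved by exhibiting them. *)
Definition smooth1 f := exists F : nat -> R -> R,
  F 0%N = f /\ forall k (x : R), is_derive x (1 : R) (F k) (F k.+1 x).

Lemma smooth1_derive f : smooth1 f -> exists2 f', smooth1 f' &
  forall x : R, is_derive x (1 : R) f (f' x).
Proof.
move=> [F [<- FD]]; exists (F 1%N) => //.
by exists (fun k => F k.+1); split.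
Qed.

Lemma smooth1_primitive f f' : smooth1 f' -> (forall x : R, is_derive x (1 : R) f (f' x)) ->
  smooth1 f.
Proof.
move=> [F [F0 FD]] fD; exists (fun k => if k is k'.+1 then F k' else f).
by split => // -[|k] x //=; rewrite F0.
Qed.

(* The factor [p.[s^-1]] makes this class of functions stable under derivation. *)
Definition flat p (s : R) : R := if 0 < s then p.[s^-1] * expR (- s^-1) else 0.

Lemma pow_expR_bounded n (y : R) : 0 <= y -> y ^+ n * expR (- y) <= n`!%:R.
Proof.
move=> y0; rewrite expRN ler_pdivrMr ?expR_gt0//.
case: n => [|n]; first by rewrite expr0 fact0 mul1r -expR0 ler_expR.
have := expR_ge1Dxn n y0; rewrite -ler_pdivrMl ?ltr0n ?fact_gt0// mulrC.
by apply: le_trans; rewrite lerDr.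
Qed.

Lemma poly_expR_bounded p : exists C : R, forall y, 0 <= y -> `|p.[y]| * expR (- y) <= C.
Proof.
exists (\sum_(i < size p) `|p`_i| * i`!%:R) => y y0.
rewrite horner_coef mulrC (le_trans (ler_wpM2l (expR_ge0 _) (ler_norm_sum _ _ _)))//.
rewrite mulr_sumr ler_sum// => i _.
rewrite mulrC normrM -mulrA ler_wpM2l// ger0_norm ?exprn_ge0//.
exact: pow_expR_bounded.
Qed.

(** For [s > 0] the derivative of [p(1/s) exp(-1/s)] is [s^-2 (p - p')(1/s) exp(-1/s)], again of the
    form [flat]. At 0, the boundedness of [y^2 p(y) exp(-y)] for [y >= 0] bounds [flat p h] by a
    multiple of [h^2], so the derivative is 0 there. *)
Lemma is_derive_flat p s :
  is_derive s (1 : R) (flat p) (flat ('X^2 * (p - p^`())) s).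
Proof.
have [s0|s0|->] := ltgtP s 0.
- rewrite [X in is_derive _ _ _ X]/flat ltNge (ltW s0)/=.
  refine (@near_eq_is_derive _ R R (cst (0 : R)) _ _ _ _ _ (is_derive_cst _ _ _)).
  near=> t; rewrite /flat/= ltNge (_ : t <= 0)//.
  by apply/ltW; near: t; exact: lt_nbhsl.
- rewrite [X in is_derive _ _ _ X]/flat s0.
  have dV : is_derive s (1 : R) (fun t : R => t^-1) (- s ^- 2).
    have := @is_deriveV R id s 1 1 (lt0r_neq0 s0) (is_derive_id _ _).
    by case=> D1 D2; apply: DeriveDef => //; rewrite D2 [LHS]mulr1.
  have dN : is_derive s (1 : R) (fun t : R => - t^-1) (s ^- 2).
    by case: (is_deriveN dV) => D1 D2; apply: DeriveDef => //; rewrite D2 opprK.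
  have d1 := @is_derive1_comp _ (horner p) _ s _ _ (is_derive_poly p _) dV.
  have d2 := @is_derive1_comp _ expR _ s _ _ (is_derive_expR _) dN.
  refine (@near_eq_is_derive _ R R ((horner p \o (fun t => t^-1)) *
    (expR \o (fun t => - t^-1))) _ _ _ _ _ _).
    near=> t; rewrite /flat/= (_ : 0 < t)//.
    by near: t; exact: lt_nbhsr.
  case: (is_deriveM d1 d2) => D1 D2; apply: DeriveDef => //; rewrite D2.
  rewrite -![_ *: _]/(_ * _) /= hornerM hornerXn hornerD hornerN -!exprVn; ring.
- rewrite [X in is_derive _ _ _ X]/flat ltxx.
  have [C HC] := poly_expR_bounded ('X^2 * p).
  apply: (@is_derive_quad _ _ _ _ _ C) => h.
  rewrite mulr0 subr0 addr0 /flat ltxx subr0 /GRing.scale/= mulr1.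
  case: ifPn => h0; last first.
    rewrite normr0 mulr_ge0 ?sqr_ge0//; have := HC 0 (lexx _).
    by apply: le_trans; rewrite mulr_ge0// expR_ge0.
  have := HC h^-1; rewrite invr_ge0 (ltW h0) => /(_ isT).
  rewrite !hornerE normrM (ger0_norm (sqr_ge0 _)) exprVn -mulrA ler_pdivrMl ?exprn_gt0//.
  by rewrite normrM (ger0_norm (expR_ge0 _)) => /le_trans; apply; rewrite expr2 mulrC mulrA.
Unshelve. all: by end_near. Qed.

Lemma smooth1_flat p : smooth1 (flat p).
Proof.
exists (fun k => flat (iter k (fun p => 'X^2 * (p - p^`())) p)); split => // k x.
exact: is_derive_flat.
Qed.

End smooth_real_functions.

(** * A class of smooth functions closed under directional derivatives *)

Section smooth_class.
Context {R : realType} (V : normedModType R).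

(* [SG_comp]: smooth functions of one real variable composed with a continuous
   affine map [a] of linear part [l]. *)
Inductive smooth_gen : (V -> R) -> Prop :=
| SG_cst c : smooth_gen (fun=> c)
| SG_comp (g : R -> R) (a l : V -> R) : smooth1 g -> continuous a ->
    (forall x v (h : R), a (h *: v + x) = h * l v + a x) ->
    smooth_gen (fun x => g (a x))
| SG_add f g : smooth_gen f -> smooth_gen g -> smooth_gen (fun x => f x + g x)
| SG_mul f g : smooth_gen f -> smooth_gen g -> smooth_gen (fun x => f x * g x).

Lemma smooth1_continuous (g : R -> R) : smooth1 g -> continuous g.
Proof.
move=> [F [<- FD]] x; apply: differentiable_continuous.
by apply/derivable1_diffP; case: (FD 0%N x).
Qed.

Lemma smooth_gen_continuous f : smooth_gen f -> continuous f.
Proof.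
elim=> [c|g a l gs ac _|f1 f2 _ c1 _ c2|f1 f2 _ c1 _ c2] x.
- exact: cvg_cst.
- by apply: continuous_comp; [exact: ac|exact: smooth1_continuous].
- by apply: cvgD; [exact: c1|exact: c2].
- by apply: cvgM; [exact: c1|exact: c2].
Qed.

Lemma smooth_gen_derive f v : smooth_gen f -> exists2 f', smooth_gen f' &
  forall x, is_derive x v f (f' x).
Proof.
elim=> [c|g a l gs ac al|f1 f2 s1 [g1 t1 d1] s2 [g2 t2 d2]|f1 f2 s1 [g1 t1 d1] s2 [g2 t2 d2]].
- by exists (fun=> 0); [exact: SG_cst|move=> x; exact: is_derive_cst].
- have [g' gs' gD] := smooth1_derive gs.
  exists (fun x => l v * g' (a x)).
    by apply: SG_mul; [exact: SG_cst|exact: SG_comp ac al].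
  move=> x.
  have D : is_derive (0 : R) (1 : R) (fun h : R => g (a (h *: v + x))) (l v * g' (a x)).
    rewrite (_ : (fun h => _) = g \o (fun h => h * l v + a x)); last first.
      by apply/funext => h /=; rewrite al.
    rewrite mulrC; apply: is_derive1_comp; first by rewrite mul0r add0r.
    apply: (@is_derive_quad _ _ _ _ _ _ 0) => h.
    by rewrite /GRing.scale/= mulr1 addr0 mul0r add0r mul0r addrK subrr normr0.
  apply: DeriveDef; first by apply/derivable1P; case: D.
  case: D => _; rewrite /derive => <-.
  apply: (congr1 (fun F : R -> R => lim (F @ (0 : R)^'))); apply/funext => h.
  by rewrite /= addr0 scale0r add0r [h%:A]mulr1.
- exists (fun x => g1 x + g2 x); first exact: SG_add.
  by move=> x; exact: is_deriveD.
- exists (fun x => f1 x * g2 x + f2 x * g1 x).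
    by apply: SG_add; exact: SG_mul.
  by move=> x; exact: is_deriveM.
Qed.

(** Every iterated directional derivative stays in the class, whose members are all continuous and
    derivable; that is what [smooth] asks for. *)
Lemma smooth_gen_smooth f : smooth_gen f -> smooth f.
Proof.
move=> sf vs.
have : smooth_gen (iter_derive f vs).
  elim: vs => [//|v vs IH] /=.
  have [f' s' fD] := smooth_gen_derive v IH.
  rewrite (_ : (fun x => _) = f')//; apply/funext => x.
  by have [_ ->] := fD x.
move=> s; split; first exact: smooth_gen_continuous.
by move=> x v; have [f' _ /(_ x)[]] := smooth_gen_derive v s.
Qed.

Lemma smooth_gen_prod (I : Type) (r : seq I) (F : I -> V -> R) :
  (forall i, smooth_gen (F i)) -> smooth_gen (fun x => \prod_(i <- r) F i x).
Proof.
move=> sF; elim: r => [|i r IH]; first by under eq_fun do rewrite big_nil; exact: SG_cst.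
by under eq_fun do rewrite big_cons; exact: SG_mul.
Qed.

End smooth_class.

(** A derivative inside the class is chosen for each member, and iterating the choice produces the
    sequence required by [smooth1]. *)
Lemma smooth_gen_smooth1 {R : realType} (f : R -> R) :
  @smooth_gen R R^o f -> smooth1 f.
Proof.
move=> sf.
have /choice[D DP] : forall u : {g : R -> R | @smooth_gen R R^o g},
    exists u' : {g : R -> R | @smooth_gen R R^o g},
      forall x : R, is_derive x (1 : R) (sval u) (sval u' x).
  move=> [g sg]; have [g' sg' gD] := @smooth_gen_derive R R^o g 1 sg.
  by exists (exist _ g' sg').
exists (fun k => sval (iter k D (exist _ f sf))); split => // k x /=.
Qed.

(** * First-order expansions with quadratic remainder *)

Section taylor.
Context {R : realType} (N : nat).
Local Notation X := 'rV[R]_N.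

(* A first-order expansion with quadratic remainder is all the regularity that
   the Levy operator needs, and it is stable under products. *)
Definition taylor2 (f : X -> R) (p : X -> X) := exists2 C : R, 0 <= C &
  forall x, [/\ `|f x| <= C, (forall i, `|p x 0 i| <= C) &
    forall z, `|f (x + z) - f x - \sum_i z 0 i * p x 0 i| <= C * `|z| ^+ 2].

Lemma dot_le (C : R) (z p : X) : (forall i, `|p 0 i| <= C) ->
  `|\sum_i z 0 i * p 0 i| <= N%:R * C * `|z|.
Proof.
move=> pC; apply: le_trans (ler_norm_sum _ _ _) _.
apply: (@le_trans _ _ (\sum_(i < N) C * `|z|)).
  apply: ler_sum => i _; rewrite normrM mulrC ler_pM//; exact: coord_le_norm.
by rewrite sumr_const card_ord -[leLHS]mulr_natl mulrA.
Qed.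

Lemma taylor2_lip f p : taylor2 f p -> exists2 C : R, 0 <= C &
  forall x z, `|f (x + z) - f x| <= C * `|z|.
Proof.
move=> [C C0 fC]; exists (2 * C + N%:R * C) => [|x z].
  by rewrite addr_ge0// mulr_ge0.
have [z1|z1] := leP `|z| 1; last first.
  apply: (@le_trans _ _ (2 * C)).
    rewrite (le_trans (ler_normB _ _))// mulr_natl mulr2n lerD//.
      by case: (fC (x + z)).
    by case: (fC x).
  rewrite [leRHS]mulrDl; apply: (@le_trans _ _ (2 * C * `|z|)).
    by rewrite ler_peMr ?mulr_ge0// ltW.
  by rewrite lerDl mulr_ge0// mulr_ge0.
have [fx px /(_ z) H] := fC x.
rewrite (_ : _ - _ = (f (x + z) - f x - \sum_i z 0 i * p x 0 i) + \sum_i z 0 i * p x 0 i);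
  last by ring.
rewrite (le_trans (ler_normD _ _))// mulrDl lerD//; last exact: dot_le.
rewrite (le_trans H)//.
rewrite expr2 mulrA; apply: le_trans (ler_pM _ _ (lexx _) z1) _ => //.
  by rewrite mulr_ge0.
by rewrite mulr1 ler_wpM2r// mulr_natl mulr2n lerDl.
Qed.

(** Beside the two remainders there is one cross term, the increment of [f1] times the linear part
    of [f2]; each factor is of order [|z|], by [taylor2_lip] and [dot_le]. *)
Lemma taylor2M f1 p1 f2 p2 : taylor2 f1 p1 -> taylor2 f2 p2 ->
  taylor2 (fun x => f1 x * f2 x) (fun x => f2 x *: p1 x + f1 x *: p2 x).
Proof.
move=> t1 t2; have [L1 L10 l1] := taylor2_lip t1.
case: t1 => C1 C10 h1; case: t2 => C2 C20 h2.
have K0 : 0 <= C2 * C1 + C1 * C2 by rewrite addr_ge0// mulr_ge0.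
exists (C2 * C1 + C1 * C2 + L1 * (N%:R * C2)) => [|x].
  by rewrite addr_ge0// mulr_ge0// mulr_ge0.
have [a1 b1 c1] := h1 x; have [a2 b2 c2] := h2 x; split.
- rewrite normrM (le_trans (ler_pM _ _ a1 a2))//.
  rewrite (@le_trans _ _ (C2 * C1 + C1 * C2))//; first by rewrite lerDr mulr_ge0.
  by rewrite lerDl mulr_ge0// mulr_ge0.
- move=> i; rewrite !mxE (le_trans (ler_normD _ _))// !normrM.
  rewrite (@le_trans _ _ (C2 * C1 + C1 * C2))//; first by rewrite lerD// ler_pM.
  by rewrite lerDl mulr_ge0// mulr_ge0.
- move=> z; have [a1' _ _] := h1 (x + z).
  pose d1 := \sum_i z 0 i * p1 x 0 i; pose d2 := \sum_i z 0 i * p2 x 0 i.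
  rewrite (_ : \sum_i _ = f2 x * d1 + f1 x * d2); last first.
    rewrite !mulr_sumr -big_split/=; apply: eq_bigr => i _; rewrite !mxE; ring.
  rewrite (_ : _ - _ = f1 (x + z) * (f2 (x + z) - f2 x - d2) +
    f2 x * (f1 (x + z) - f1 x - d1) + (f1 (x + z) - f1 x) * d2); last by ring.
  apply: (le_trans (ler_normD _ _)); rewrite [leRHS]mulrDl lerD//.
    apply: (le_trans (ler_normD _ _)); rewrite [leLHS]addrC [leRHS]mulrDl lerD//.
      by rewrite normrM -mulrA ler_pM.
    by rewrite normrM -mulrA ler_pM.
  rewrite normrM [leRHS](_ : _ = (L1 * `|z|) * (N%:R * C2 * `|z|)); last by ring.
  by rewrite ler_pM//; exact: dot_le.
Qed.

Lemma taylor2_prod I (r : seq I) (F : I -> X -> R) :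
  (forall i, exists p, taylor2 (F i) p) ->
  exists p, taylor2 (fun x => \prod_(i <- r) F i x) p.
Proof.
move=> tF; elim: r => [|i r [p IH]].
  exists (fun=> 0); exists 1 => // x; rewrite !big_nil; split.
  - by rewrite normr1.
  - by move=> i; rewrite mxE normr0.
  - move=> z; rewrite big_nil subrr big1 ?subrr ?normr0 ?mul1r// => i _.
    by rewrite mxE mulr0.
have [q tq] := tF i; eexists.
by under eq_fun do rewrite big_cons; exact: taylor2M tq IH.
Qed.

Lemma taylor2_derive f p x : taylor2 f p -> forall i, 'D_('e_i) f x = p x 0 i.
Proof.
move=> [C C0 /(_ x)[_ _ H]] i.
suff : is_derive x ('e_i : X) f (p x 0 i) by case.
apply: (@is_derive_quad _ _ _ _ _ _ (C * `|'e_i : X| ^+ 2)) => h.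
have := H (h *: 'e_i); rewrite [x + _]addrC normrZ exprMn.
rewrite (bigD1 i)//= big1 ?addr0 => [|j ji].
  have -> : (h *: ('e_i : X)) 0 i = h by rewrite !mxE !eqxx mulr1.
  by move=> /le_trans; apply; rewrite real_normK ?num_real// mulrA mulrAC.
by rewrite !mxE eqxx (negbTE ji) mulr0 mul0r.
Qed.

Lemma flat_bounded (p : {poly R}) : exists2 C : R, 0 <= C & forall s, `|flat p s| <= C.
Proof.
have [C HC] := poly_expR_bounded p.
have C0 : 0 <= C by apply: le_trans (HC 0 (lexx _)); rewrite mulr_ge0// expR_ge0.
exists C => // s; rewrite /flat; case: ifPn => s0; last by rewrite normr0.
by rewrite normrM (ger0_norm (expR_ge0 _)) HC// invr_ge0 ltW.
Qed.

Lemma mvt_derive (f f' : R -> R) : (forall s : R, is_derive s (1 : R) f (f' s)) ->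
  forall s t, exists2 c, `|c - s| <= `|t - s| & f t - f s = f' c * (t - s).
Proof.
move=> fD s t.
have cf u v : {within `[u, v], continuous f}.
  by apply: derivable_within_continuous => x _; case: (fD x).
have [st|ts|->] := ltgtP s t.
- have [c] := MVT st (fun x _ => fD x) (cf _ _).
  rewrite in_itv/= => /andP[sc ct] E; exists c => //.
  by rewrite !gtr0_norm ?subr_gt0// lerD2r ltW.
- have [c] := MVT ts (fun x _ => fD x) (cf _ _).
  rewrite in_itv/= => /andP[tc cs] E; exists c.
    by rewrite !ltr0_norm ?subr_lt0// lerN2 lerD2r ltW.
  by rewrite -opprB E -mulrN opprB.
- by exists t => //; rewrite !subrr mulr0.
Qed.

Lemma lip_derive (f f' : R -> R) (C : R) : (forall s : R, is_derive s (1 : R) f (f' s)) ->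
  (forall s, `|f' s| <= C) -> forall s t, `|f t - f s| <= C * `|t - s|.
Proof.
move=> fD f'C s t; have [c _ ->] := mvt_derive fD s t.
by rewrite normrM ler_wpM2r.
Qed.

(** Two uses of the mean value theorem: an increment of [flat p] is [h] times an intermediate
    derivative, and the derivative is Lipschitz with constant [C2]. The slopes [e = 1] and [e = -1]
    give the two factors of [bump]. *)
Lemma flat_taylor (p : {poly R}) (a e : R) (i : 'I_N) : `|e| <= 1 ->
  exists q, taylor2 (fun x => flat p (a + e * x 0 i)) q.
Proof.
move=> e1; pose op (p : {poly R}) : {poly R} := 'X^2 * (p - p^`()).
have [C0 C00 H0] := flat_bounded p; have [C1 C10 H1] := flat_bounded (op p).
have [C2 C20 H2] := flat_bounded (op (op p)).
have T s h : `|flat p (s + h) - flat p s - h * flat (op p) s| <= C2 * h ^+ 2.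
  have [c cs E] := mvt_derive (is_derive_flat p) s (s + h).
  have E' : flat p (s + h) - flat p s = flat (op p) c * h by rewrite E [s + h]addrC addrK.
  rewrite E' mulrC -mulrBr normrM -real_normK ?num_real// expr2 mulrA [leRHS]mulrC.
  rewrite ler_wpM2l// (le_trans (lip_derive (is_derive_flat (op p)) H2 s c))//.
  by rewrite ler_wpM2l// (le_trans cs)// [s + h]addrC addrK.
exists (fun x => \row_j (e * flat (op p) (a + e * x 0 i) * (i == j)%:R)).
exists (C0 + C1 + C2) => [|x]; first by rewrite !addr_ge0.
have C0C : C0 <= C0 + C1 + C2 by rewrite -addrA lerDl addr_ge0.
have C1C : C1 <= C0 + C1 + C2 by rewrite addrAC lerDr addr_ge0.
have C2C : C2 <= C0 + C1 + C2 by rewrite lerDr addr_ge0.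
split.
- exact: le_trans (H0 _) C0C.
- move=> j; rewrite mxE; apply: le_trans C1C; rewrite !normrM.
  apply: (@le_trans _ _ (1 * C1 * 1)); last by rewrite mul1r mulr1.
  by rewrite ler_pM ?mulr_ge0// ?ler_pM//; case: eqP; rewrite ?normr1 ?normr0.
- move=> z; rewrite (bigD1 i)//= big1 => [|j ji]; last first.
    by rewrite mxE eq_sym (negbTE ji) !mulr0.
  rewrite !mxE eqxx mulr1 addr0 mulrDr addrA.
  have := T (a + e * x 0 i) (e * z 0 i).
  rewrite (_ : e * z 0 i * _ = z 0 i * (e * flat (op p) (a + e * x 0 i))); last by ring.
  move=> /le_trans; apply.
  apply: ler_pM => //; first by rewrite sqr_ge0.
  rewrite -real_normK ?num_real// lerXn2r ?nnegrE//.
  rewrite normrM -[leRHS]mul1r ler_pM//; exact: coord_le_norm.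
Qed.

End taylor.

(** * Bumps and time cutoffs in one variable *)

Section bump.
Context {R : realType}.

Definition bump (d s : R) := flat 1 (d + s) * flat 1 (d - s).

Implicit Types d s t : R.

Lemma flat1E (s : R) : flat 1 s = if 0 < s then expR (- s^-1) else 0.
Proof. by rewrite /flat hornerC mul1r. Qed.

Lemma flat1_ge0 (s : R) : 0 <= flat 1 s.
Proof. by rewrite flat1E; case: ifP => // _; exact: expR_ge0. Qed.

Lemma flat1_gt0 (s : R) : 0 < s -> 0 < flat 1 s.
Proof. by rewrite flat1E => ->; exact: expR_gt0. Qed.

Lemma flat1_le (s t : R) : s <= t -> flat 1 s <= flat 1 t.
Proof.
move=> st; rewrite !flat1E; case: ifPn => s0; last by rewrite -flat1E flat1_ge0.
rewrite (lt_le_trans s0 st) ler_expR lerN2 lef_pV2//.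
by rewrite posrE (lt_le_trans s0).
Qed.

Lemma bump_ge0 d s : 0 <= bump d s.
Proof. by rewrite mulr_ge0// flat1_ge0. Qed.

Lemma bumpN d s : bump d (- s) = bump d s.
Proof. by rewrite /bump opprK mulrC. Qed.

Lemma bump_neq0 d s : bump d s != 0 -> `|s| < d.
Proof.
rewrite /bump !flat1E mulf_eq0 negb_or ltr_norml.
case: ifPn => [ds|_]; last by rewrite eqxx.
case: ifPn => [ds'|_]; last by rewrite eqxx andbF.
by move=> _; apply/andP; split; lra.
Qed.

Lemma bump_gt0 d s : `|s| <= d / 2 -> 0 < d -> (flat 1 (d / 2)) ^+ 2 <= bump d s.
Proof.
rewrite ler_norml => /andP[s1 s2] d0.
rewrite expr2 ler_pM// ?flat1_ge0// flat1_le//; lra.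
Qed.

Lemma smooth1_bump d t : smooth1 (fun s => bump d (s - t)).
Proof.
apply: smooth_gen_smooth1; apply: SG_mul.
- apply: (@SG_comp R R^o (flat 1) (fun s => d + (s - t)) id); first exact: smooth1_flat.
    move=> x; apply: cvgD; first exact: cvg_cst.
    by apply: cvgB; [exact: cvg_id|exact: cvg_cst].
  by move=> x v h; rewrite -[h *: v]/(h * v); ring.
- apply: (@SG_comp R R^o (flat 1) (fun s => d - (s - t)) (fun v => - v)); first exact: smooth1_flat.
    move=> x; apply: cvgB; first exact: cvg_cst.
    by apply: cvgB; [exact: cvg_id|exact: cvg_cst].
  by move=> x v h; rewrite -[h *: v]/(h * v); ring.
Qed.

Lemma continuous_bump d t : continuous (fun s => bump d (s - t)).
Proof. exact: (smooth1_continuous (smooth1_bump d t)). Qed.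

Lemma bump_support d t s : s <= t - d \/ t + d <= s -> bump d (s - t) = 0.
Proof.
move=> H; apply/eqP/negPn/negP => /bump_neq0; rewrite ltr_norml => /andP[? ?].
by case: H; lra.
Qed.

Local Notation leb := (@lebesgue_measure R).

Lemma leb_itv (b1 b2 : bool) (a c : R) :
  leb [set` Interval (BSide b1 a) (BSide b2 c)] = (if a < c then (c - a)%:E else 0%E).
Proof.
have := @lebesgue_measure_itv R (Interval (BSide b1 a) (BSide b2 c)).
by rewrite /= lte_fin EFinB.
Qed.

Lemma integ_itv (b1 b2 : bool) (a c : R) :
  integ leb (\1_[set` Interval (BSide b1 a) (BSide b2 c)] : R -> R).
Proof.
apply: integ_indic; first exact: measurable_itv.
by rewrite [X in (X < _)%E]leb_itv; case: ifP => _ //; rewrite ltry.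
Qed.

Lemma integ_bump d t : integ leb (fun s => bump d (s - t)).
Proof.
have mb : measurable_fun (setT : set (measurableTypeR R)) (fun s => bump d (s - t)).
  have cb : continuous (fun s => bump d (s - t)) by exact: continuous_bump.
  exact: (continuous_measurable_fun cb).
have i1 : integ leb (\1_`]t - d, t + d[%classic : R -> R).
  exact: integ_itv.
apply: (integ_dom mb _ i1) => s.
have [sd|sd] := boolP (s \in `]t - d, t + d[).
  rewrite indicE mem_set// ger0_norm ?bump_ge0// /bump.
  have f1 r : flat 1 r <= 1 :> R.
    rewrite flat1E; case: ifPn => // r0.
    by rewrite -[leRHS]expR0 ler_expR oppr_le0 invr_ge0 ltW.
  by rewrite -[leRHS]mulr1 ler_pM// flat1_ge0.
rewrite indicE memNset//=; last by apply/negP.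
rewrite bump_support ?normr0//; move: sd; rewrite in_itv/= negb_and -!leNgt.
by move=> /orP.
Qed.

Lemma Int_bump_gt0 d t : 0 < d -> 0 < \int[leb]_s bump d (s - t).
Proof.
move=> d0; have c0 : 0 < (flat 1 (d / 2)) ^+ 2 :> R by rewrite exprn_gt0// flat1_gt0// divr_gt0.
set c := (_ ^+ 2) in c0.
have i1 : integ leb (\1_`[t - d / 2, t + d / 2]%classic : R -> R).
  exact: integ_itv.
apply: (@lt_le_trans _ _ (\int[leb]_s (c * \1_`[t - d / 2, t + d / 2]%classic s))).
  rewrite IntZ// mulr_gt0// -lte_fin Int_EFin//.
  rewrite (integral_indic _ measurableT) ?setIT; last exact: measurable_itv.
  by rewrite [X in (_ < X)%E]leb_itv ifT ?lte_fin; lra.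
apply: Int_le; [exact: integZ|exact: integ_bump|move=> s].
rewrite indicE; have [|_] := boolP (s \in _); last by rewrite mulr0 bump_ge0.
rewrite inE/= in_itv/= => /andP[s1 s2]; rewrite mulr1 bump_gt0// ler_norml.
by apply/andP; split; lra.
Qed.

Lemma normalized_bump d t : 0 < d -> exists b : R -> R, [/\ smooth1 b,
  integ leb b, \int[leb]_s b s = 1, forall s, 0 <= b s &
  forall s, s <= t - d \/ t + d <= s -> b s = 0].
Proof.
move=> d0; have I0 := Int_bump_gt0 t d0; set I := Rintegral _ _ _ in I0.
exists (fun s => I^-1 * bump d (s - t)); split.
- apply: smooth_gen_smooth1; apply: SG_mul; first exact: SG_cst.
  apply: (@SG_comp R R^o (fun s => bump d (s - t)) id id); first exact: smooth1_bump.
    by move=> x; exact: cvg_id.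
  by [].
- exact/integZ/integ_bump.
- rewrite IntZ; last exact: integ_bump.
  by rewrite mulVf// gt_eqF.
- by move=> s; rewrite mulr_ge0 ?bump_ge0// invr_ge0 ltW.
- by move=> s /bump_support bs; rewrite bs mulr0.
Qed.

Definition heav (f : R -> R) (s : R) := \int[leb]_(r in `]-oo, s]) f r.

Lemma heavE f s : heav f s = \int[leb]_r (f r * \1_`]-oo, s]%classic r).
Proof.
rewrite /heav Rintegral_mkcond; apply: eq_Int => r.
by rewrite patchE indicE; case: ifP => _; rewrite ?mulr1 ?mulr0.
Qed.

Lemma heav_derive f s : integ leb f -> continuous f -> is_derive s (1 : R) (heav f) (f s).
Proof.
move=> fi cf.
have fi' : leb.-integrable `]-oo, (s + 1)] (EFin \o f).
  by apply: integrableS fi => //.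
have ls : s < s + 1 by rewrite ltrDl.
have [|D1 D2] := @continuous_FTC1 R f -oo%O s (s + 1) ls fi' _ (cf s).
  by rewrite ltNyr.
by split; [exact: D1|rewrite -derive1E; exact: D2].
Qed.

Lemma smooth_step f t d : smooth1 f -> integ leb f -> (forall s, 0 <= f s) ->
  \int[leb]_s f s = 1 -> (forall s, s <= t - d \/ t + d <= s -> f s = 0) ->
  exists h : R -> R, [/\ forall s, is_derive s (1 : R) h (f s),
    forall s, 0 <= h s <= 1, forall s, s <= t - d -> h s = 0 &
    forall s, t + d <= s -> h s = 1].
Proof.
move=> sf fi f0 f1 fs; exists (heav f).
have ii s : integ leb (fun r => f r * \1_`]-oo, s]%classic r).
  under eq_fun do rewrite mulrC; apply: (integMb (C := 1)) fi => //.
  by move=> r; rewrite indicE; case: (_ \in _); rewrite ?normr1 ?normr0.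
split=> s; rewrite ?heavE; first exact: heav_derive fi (smooth1_continuous sf).
- apply/andP; split; first by apply: Int_ge0 => r; rewrite mulr_ge0// indicE.
  rewrite -f1; apply: Int_le; [exact: ii|exact: fi|move=> r].
  by rewrite ler_piMr.
- move=> st; rewrite (_ : (fun r => _) = fun=> 0); first by rewrite /Rintegral integral0_eq.
  apply/funext => r; rewrite indicE; have [|_] := boolP (_ \in _); last by rewrite mulr0.
  by rewrite inE/= in_itv/= => rs; rewrite fs ?mul0r//; left; exact: le_trans rs st.
- move=> ts; rewrite -[RHS]f1; apply: eq_Int => r; rewrite indicE.
  have [|] := boolP (_ \in _); rewrite ?mulr1// notin_setE/= in_itv/= => /negP.
  by rewrite -ltNge mulr0 => sr; rewrite fs//; right; rewrite (le_trans ts)// ltW.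
Qed.

(** On nonnegative times [th] is a smoothed indicator of the times before [t], and [- th'] is an
    approximate Dirac mass [b] at [t]; tested with such functions, the weak equation becomes its
    integral over [(0, t)]. *)
Lemma cutoff t d : 0 < d -> d < t -> exists th th' b : R -> R,
  [/\ smooth1 th, (forall s, is_derive s (1 : R) th (th' s)),
     forall s, 0 <= s -> th' s = - b s,
     [/\ forall s, 0 <= s -> 0 <= th s <= 1, forall s, 0 <= s <= t - d -> th s = 1 &
      forall s, s <= - 3 \/ t + d <= s -> th s = 0] &
     [/\ integ leb b, \int[leb]_s b s = 1, forall s, 0 <= b s &
      forall s, s <= t - d \/ t + d <= s -> b s = 0]].
Proof.
move=> d0 dt.
(* The rise of [th] is centred at -2 with radius 1, hence placed in [[-3, -1]]: it makes the support
   compact and is invisible at times [s >= 0]. *)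
have [b1 [s1 i1 I1 p1 z1]] := normalized_bump (-2) (@ltr01 R).
have [b2 [s2 i2 I2 p2 z2]] := normalized_bump t d0.
have [h1 [D1 r1 l1 u1]] := smooth_step s1 i1 p1 I1 z1.
have [h2 [D2 r2 l2 u2]] := smooth_step s2 i2 p2 I2 z2.
have thD s : is_derive s (1 : R) (fun s => h1 s - h2 s) (b1 s - b2 s).
  exact: (is_deriveB (D1 s) (D2 s)).
have sid (f : R -> R) : smooth1 f -> @smooth_gen R R^o f.
  move=> sf; apply: (@SG_comp R R^o f id id) => //.
  by move=> x; exact: cvg_id.
exists (fun s => h1 s - h2 s), (fun s => b1 s - b2 s), b2; split => //.
- apply: smooth1_primitive thD; apply: smooth_gen_smooth1.
  under eq_fun do rewrite -[- b2 _]mulN1r.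
  by apply: SG_add; [exact: sid|apply: SG_mul; [exact: SG_cst|exact: sid]].
- move=> s s0; have -> : b1 s = 0 by apply: z1; right; lra.
  by rewrite sub0r.
- split.
  + move=> s s0; have -> : h1 s = 1 by apply: u1; lra.
    by have /andP[? ?] := r2 s; apply/andP; split; lra.
  + move=> s /andP[s0 st]; have -> : h1 s = 1 by apply: u1; lra.
    by rewrite l2// subr0.
  + move=> s [s3|ts].
      have -> : h1 s = 0 by apply: l1; lra.
      by rewrite l2 ?subrr//; lra.
    have -> : h1 s = 1 by apply: u1; lra.
    by rewrite u2 ?subrr//; lra.
Qed.

End bump.

(** * The mollifying kernel in space *)

Section mollifier.
Context {R : realType} (N : nat).
Local Notation X := 'rV[R]_N.
Local Notation lam := (@lebesgue_rV R N).

(** Left unnormalised; the total mass is divided out in [mo]. *)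
Definition kap (d : R) (x : X) : R := \prod_i bump d (x 0 i).

Lemma kap_ge0 d x : 0 <= kap d x.
Proof. by apply: prodr_ge0 => i _; exact: bump_ge0. Qed.

Lemma kapN d x : kap d (- x) = kap d x.
Proof. by apply: eq_bigr => i _; rewrite mxE bumpN. Qed.

Lemma kap_support d x : kap d x != 0 -> cube d x.
Proof.
move=> /prodf_neq0 H i; apply: bump_neq0; exact: H.
Qed.

Lemma kap_taylor d : exists p, taylor2 (kap d) p.
Proof.
apply: taylor2_prod => i.
have [|q1 t1] := @flat_taylor R N 1 d 1 i; first by rewrite normr1.
have [|q2 t2] := @flat_taylor R N 1 d (-1) i; first by rewrite normrN1.
exists (fun x : X => flat 1 (d + -1 * x 0 i) *: q1 x + flat 1 (d + 1 * x 0 i) *: q2 x).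
rewrite (_ : (fun x => _) = (fun x : X => flat 1 (d + 1 * x 0 i) * flat 1 (d + -1 * x 0 i))).
  exact: taylor2M t1 t2.
by apply/funext => x; rewrite /bump mul1r mulN1r.
Qed.

Lemma kap_le1 d x : kap d x <= 1.
Proof.
rewrite /kap; apply: (@le_trans _ _ (\prod_(i < N) 1)); last by rewrite big1.
apply: ler_prod => i _.
rewrite bump_ge0/= /bump.
have f1 r : flat 1 r <= 1 :> R.
  rewrite flat1E; case: ifPn => // r0.
  by rewrite -[leRHS]expR0 ler_expR oppr_le0 invr_ge0 ltW.
by rewrite -[leRHS]mulr1 ler_pM// flat1_ge0.
Qed.

Lemma kap_continuous d : continuous (kap d).
Proof.
apply: smooth_gen_continuous; apply: smooth_gen_prod => i.
apply: (@SG_comp R X (bump d) (fun x => x 0 i) (fun x => x 0 i)).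
- have := @smooth1_bump R d 0.
  by under [X in smooth1 X -> _]eq_fun do rewrite subr0.
- exact: coord_continuous.
- by move=> x v h; rewrite !mxE.
Qed.

Lemma kap_measurable d : measurable_fun setT (kap d).
Proof. by apply: measurable_continuous; exact: kap_continuous. Qed.

Lemma kap_integ d : integ lam (kap d).
Proof.
have i1 : integ lam (\1_(cube d) : X -> R).
  by apply: integ_indic; [exact: cube_measurable|exact: cube_fin].
apply: (integ_dom (kap_measurable d) _ i1) => x.
rewrite ger0_norm ?kap_ge0// indicE.
have [_|xd] := boolP (x \in cube d); first exact: kap_le1.
rewrite (_ : kap d x = 0)//; apply/eqP/negPn/negP => /kap_support cx.
by move: xd; rewrite notin_setE.
Qed.

Lemma kap_Int_gt0 d : 0 < d -> 0 < \int[lam]_x kap d x.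
Proof.
move=> d0; pose a : X := const_mx (- (d / 2)); pose b : X := const_mx (d / 2).
have ab i : a 0 i <= b 0 i by rewrite !mxE; lra.
pose c : R := ((flat 1 (d / 2)) ^+ 2) ^+ N.
have c0 : 0 < c by rewrite exprn_gt0// exprn_gt0// flat1_gt0// divr_gt0.
have i1 : integ lam (\1_(cbox a b) : X -> R).
  by apply: integ_indic; [exact: cbox_measurable|rewrite [X in (X < _)%E](lebesgue_rV_box ab) ltry].
apply: (@lt_le_trans _ _ (\int[lam]_x (c * \1_(cbox a b) x))).
  rewrite IntZ// mulr_gt0// -lte_fin Int_EFin//.
  rewrite (integral_indic _ measurableT) ?setIT; last exact: cbox_measurable.
  rewrite [X in (_ < X)%E](lebesgue_rV_box ab) lte_fin; apply: prodr_gt0 => i _; rewrite !mxE; lra.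
apply: Int_le; [exact: integZ|exact: kap_integ|move=> x].
rewrite indicE; have [|_] := boolP (x \in _); last by rewrite mulr0 kap_ge0.
rewrite inE mulr1 => xab; rewrite /c /kap -[X in _ ^+ X](card_ord N) -prodr_const.
apply: ler_prod => i _; rewrite exprn_ge0 ?flat1_ge0//=.
apply: bump_gt0 => //; have := xab i; rewrite !mxE in_itv/= => /andP[? ?].
by rewrite ler_norml; apply/andP; split.
Qed.

Lemma kap_test_function (T d t e : R) (y : X) (th : R -> R) :
  smooth1 th -> t + e < T -> (forall s, s <= - 3 \/ t + e <= s -> th s = 0) ->
  test_function T (fun q : X * R => kap d (q.1 - y) * th q.2).
Proof.
move=> sth tT th0.
(* A compact box around the support; its time interval starts at -3, where the cutoffs of [cutoff]
   start to rise. *)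
pose K : set (X * R) := [set x : X | forall i, x 0 i \in `[y 0 i - d, y 0 i + d]] `*` `[-3, t + e].
have cK : compact K.
  apply: compact_setX; last exact: segment_compact.
  apply: (@rV_compact R N (fun i => `[y 0 i - d, y 0 i + d]%classic)) => i.
  exact: segment_compact.
have sK : [set p : X * R | kap d (p.1 - y) * th p.2 != 0] `<=` K.
  move=> [x s] /=; rewrite mulf_eq0 negb_or => /andP[/kap_support kx ts]; split => /=.
    move=> i; have := kx i; rewrite !mxE in_itv/= ltr_norml => /andP[? ?].
    by apply/andP; split; lra.
  rewrite in_itv/=; apply/andP; split; rewrite leNgt; apply/negP => h; move/eqP: ts; apply.
    by apply: th0; left; exact: ltW.
  by apply: th0; right; exact: ltW.
have clK : closure [set p : X * R | kap d (p.1 - y) * th p.2 != 0] `<=` K.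
  have cK' : closed K by apply: compact_closed => //; exact: norm_hausdorff.
  by rewrite ((closure_id K).1 cK'); exact: closure_subset.
have cc i : continuous (fun q : X * R => (q.1 - y) 0 i).
  rewrite (_ : (fun q => _) = fun q : X * R => q.1 0 i - y 0 i); last first.
    by apply/funext => q; rewrite !mxE.
  move=> q; apply: cvgB; last exact: cvg_cst.
  apply: (@continuous_comp _ _ _ fst (fun x : X => x 0 i)); first exact: cvg_fst.
  exact: coord_continuous.
split.
- apply: smooth_gen_smooth; apply: SG_mul.
    apply: smooth_gen_prod => i; apply: SG_mul.
    + apply: (@SG_comp R (X * R)%type (flat 1) (fun q => d + (q.1 - y) 0 i) (fun q => q.1 0 i)).
      * exact: smooth1_flat.
      * by move=> q; apply: cvgD; [exact: cvg_cst|exact: cc].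
      * by move=> x v h; rewrite /= !mxE; ring.
    + apply: (@SG_comp R (X * R)%type (flat 1) (fun q => d - (q.1 - y) 0 i) (fun q => - q.1 0 i)).
      * exact: smooth1_flat.
      * by move=> q; apply: cvgB; [exact: cvg_cst|exact: cc].
      * by move=> x v h; rewrite /= !mxE; ring.
  apply: (@SG_comp R (X * R)%type th snd snd) => //.
  by move=> x; exact: cvg_snd.
- by apply: subclosed_compact cK clK; exact: closed_closure.
- by move=> p /clK [_ /=]; rewrite in_itv/= => /andP[_ pt]; exact: le_lt_trans pt tT.
Qed.

End mollifier.

(** * The Levy operator on mollified functions *)

Lemma continuous_norm_dist {R : realType} (V : normedModType R) (f : V -> R) :
  (forall (y : V) (e : R), 0 < e -> exists2 r, 0 < r &
    forall z, `|y - z| < r -> `|f y - f z| <= e) -> continuous f.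
Proof.
move=> H y; apply/cvgrPdist_le => e e0; have [r r0 Hr] := H y e e0.
by apply/nbhs_normP; exists r => //= z; exact: Hr.
Qed.

Section levy_kernel.
Context {R : realType} (N : nat).
Local Notation X := 'rV[R]_N.
Local Notation lam := (@lebesgue_rV R N).
Variable mu : {sigma_finite_measure set X -> \bar R}.
Implicit Types (f a v : X -> R) (x y z : X).

(* Comparable to the weight in [levy_integrable]; [`|z|] is the maximum norm. *)
Definition mw z : R := Num.min 1 (`|z| ^+ 2).

Lemma mw_ge0 z : 0 <= mw z.
Proof. by rewrite le_min ler01 sqr_ge0. Qed.

Hypothesis mu_even : forall A : set X, measurable A -> mu (-%R @^-1` A) = mu A.
Hypothesis mu_mw : integ mu mw.

Lemma measurable_opp : measurable_fun setT (-%R : X -> X).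
Proof.
apply: measurable_fun_mx => i j; under eq_fun do rewrite mxE.
by apply: measurable_funN; exact: measurable_coord.
Qed.

Lemma measurable_addX : measurable_fun setT (fun p : X * X => p.1 + p.2).
Proof.
apply: measurable_fun_mx => i j; under eq_fun do rewrite mxE.
by apply: measurable_funD; apply: (measurableT_comp (measurable_coord i j)).
Qed.

Lemma measurable_subX : measurable_fun setT (fun p : X * X => p.1 - p.2).
Proof.
apply: measurable_fun_mx => i j; under eq_fun do rewrite !mxE.
by apply: measurable_funB; apply: (measurableT_comp (measurable_coord i j)).
Qed.

(** The symmetric second difference, which is even in [z] and cancels first-order terms. *)
Definition sd f x z := f (x + z) + f (x - z) - 2 * f x.

(* For even [mu] this is [levy_op]: in the symmetrised form the gradient term
   cancels. *)
Definition ell f x := 2^-1 * \int[mu]_z sd f x z.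

Lemma measurable_sd f : measurable_fun setT f ->
  measurable_fun setT (fun p : X * X => sd f p.1 p.2).
Proof.
move=> mf; apply: measurable_funB; first apply: measurable_funD.
- exact: (measurableT_comp mf measurable_addX).
- exact: (measurableT_comp mf measurable_subX).
- by apply: measurable_funM => //; exact: (measurableT_comp mf measurable_fst).
Qed.

Section kernel.
Variable d : R.
Let k : X -> R := kap d.

Lemma norm_le_enorm z : `|z| <= enorm z.
Proof.
rewrite [leLHS]/Num.norm /= mx_normrE; apply/bigmax_leP; split; first exact: sqrtr_ge0.
move=> -[a i] _ /=; rewrite (ord1 a) -sqrtr_sqr ler_wsqrtr//.
by rewrite (bigD1 i)//= lerDl sumr_ge0// => j _; exact: sqr_ge0.
Qed.

Lemma enorm_le z : enorm z ^+ 2 <= N%:R * `|z| ^+ 2.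
Proof.
rewrite /enorm sqr_sqrtr; last by rewrite sumr_ge0// => i _; exact: sqr_ge0.
apply: (@le_trans _ _ (\sum_(i < N) `|z| ^+ 2)).
  apply: ler_sum => i _; rewrite -real_normK ?num_real// lerXn2r ?nnegrE//.
  exact: coord_le_norm.
by rewrite sumr_const card_ord mulr_natl.
Qed.

Lemma enorm_gt1_mw z : 1 < enorm z -> 1 <= N%:R * mw z.
Proof.
move=> ez; have e2 : 1 <= enorm z ^+ 2 by rewrite exprn_ege1// ltW.
rewrite /mw; have [h|/ltW h] := leP 1 (`|z| ^+ 2); last first.
  by rewrite (le_trans e2)// enorm_le.
rewrite mulr1 ler1n lt0n; apply/eqP => N0.
have := le_trans e2 (enorm_le z); rewrite [X in X%:R]N0 mul0r.
by rewrite leNgt ltr01.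
Qed.

Lemma enorm_measurable : measurable_fun setT (@enorm R N).
Proof.
apply: (measurableT_comp (f := @Num.sqrt R)); first exact: (continuous_measurable_fun (@sqrt_continuous R)).
apply: measurable_sum => i; apply: measurable_funX; exact: measurable_coord.
Qed.

Lemma enorm_ball_measurable r : measurable [set z : X | enorm z <= r].
Proof.
rewrite -[X in measurable X]setTI.
have := enorm_measurable measurableT (measurable_itv `]-oo, r]).
by rewrite (_ : _ `&` _ = setT `&` [set z | enorm z <= r]).
Qed.

(** The pointwise bound makes [ell k] converge. The bound on the integral over [x] lets [z] and [x]
    be exchanged against a function that is only bounded. For [|z| <= 1] the second difference is
    quadratically small and supported in a fixed cube; for [|z| > 1] the terms are bounded one by
    one. *)
Lemma kap_sd_bounds : exists2 K : R, 0 <= K &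
  (forall x z, `|sd k x z| <= K * mw z) /\
  (forall z, \int[lam]_x `|sd k x z| <= K * mw z).
Proof.
have [p [C C0 HC]] := kap_taylor N d.
pose V := \int[lam]_x \1_(cube (d + 1)) (x : X) : R.
have iV : integ lam (\1_(cube (d + 1)) : X -> R).
  by apply: integ_indic; [exact: cube_measurable|exact: cube_fin].
have V0 : 0 <= V by apply: Int_ge0 => x; rewrite indicE.
pose c := \int[lam]_x k x.
have c0 : 0 <= c by apply: Int_ge0 => x; exact: kap_ge0.
have sd4 x z : `|sd k x z| <= k (x + z) + k (x - z) + 2 * k x.
  rewrite /sd (le_trans (ler_normB _ _))// ger0_norm ?addr_ge0 ?kap_ge0//.
  by rewrite ger0_norm// mulr_ge0// kap_ge0.
have sdC x z : `|sd k x z| <= 2 * C * `|z| ^+ 2.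
  have [_ _ H] := HC x; have H1 := H z; have := H (- z).
  rewrite normrN; set s := \sum_i _ in H1 *.
  rewrite (_ : \sum_i _ = - s); last first.
    by rewrite -sumrN; apply: eq_bigr => i _; rewrite mxE mulNr.
  rewrite /sd => H2; rewrite (_ : _ - _ = (k (x + z) - k x - s) + (k (x - z) - k x - - s)); last by ring.
  rewrite (le_trans (ler_normD _ _))// (le_trans (lerD H1 H2))//.
  by rewrite -mulrDl -[in leRHS]mulr_natl; lra.
have isd z : integ lam (fun x => `|sd k x z|).
  apply: integ_norm; apply: integB; last exact/integZ/kap_integ.
  by apply: integD; apply: integ_shift; exact: kap_integ.
(* One summand per regime: [4] and [2 C] for the pointwise bound at large and small [z], [4 c] and
   [2 C V] for the integrated one. *)
exists (4 + 2 * C + 2 * C * V + 4 * c).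
  by rewrite !addr_ge0// !mulr_ge0.
have le1 (u w : R) z : 0 <= u -> w <= u -> (1 < `|z| ) -> w <= u * mw z.
  move=> u0 wu z1; rewrite /mw (min_idPl _) ?mulr1//.
  by rewrite exprn_ege1// ltW.
have le2 (u w : R) z : (`|z| <= 1) -> w <= u * `|z| ^+ 2 -> w <= u * mw z.
  move=> z1 H; rewrite /mw (min_idPr _)//.
  by rewrite expr_le1.
split.
- move=> x z; have [z1|z1] := leP `|z| 1.
    apply: le2 => //; apply: le_trans (sdC x z) _; rewrite ler_wpM2r ?sqr_ge0//.
    have := mulr_ge0 C0 V0; lra.
  apply: le1 => //; first by rewrite !addr_ge0// !mulr_ge0.
  apply: (le_trans (sd4 x z)).
  have := @kap_le1 R N d (x + z); have := @kap_le1 R N d (x - z); have := @kap_le1 R N d x.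
  have := mulr_ge0 C0 V0; rewrite -/(k _) -/(k _) -/(k _) /k; lra.
- move=> z; have [z1|z1] := leP `|z| 1.
    apply: le2 => //.
    apply: (@le_trans _ _ (\int[lam]_x (2 * C * `|z| ^+ 2 * \1_(cube (d + 1)) x))); last first.
      rewrite IntZ// -/V; have := sqr_ge0 `|z|; set s := (_ ^+ 2) => s0.
      rewrite mulrAC ler_wpM2r//; have := mulr_ge0 C0 V0; lra.
    apply: Int_le => //; first exact: integZ.
    move=> x; rewrite indicE; have [_|xc] := boolP (x \in cube (d + 1)).
      by rewrite mulr1.
    rewrite mulr0 (_ : sd k x z = 0) ?normr0//.
    have k0 (t : X) : `|t| <= 1 -> k (x + t) = 0.
      move=> t1; apply/eqP/negPn/negP => /kap_support xt.
      move: xc; rewrite notin_setE; apply => i.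
      rewrite (_ : x 0 i = (x + t) 0 i - t 0 i); last by rewrite mxE addrK.
      rewrite (le_lt_trans (ler_normB _ _))// ltr_leD//.
      exact: le_trans (coord_le_norm _ _) t1.
    rewrite /sd k0// k0 ?normrN//.
    have := k0 0; rewrite addr0 normr0 => -> //.
    by rewrite mulr0 addr0 subr0.
  apply: le1 => //; first by rewrite !addr_ge0// !mulr_ge0.
  apply: (@le_trans _ _ (\int[lam]_x (k (x + z) + k (x - z) + 2 * k x))).
    apply: Int_le => //.
    apply: integD; last exact/integZ/kap_integ.
    by apply: integD; apply: integ_shift; exact: kap_integ.
  rewrite !IntD; [|exact: integ_shift (kap_integ _ _)|exact: integ_shift (kap_integ _ _)
    |by apply: integD; apply: integ_shift; exact: kap_integ|exact/integZ/kap_integ].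
  rewrite (Int_shift z (@kap_measurable R N d)) (Int_shift (- z) (@kap_measurable R N d)).
  rewrite IntZ; last exact: kap_integ.
  rewrite -/k -/c; have := mulr_ge0 C0 V0; lra.
Qed.

(** The compensated integrand [F] is integrable thanks to the quadratic remainder. As [mu] is even,
    [F z] and [F (- z)] have the same integral, and in their sum the odd gradient term cancels,
    leaving [sd]. The factor [c] stands for the value of a time cutoff. *)
Lemma levy_op_kap c y x : levy_op mu (fun x => k (x - y) * c) x = c * ell k (x - y).
Proof.
have [p tp] := kap_taylor N d.
have Dk u i : 'D_('e_i) (fun x => k (x - y) * c) u = c * p (u - y) 0 i.
  suff t : taylor2 (fun x => k (x - y) * c) (fun x => c *: p (x - y)).
    by rewrite (taylor2_derive _ t) mxE.
  case: tp => C C0 HC; exists (`|c| * C) => [|v]; first exact: mulr_ge0.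
  have [h1 h2 h3] := HC (v - y); split.
  - by rewrite normrM mulrC ler_wpM2l.
  - by move=> j; rewrite mxE normrM ler_wpM2l.
  - move=> z; rewrite (_ : \sum_i _ = c * \sum_i z 0 i * p (v - y) 0 i); last first.
      by rewrite mulr_sumr; apply: eq_bigr => j _; rewrite mxE mulrCA.
    rewrite (_ : _ - _ = c * (k (v - y + z) - k (v - y) - \sum_i z 0 i * p (v - y) 0 i)).
      by rewrite normrM -mulrA ler_wpM2l.
    by rewrite -[v + z - y]addrA [z - y]addrC addrA; ring.
rewrite /levy_op; set x' := x - y.
pose F z := k (x' + z) - k x' - (\sum_i z 0 i * p x' 0 i) * \1_[set z | enorm z <= 1] z.
have cF z : k (x + z - y) * c - k (x - y) * c -
   (\sum_i z 0 i * 'D_('e_i) (fun x => k (x - y) * c) x) * \1_[set z | enorm z <= 1] z = c * F z.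
  rewrite /F (_ : \sum_i _ = c * \sum_i z 0 i * p x' 0 i); last first.
    by rewrite mulr_sumr; apply: eq_bigr => i _; rewrite Dk mulrCA.
  by rewrite -[x + z - y]addrA [z - y]addrC addrA -/x'; ring.
have iF : integ mu F.
  case: tp => C C0 HC; have [_ _ hz] := HC x'.
  apply: (integ_dom (g := fun z => (C + 2 * C * N%:R) * mw z)); last exact: integZ.
    apply: measurable_funB.
      apply: measurable_funB => //.
      have := measurableT_comp (@kap_measurable R N d) (measurable_addmx x').
      by under eq_fun do rewrite /= addrC.
    apply: measurable_funM.
      apply: measurable_sum => i; apply: measurable_funM => //.
      exact: measurable_coord.
    by apply: measurable_indic; exact: enorm_ball_measurable.
  move=> z; rewrite /F indicE; have [|] := boolP (z \in _).
    rewrite inE/= => ez; rewrite mulr1.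
    have z1 : `|z| <= 1 by exact: le_trans (norm_le_enorm z) ez.
    rewrite /mw (min_idPr _) ?expr_le1// (le_trans (hz z))//.
    by rewrite ler_wpM2r ?sqr_ge0// lerDl !mulr_ge0.
  rewrite notin_setE/= => /negP; rewrite -ltNge => ez; rewrite mulr0 subr0.
  have [a1 _ _] := HC (x' + z); have [a2 _ _] := HC x'.
  apply: (@le_trans _ _ (2 * C)).
    by rewrite (le_trans (ler_normB _ _))//; have := lerD a1 a2; rewrite -/k; lra.
  apply: (@le_trans _ _ (2 * C * (N%:R * mw z))); last first.
    by rewrite mulrA ler_wpM2r ?mw_ge0// lerDr.
  by rewrite ler_peMr ?mulr_ge0// enorm_gt1_mw.
transitivity (\int[mu]_z (c * F z)).
  rewrite Rintegral_mkcond; apply: eq_Int => z; rewrite patchE.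
  case: ifPn => [_|]; first exact: cF.
  (* At [z = 0] the integrand [F] is 0, so extending the integral to the origin changes nothing. *)
  rewrite notin_setE/= => /contrapT ->; rewrite /F addr0 subrr sub0r.
  by rewrite big1 ?mul0r ?oppr0 ?mulr0// => i _; rewrite mxE mul0r.
rewrite IntZ//; congr (_ * _); rewrite /ell.
have := Int_mp measurable_opp mu_even (integ_meas iF) => E.
rewrite (_ : \int[mu]_z sd k x' z = \int[mu]_z F z + \int[mu]_z F (- z)).
  by rewrite E; lra.
rewrite -IntD//; last exact: (integ_mp measurable_opp mu_even iF).
apply: eq_Int => z; rewrite /F /sd.
rewrite (_ : \1_[set z | enorm z <= 1] (- z) = \1_[set z | enorm z <= 1] z :> R); last first.
  rewrite !indicE; congr (_%:R); congr nat_of_bool; apply/idP/idP; rewrite !inE/= /enorm.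
    by under eq_bigr do rewrite mxE sqrrN.
  by under [in X in _ -> X]eq_bigr do rewrite mxE sqrrN.
rewrite (_ : \sum_i (- z) 0 i * p x' 0 i = - \sum_i z 0 i * p x' 0 i); last first.
  by rewrite -sumrN; apply: eq_bigr => i _; rewrite mxE mulNr.
ring.
Qed.

Definition conv f y := \int[lam]_x (f x * k (x - y)).

Lemma bounded_kap_integ f y (S : R) : measurable_fun setT f -> (forall x, `|f x| <= S) ->
  integ lam (fun x => f x * k (x - y)).
Proof. by move=> mf fS; apply: integMb mf fS _; apply: integ_shift; exact: kap_integ. Qed.

Lemma conv_bounded f (S : R) y : measurable_fun setT f -> (forall x, `|f x| <= S) ->
  `|conv f y| <= S * \int[lam]_x k x.
Proof.
move=> mf fS; have ik := kap_integ N d.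
apply: le_trans (Int_norm_le (g := fun x => S * k (x - y)) (bounded_kap_integ y mf fS) _ _) _.
- by apply: integZ; exact: integ_shift.
- by move=> x; rewrite normrM ler_pM// ger0_norm// kap_ge0.
- rewrite IntZ; last exact: integ_shift.
  by rewrite (Int_shift (- y) (@kap_measurable R N d)).
Qed.

Lemma conv_continuous f (S : R) : measurable_fun setT f -> (forall x, `|f x| <= S) ->
  continuous (conv f).
Proof.
move=> mf fS; apply: continuous_norm_dist => y e e0.
have S0 : 0 <= S by exact: le_trans (normr_ge0 _) (fS 0).
have [_ /(_ (e / (S + 1)))[|r r0 H]] := integ_L1_continuous (kap_integ N d).
  by rewrite divr_gt0// ltr_wpDl.
exists r => // z zr.
rewrite /conv -IntB; [|exact: bounded_kap_integ fS..].
have ik (u : X) : integ lam (fun x => k (x + u)) by apply: integ_shift; exact: kap_integ.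
apply: le_trans (Int_norm_le (g := fun x => S * `|k (x - y) - k (x - z)|) _ _ _) _.
- by apply: integB; exact: bounded_kap_integ fS.
- by apply: integZ; apply: integ_norm; apply: integB.
- by move=> x; rewrite -mulrBr normrM ler_wpM2r.
rewrite IntZ; last by apply: integ_norm; apply: integB.
rewrite -(Int_shift y (f := fun x => `|k (x - y) - k (x - z)|)); last first.
  by apply: integ_meas; apply: integ_norm; apply: integB.
have := H _ zr; rewrite ler_pdivlMr ?ltr_wpDl// => He.
apply: le_trans He; rewrite mulrC; apply: ler_pM => //; last by rewrite lerDl.
  by apply: Int_ge0.
rewrite le_eqVlt; apply/orP; left; apply/eqP; apply: eq_Int => x.
by rewrite addrK distrC addrA.
Qed.

Lemma conv_measurable f (S : R) : measurable_fun setT f -> (forall x, `|f x| <= S) ->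
  measurable_fun setT (conv f).
Proof. by move=> mf fS; apply: measurable_continuous; exact: conv_continuous fS. Qed.

Lemma conv_sd f (S : R) y z : measurable_fun setT f -> (forall x, `|f x| <= S) ->
  \int[lam]_x (f x * sd k (x - y) z) = sd (conv f) y z.
Proof.
move=> mf fS; rewrite /sd /conv -IntD; [|exact: bounded_kap_integ fS..].
rewrite -IntZ; last exact: bounded_kap_integ fS.
rewrite -IntB; last 2 first.
- by apply: integD; exact: bounded_kap_integ fS.
- by apply: integZ; exact: bounded_kap_integ fS.
apply: eq_Int => x; rewrite !opprD opprK !addrA; ring.
Qed.

Lemma kap_kernel_sd f (S : R) y : measurable_fun setT f -> (forall x, `|f x| <= S) ->
  integ (lam \x mu)%E (fun p => f p.1 * sd k (p.1 - y) p.2).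
Proof.
move=> mf fS; have [K K0 [_ HK]] := kap_sd_bounds.
have S0 : 0 <= S by exact: le_trans (normr_ge0 _) (fS 0).
have isd z : integ lam (fun x => sd k x z).
  apply: integB; last exact/integZ/kap_integ.
  by apply: integD; apply: integ_shift; exact: kap_integ.
have ims z : integ lam (fun x => f x * sd k (x - y) z).
  by apply: integMb mf fS _; apply: (integ_shift (- y) (isd z)).
apply: (integ_prod2 (g := fun z => S * K * mw z)).
- apply: measurable_funM; first exact: (measurableT_comp mf measurable_fst).
  have mk := measurable_sd (@kap_measurable R N d).
  apply: (measurableT_comp mk (_ : measurable_fun setT (fun p : X * X => (p.1 - y, p.2)))).
  apply: measurable_fun_pair => //=.
  exact: (measurableT_comp (measurable_addmx (- y)) measurable_fst).
- exact: integZ.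
- move=> z; rewrite -Int_EFin; last exact: integ_norm (ims z).
  rewrite lee_fin; apply: (@le_trans _ _ (\int[lam]_x (S * `|sd k (x - y) z|))).
    apply: Int_le; first exact: integ_norm (ims z).
      by apply: integZ; apply: (integ_shift (- y) (integ_norm (isd z))).
    by move=> x; rewrite normrM ler_wpM2r.
  rewrite IntZ; last by apply: (integ_shift (- y) (integ_norm (isd z))).
  rewrite (Int_shift (- y) (f := fun x => `|sd k x z|)); last exact: integ_meas (integ_norm (isd z)).
  by rewrite -mulrA ler_wpM2l.
Qed.

Lemma conv_sd_bound f (S : R) : measurable_fun setT f -> (forall x, `|f x| <= S) ->
  exists2 K : R, 0 <= K & forall y z, `|sd (conv f) y z| <= K * mw z.
Proof.
move=> mf fS; have [K K0 [_ HK]] := kap_sd_bounds.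
have S0 : 0 <= S by exact: le_trans (normr_ge0 _) (fS 0).
have isd z : integ lam (fun x => sd k x z).
  apply: integB; last exact/integZ/kap_integ.
  by apply: integD; apply: integ_shift; exact: kap_integ.
exists (S * K) => [|y z]; first exact: mulr_ge0.
rewrite -(conv_sd y z mf fS).
have is' := integ_shift (- y) (isd z).
apply: le_trans (Int_norm_le (g := fun x => S * `|sd k (x - y) z|) _ _ _) _.
- exact: integMb mf fS is'.
- by apply: integZ; exact: integ_norm is'.
- by move=> x; rewrite normrM ler_wpM2r.
rewrite IntZ; last exact: integ_norm is'.
rewrite (Int_shift (- y) (f := fun x => `|sd k x z|)); last exact: integ_meas (integ_norm (isd z)).
by rewrite -mulrA ler_wpM2l.
Qed.

Lemma ell_integ : integ lam (ell k).
Proof.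
have m1 : measurable_fun setT ((fun=> 1) : X -> R) by exact: measurable_cst.
have b1 (x : X) : `|1 : R| <= 1 by rewrite normr1.
have Fi := kap_kernel_sd 0 m1 b1.
have := integZ 2^-1 (integ_fubini1 Fi); congr integ; apply/funext => x.
by rewrite /ell; congr (_ * _); apply: eq_Int => z /=; rewrite mul1r subr0.
Qed.

(** Transfers the operator from the kernel to the mollified function, so that the weak relation for
    [f] becomes a pointwise one for [conv f]. Fubini applies by the integrated bound on [sd k]. *)
Lemma conv_ell f (S : R) y : measurable_fun setT f -> (forall x, `|f x| <= S) ->
  \int[lam]_x (f x * ell k (x - y)) = ell (conv f) y.
Proof.
move=> mf fS; have Fi := kap_kernel_sd y mf fS.
rewrite /ell; under [in RHS]eq_Int do rewrite -(conv_sd _ _ mf fS).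
rewrite -(Int_fubini Fi) -IntZ; last exact: integ_fubini1 Fi.
apply: eq_Int => x /=; rewrite mulrCA; congr (_ * _); rewrite -IntZ//.
have [K K0 [HK _]] := kap_sd_bounds.
have mk := measurable_slice1 (x - y) (measurable_sd (@kap_measurable R N d)).
apply: (integ_dom mk (HK _)); exact: integZ.
Qed.

End kernel.

(** Discrete integration by parts: [sd] is a forward minus a backward difference, and translating
    the backward one by [z] moves the difference onto [v]. *)
Lemma Int_sd_parts a v (S : R) z : measurable_fun setT a -> (forall x, `|a x| <= S) ->
  integ lam v ->
  \int[lam]_y (v y * sd a y z) = - \int[lam]_y ((a (y + z) - a y) * (v (y + z) - v y)).
Proof.
move=> ma aS iv.
have ish (u : X) : integ lam (fun y => a (y + u) * v y).
  apply: (integMb (C := S)) => //.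
  exact: (measurableT_comp ma (measurable_addmx u)).
have ia : integ lam (fun y => a y * v y) by exact: integMb ma aS iv.
have i1 : integ lam (fun y => (a (y + z) - a y) * v y).
  by under eq_fun do rewrite mulrBl; exact: integB.
have i2 : integ lam (fun y => (a y - a (y - z)) * v y).
  by under eq_fun do rewrite mulrBl; exact: integB.
have i3 := integ_shift z i2.
transitivity (\int[lam]_y ((a (y + z) - a y) * v y) - \int[lam]_y ((a y - a (y - z)) * v y)).
  rewrite -IntB//; apply: eq_Int => y; rewrite /sd; ring.
rewrite -[X in _ - X](Int_shift z (f := fun y => (a y - a (y - z)) * v y)); last exact: integ_meas i2.
rewrite -IntB// -IntN; last first.
  have := integB i3 i1; congr integ; apply/funext => y; rewrite addrK; ring.
by apply: eq_Int => y; rewrite addrK; ring.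
Qed.

(** The double integral is iterated, with [y] inside: integrability in [z] then comes from the
    second-difference bound on [a], whereas the product of first differences is not known at this
    point to be jointly integrable. *)
Lemma Int_ell_parts a v (S K : R) : measurable_fun setT a -> (forall x, `|a x| <= S) ->
  (forall y z, `|sd a y z| <= K * mw z) -> integ lam v ->
  integ mu (fun z => \int[lam]_y ((a (y + z) - a y) * (v (y + z) - v y))) /\
  \int[lam]_y (v y * ell a y) =
  - (2^-1 * \int[mu]_z \int[lam]_y ((a (y + z) - a y) * (v (y + z) - v y))).
Proof.
move=> ma aS aK iv.
have Fi : integ (lam \x mu)%E (fun p => v p.1 * sd a p.1 p.2).
  have iK : integ mu (fun z => K * mw z) by exact: integZ.
  have := integ_tensor (integ_norm iv) iK; apply: integ_dom.
    apply: measurable_funM; last exact: measurable_sd.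
    exact: (measurableT_comp (integ_meas iv) measurable_fst).
  by move=> p; rewrite normrM ler_wpM2l.
have E z := Int_sd_parts z ma aS iv.
split.
  have := integN (integ_fubini2 Fi); congr integ; apply/funext => z /=.
  by rewrite E opprK.
rewrite -mulrN -IntN; last first.
  have := integN (integ_fubini2 Fi); congr integ; apply/funext => z /=.
  by rewrite E opprK.
under [in RHS]eq_Int do rewrite -E.
rewrite -(Int_fubini Fi) -IntZ; last exact: integ_fubini1 Fi.
apply: eq_Int => y; rewrite /ell mulrCA; congr (_ * _).
rewrite -IntZ//.
have mk := measurable_slice1 y (measurable_sd ma).
apply: (integ_dom mk (aK y)); exact: integZ.
Qed.

End levy_kernel.

(* Unification would otherwise unfold these when it compares integrals. *)
#[local] Opaque kap Rintegral.

(** * Energy estimate for the pairs [U = L W] *)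

Section soft_threshold.
Context {R : realType}.
Implicit Types e a b : R.

(* The soft threshold turns a function that is small up to an integrable part into
   an integrable one, and [soft_mono] makes it admissible as a test function. *)
Definition soft e a := Num.max (a - e) 0 + Num.min (a + e) 0.

Lemma softP e a : 0 <= e -> [\/ e <= a /\ soft e a = a - e,
  a <= - e /\ soft e a = a + e | `|a| <= e /\ soft e a = 0].
Proof.
move=> e0; rewrite /soft; have [h1|h1] := leP (a - e) 0.
  have [h2|h2] := leP (a + e) 0.
    by apply: Or32; rewrite add0r; split => //; lra.
  by apply: Or33; rewrite addr0; split => //; rewrite ler_norml; apply/andP; split; lra.
have [h2|h2] := leP (a + e) 0; first by lra.
by apply: Or31; rewrite addr0; split => //; lra.
Qed.

Lemma soft_near e a : 0 <= e -> `|soft e a - a| <= e.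
Proof.
move=> e0; case: (softP a e0) => -[h ->].
- by rewrite addrAC subrr sub0r normrN ger0_norm.
- by rewrite addrAC subrr add0r ger0_norm.
- by rewrite sub0r normrN.
Qed.

Lemma soft_le e a g : 0 <= e -> 0 <= g -> `|a| <= e + g -> `|soft e a| <= g.
Proof.
move=> e0 g0; rewrite ler_norml => /andP[h1 h2].
by case: (softP a e0) => -[h ->]; rewrite ler_norml; apply/andP; split; lra.
Qed.

Lemma soft_le_norm e a : 0 <= e -> `|soft e a| <= `|a|.
Proof. by move=> e0; apply: soft_le => //; rewrite lerDr. Qed.

(** Firm nonexpansiveness, the soft threshold being the proximal map of [e |.|]. It turns the
    pairing obtained by testing with [soft e W] into a bound on the energy of [soft e W] itself. *)
Lemma soft_mono e a b : 0 <= e -> (soft e a - soft e b) ^+ 2 <= (a - b) * (soft e a - soft e b).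
Proof.
move=> e0; rewrite expr2 -subr_ge0 -mulrBl.
case: (softP a e0) => -[h ->]; case: (softP b e0) => -[h' ->].
- by rewrite (_ : _ * _ = 0) //; ring.
- apply: mulr_ge0; lra.
- move: h'; rewrite ler_norml => /andP[? ?]; apply: mulr_ge0; lra.
- rewrite -mulrNN; apply: mulr_ge0; lra.
- by rewrite (_ : _ * _ = 0) //; ring.
- move: h'; rewrite ler_norml => /andP[? ?]; rewrite -mulrNN; apply: mulr_ge0; lra.
- move: h; rewrite ler_norml => /andP[? ?]; rewrite -mulrNN; apply: mulr_ge0; lra.
- move: h; rewrite ler_norml => /andP[? ?]; apply: mulr_ge0; lra.
- by rewrite subrr mulr0.
Qed.

Lemma soft_lip e a b : 0 <= e -> `|soft e a - soft e b| <= `|a - b|.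
Proof.
move=> e0; have := soft_mono a b e0; set s := soft e a - soft e b => H.
have [->|s0] := eqVneq s 0; first by rewrite normr0.
have sp : 0 < `|s| by rewrite normr_gt0.
rewrite -(ler_pM2r sp) -!normrM -[s * s]expr2 ger0_norm ?sqr_ge0//.
by apply: le_trans H _; rewrite ler_norm.
Qed.

Lemma soft_measurable d (T : measurableType d) e (f : T -> R) :
  measurable_fun setT f -> measurable_fun setT (fun x => soft e (f x)).
Proof.
move=> mf; apply: measurable_funD.
  by apply: measurable_maxr => //; exact: measurable_funB.
by apply: measurable_minr => //; exact: measurable_funD.
Qed.

End soft_threshold.

(** * Mollification *)

Section mollification.
Context {R : realType} (N : nat).
Local Notation X := 'rV[R]_N.
Local Notation lam := (@lebesgue_rV R N).
Implicit Types (f g : X -> R) (d : R).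

Definition mo d f y := (\int[lam]_x (kap d x : R))^-1 * conv d f y.

Lemma measurable_kap_sub d : measurable_fun setT (fun p : X * X => kap d (p.1 - p.2)).
Proof. exact: (measurableT_comp (@kap_measurable R N d) (@measurable_subX R N)). Qed.

Lemma kap_shift d (x : X) : \int[lam]_y kap d (x - y) = \int[lam]_y (kap d y : R).
Proof.
rewrite -(Int_shift (- x) (@kap_measurable R N d)); apply: eq_Int => y.
by rewrite -kapN opprB.
Qed.

Lemma conv_integ2 d f : integ lam f ->
  integ (lam \x lam)%E (fun p => f p.1 * kap d (p.1 - p.2)).
Proof.
move=> fi; have ik := kap_integ N d.
have ik' (x : X) : integ lam (fun y => kap d (x - y)).
  have := integ_shift (- x) ik; congr integ; apply/funext => y.
  by rewrite -kapN opprB.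
apply: (integ_prod1 (g := fun x => (\int[lam]_x (kap d x : R)) * `|f x|)).
- apply: measurable_funM; last exact: measurable_kap_sub.
  exact: (measurableT_comp (integ_meas fi) measurable_fst).
- exact/integZ/integ_norm.
- move=> x /=; rewrite -Int_EFin; last exact: integ_norm (integZ _ (ik' x)).
  rewrite lee_fin; under eq_Int do rewrite normrM (ger0_norm (kap_ge0 _ _)).
  by rewrite IntZ// kap_shift mulrC.
Qed.

Lemma mo_integ d f : integ lam f -> integ lam (mo d f).
Proof. by move=> fi; apply: integZ; exact: (integ_fubini2 (conv_integ2 d fi)). Qed.

Lemma mo_bounded d f (S : R) y : 0 < d -> measurable_fun setT f ->
  (forall x, `|f x| <= S) -> `|mo d f y| <= S.
Proof.
move=> d0 mf fS; have c0 := kap_Int_gt0 N d0.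
rewrite /mo normrM gtr0_norm ?invr_gt0// ler_pdivrMl//.
by rewrite mulrC; exact: conv_bounded.
Qed.

Lemma mo_measurable d f (S : R) : measurable_fun setT f -> (forall x, `|f x| <= S) ->
  measurable_fun setT (mo d f).
Proof. by move=> mf fS; apply: measurable_funM => //; exact: conv_measurable fS. Qed.

Lemma mo_adjoint d f g (S : R) : integ lam f -> measurable_fun setT g ->
  (forall x, `|g x| <= S) -> \int[lam]_x (f x * mo d g x) = \int[lam]_x (mo d f x * g x).
Proof.
move=> fi mg gS; have Fi : integ (lam \x lam)%E (fun p => g p.2 * (f p.1 * kap d (p.1 - p.2))).
  apply: (@integMb _ _ _ _ _ (fun p => g p.2) S); last exact: conv_integ2.
    exact: (measurableT_comp mg measurable_snd).
  by move=> p.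
have E1 x : f x * conv d g x = \int[lam]_y (g y * (f x * kap d (x - y))).
  rewrite /conv -IntZ; last exact: bounded_kap_integ gS.
  by apply: eq_Int => y; rewrite -(kapN d (x - y)) opprB mulrCA.
have E2 : {ae lam, forall y, conv d f y * g y = \int[lam]_x (g y * (f x * kap d (x - y)))}.
  apply: filterS (integ_ae2 (conv_integ2 d fi)) => y yi.
  by rewrite mulrC /conv -IntZ.
have m2 := integ_meas (integ_fubini2 Fi).
have ic := integ_fubini2 (conv_integ2 d fi).
have i2 : integ lam (fun y => conv d f y * g y).
  by under eq_fun do rewrite mulrC; exact: integMb mg gS ic.
have i1 : integ lam (fun x => f x * conv d g x).
  have := integ_fubini1 Fi; congr integ; apply/funext => x.
  by rewrite E1.
have E : \int[lam]_x (f x * conv d g x) = \int[lam]_y (conv d f y * g y).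
  under eq_Int do rewrite E1.
  have /= -> := Int_fubini Fi.
  by apply/esym; exact: (Int_ae (integ_meas i2) m2 E2).
rewrite /mo; move: (_^-1) => c.
under eq_Int do rewrite mulrCA.
under [in RHS]eq_Int do rewrite -mulrA.
by rewrite (IntZ _ i1) (IntZ _ i2) E.
Qed.

(** [mo d f - f] is an average of the translation differences of [f] over shifts in the cube of
    radius [d]; after exchanging the integrals, continuity of translations in L^1 bounds each
    difference. *)
Lemma mo_cvg f : integ lam f -> forall e : R, 0 < e -> exists2 d0 : R, 0 < d0 &
  forall d, 0 < d < d0 -> \int[lam]_y `|mo d f y - f y| <= e.
Proof.
move=> fi e e0; have [_ /(_ e e0)[d0 d00 H]] := integ_L1_continuous fi.
exists d0 => // d /andP[dp dd]; have c0 := kap_Int_gt0 N dp.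
have ik := kap_integ N d.
have [c [cE moE]] : exists c : R, \int[lam]_x (kap d x : R) = c /\
    forall f y, mo d f y = c^-1 * conv d f y by eexists.
rewrite cE in c0.
pose G (p : X * X) := `|f (p.2 + p.1) - f p.2| * kap d p.1.
have mG : measurable_fun setT G.
  apply: measurable_funM; last exact: (measurableT_comp (@kap_measurable R N d) measurable_fst).
  apply: measurableT_comp => //; apply: measurable_funB.
    have := measurableT_comp (integ_meas fi) (@measurable_addX R N).
    move=> h; rewrite (_ : (fun x => _) = (f \o (fun p : X * X => p.1 + p.2)))//.
    by apply/funext => p /=; rewrite addrC.
  exact: (measurableT_comp (integ_meas fi) measurable_snd).
have GE s : \int[lam]_y G (s, y) <= e * kap d s.
  have [k0|k0] := eqVneq (kap d s) 0.
    by rewrite k0 mulr0 Int0// => y; rewrite /G/= k0 mulr0.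
  under eq_Int do rewrite /G/= mulrC.
  rewrite IntZ; last exact: integ_diff.
  rewrite mulrC ler_wpM2r ?kap_ge0//; apply: H.
  by rewrite (lt_trans _ dd)//; apply/rV_norm_lt => //; exact: kap_support.
have iGs s : integ lam (fun y => G (s, y)).
  by rewrite /G/=; under eq_fun do rewrite mulrC; apply: integZ; exact: integ_diff.
have Gi : integ (lam \x lam)%E G.
  apply: (integ_prod1 (g := fun s => e * kap d s)) => //; first exact: integZ.
  move=> s; rewrite -Int_EFin; last exact: integ_norm.
  rewrite lee_fin; apply: le_trans (GE s); apply: Int_le => //; first exact: integ_norm.
  by move=> y; rewrite ger0_norm// mulr_ge0// kap_ge0.
apply: (@le_trans _ _ (c^-1 * \int[lam]_y \int[lam]_s G (s, y))); last first.
  rewrite -(Int_fubini Gi) ler_pdivrMl// mulrC.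
  rewrite -cE -(IntZ e ik); apply: Int_le => //; first exact: integ_fubini1.
  exact: integZ.
rewrite -IntZ; last exact: integ_fubini2.
apply: ae_Int_le.
- by apply: integ_norm; apply: integB => //; exact: mo_integ.
- by apply: integZ; exact: integ_fubini2.
have h1 := integ_ae2 Gi; have h2 := integ_ae2 (conv_integ2 d fi).
move: h1 h2; apply: filterS2 => y /= Gy fy.
have fy' : integ lam (fun s => f (s + y) * kap d s).
  have := integ_shift y fy; congr integ; apply/funext => s.
  by rewrite addrK.
have -> : mo d f y - f y = c^-1 * \int[lam]_s ((f (y + s) - f y) * kap d s).
  rewrite moE /conv -(Int_shift y (f := fun x => f x * kap d (x - y))); last exact: integ_meas fy.
  rewrite (_ : \int[lam]_s ((f (y + s) - f y) * kap d s) =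
    \int[lam]_s (f (s + y) * kap d s) - \int[lam]_s (f y * kap d s)).
    rewrite (IntZ (f y) ik) cE mulrBr mulrCA mulVf ?gt_eqF// mulr1.
    have -> // : \int[lam]_x (f (x + y) * kap d (x + y - y)) = \int[lam]_s (f (s + y) * kap d s).
    by apply: eq_Int => s; rewrite addrK.
  rewrite -IntB//; last exact: integZ.
  by apply: eq_Int => s; rewrite mulrBl [s + y]addrC.
rewrite normrM gtr0_norm ?invr_gt0// ler_pM2l ?invr_gt0//.
apply: le_trans (Int_norm _) _.
  have := integB fy' (integZ (f y) ik); congr integ; apply/funext => s.
  by rewrite mulrBl [s + y]addrC.
by rewrite le_eqVlt; apply/orP; left; apply/eqP/eq_Int => s; rewrite normrM (ger0_norm (kap_ge0 _ _)).
Qed.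

Lemma mo_local d f g (y : X) : (forall x, `|x - y| < d -> f x = g x) -> 0 < d ->
  mo d f y = mo d g y.
Proof.
move=> fg d0; congr (_ * _); apply: eq_Int => x.
have [->|k0] := eqVneq (kap d (x - y)) 0; first by rewrite !mulr0.
by rewrite fg//; apply/rV_norm_lt => //; exact: kap_support.
Qed.

(** A bounded function need not be integrable. For [d < 1], however, its mollification on the cube
    of radius [n] only sees the cube of radius [n + 1], so [f] may be replaced there by its
    restriction [g]. *)
Lemma mo_cvg_loc f (S : R) : measurable_fun setT f -> (forall x, `|f x| <= S) ->
  forall (n : nat) (e : R), 0 < e -> exists2 d0 : R, 0 < d0 &
  forall d, 0 < d < d0 ->
   \int[lam]_y (`|mo d f y - f y| * \1_(cube n%:R) y) <= e.
Proof.
move=> mf fS n e e0.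
have i1 (m : nat) : integ lam (\1_(cube m%:R) : X -> R).
  by apply: integ_indic; [exact: cube_measurable|exact: cube_fin].
pose g (x : X) := f x * \1_(cube n.+1%:R) x.
have ig : integ lam g by apply: integMb mf fS _.
have [d0 d00 H] := mo_cvg ig e0.
exists (Num.min d0 1) => [|d]; first by rewrite lt_min d00 ltr01.
rewrite lt_min => /and3P[dp dd d1]; apply: le_trans (H d _); last by rewrite dp dd.
apply: Int_le.
- under eq_fun do rewrite mulrC; apply: (integ_dom (g := fun y => (S + S) * \1_(cube n%:R) y)); last exact: integZ.
    apply: measurable_funM; first by apply: measurable_indic; exact: cube_measurable.
    by apply: measurableT_comp => //; apply: measurable_funB => //; exact: mo_measurable fS.
  move=> y; rewrite normrM normr_id mulrC.
  have -> : `|\1_(cube n%:R) y| = \1_(cube n%:R) y :> R by rewrite ger0_norm// indicE.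
  rewrite ler_wpM2r// ?indicE//.
  by rewrite (le_trans (ler_normB _ _))// lerD//; exact: mo_bounded.
- by apply: integ_norm; apply: integB => //; exact: mo_integ.
move=> y; rewrite indicE; have [|_] := boolP (y \in _); last by rewrite mulr0.
rewrite inE => yn; rewrite mulr1.
have sub (x : X) : `|x - y| < 1 -> cube n.+1%:R x.
  move=> xy i; rewrite (_ : x 0 i = (x - y) 0 i + y 0 i); last by rewrite !mxE subrK.
  rewrite (le_lt_trans (ler_normD _ _))// -natr1 addrC ltrD//.
  by rewrite (le_lt_trans (coord_le_norm _ _)).
rewrite (@mo_local d f g)//; last first.
  by move=> x xy; rewrite /g indicE mem_set ?mulr1//; apply: sub; exact: lt_trans xy d1.
by rewrite /g indicE mem_set ?mulr1//; apply: sub; rewrite subrr normr0.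
Qed.

End mollification.

(** * The energy form and its lower semicontinuity *)

Section energy_form.
Context {R : realType} (N : nat).
Local Notation X := 'rV[R]_N.
Local Notation lam := (@lebesgue_rV R N).
Variable mu : {sigma_finite_measure set X -> \bar R}.
Implicit Types (f g U W : X -> R) (d e : R).

(* Twice the energy, with the two integrals exchanged so that Fatou's lemma can be
   applied for each fixed [z]. *)
Definition EE f : \bar R :=
  (\int[mu]_z \int[lam]_x ((f (x + z)%R - f x) ^+ 2)%:E)%E.

Lemma measurable_diff f : measurable_fun setT f ->
  measurable_fun setT (fun p : X * X => f (p.1 + p.2) - f p.1).
Proof.
move=> mf; apply: measurable_funB.
  exact: (measurableT_comp mf (@measurable_addX R N)).
exact: (measurableT_comp mf measurable_fst).
Qed.

Lemma measurable_diff2 f : measurable_fun setT f ->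
  measurable_fun setT (fun p : X * X => ((f (p.1 + p.2) - f p.1) ^+ 2)%:E).
Proof.
by move=> mf; apply/measurable_EFinP; apply: measurable_funX; exact: measurable_diff.
Qed.

Lemma EE_ge0 f : (0 <= EE f)%E.
Proof. by apply: integral_ge0 => z _; apply: integral_ge0 => x _; rewrite lee_fin sqr_ge0. Qed.

Lemma EE_slice_measurable f : measurable_fun setT f ->
  measurable_fun setT (fun z : X => \int[lam]_x ((f (x + z)%R - f x) ^+ 2)%:E)%E.
Proof.
move=> mf; apply: (measurable_fun_fubini_tonelli_G (m1 := lam)
  (fun p : X * X => ((f (p.1 + p.2) - f p.1) ^+ 2)%:E)).
- exact: measurable_diff2.
- by move=> p; rewrite lee_fin sqr_ge0.
Qed.

(** Fatou's lemma is used twice, in [x] for each fixed [z] and then in [z]. The translate of the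
    exceptional null set is again null, so the differences converge almost everywhere for every
    [z]. *)
Lemma EE_fatou (F : nat -> X -> R) f : (forall k, measurable_fun setT (F k)) ->
  measurable_fun setT f -> {ae lam, forall x, F ^~ x @ \oo --> f x} ->
  (EE f <= limn_einf (fun k => EE (F k)))%E.
Proof.
move=> mF mf Ff.
have mF2 k z : measurable_fun setT (fun x : X => ((F k (x + z) - F k x) ^+ 2)%:E).
  exact: (measurable_slice2 z (measurable_diff2 (mF k))).
have mf2 z : measurable_fun setT (fun x : X => ((f (x + z) - f x) ^+ 2)%:E).
  exact: (measurable_slice2 z (measurable_diff2 mf)).
have step z : (\int[lam]_x ((f (x + z)%R - f x) ^+ 2)%:E <=
    limn_einf (fun k => \int[lam]_x ((F k (x + z)%R - F k x) ^+ 2)%:E))%E.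
  apply: le_trans (fatou _ measurableT (fun k => mF2 k z) _); last first.
    by move=> k x _; rewrite lee_fin sqr_ge0.
  apply: ae_ge0_le_integral => //.
  - by move=> x _; rewrite lee_fin sqr_ge0.
  - move=> x _; rewrite limn_einf_lim; apply: lime_ge; first exact: is_cvg_einfs.
    by apply: nearW => k; apply: le_ereal_inf_tmp => _ [j _ <-]; rewrite lee_fin sqr_ge0.
  - apply: (measurableT_comp (@oppe_measurable R setT)).
    apply: (@measurable_fun_limn_esup _ X R setT
      (fun k x => - ((F k (x + z) - F k x) ^+ 2)%:E)%E) => k.
    exact: (measurableT_comp (@oppe_measurable R setT) (mF2 k z)).
  have Ffz : {ae lam, forall x, F ^~ (x + z) @ \oo --> f (x + z)}.
    case: Ff => A [mA A0 HA].
    exists ((fun x => x + z) @^-1` A); split.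
    - by rewrite -[X in measurable X]setTI; exact: measurable_addmx.
    - by rewrite lebesgue_rV_shift.
    - by move=> x /= H; apply: HA.
  move: Ff Ffz; apply: filterS2 => x Fx Fxz _.
  have c : (fun k => ((F k (x + z) - F k x) ^+ 2)%:E) @ \oo --> ((f (x + z) - f x) ^+ 2)%:E.
    apply: cvg_EFin; first exact: nearW.
    have cd : (fun k => F k (x + z) - F k x) @ \oo --> f (x + z) - f x by exact: cvgB.
    by under eq_fun do rewrite expr2; rewrite expr2; apply: cvgM.
  rewrite is_cvg_limn_einfE; last by apply/cvg_ex; eexists; exact: c.
  by rewrite (cvg_lim _ c).
apply: le_trans (fatou mu measurableT (fun k => EE_slice_measurable (mF k)) _); last first.
  by move=> k z _; apply: integral_ge0 => x _; rewrite lee_fin sqr_ge0.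
apply: ge0_le_int => z _; last exact: step.
by apply: integral_ge0 => x _; rewrite lee_fin sqr_ge0.
Qed.

(** The rates are summable, so the series of the [h k] has a finite integral and converges almost
    everywhere; its terms then tend to 0. Prescribing the rate replaces the extraction of a
    subsequence. *)
Lemma ae_cvg_of_L1 (h : nat -> X -> R) : (forall k, integ lam (h k)) ->
  (forall k x, 0 <= h k x) -> (forall k, \int[lam]_x h k x <= 1 / (2 ^ k.+1)%:R) ->
  {ae lam, forall x, h ^~ x @ \oo --> (0 : R)}.
Proof.
move=> ih h0 hk.
have mh k : measurable_fun setT (fun x => (h k x)%:E) by exact/measurable_EFinP/integ_meas.
have Soo : (\int[lam]_x (\sum_(0 <= k <oo) (h k x)%:E) < +oo)%E.
  rewrite integral_nneseries//; last by move=> k x _; rewrite lee_fin.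
  apply: (@le_lt_trans _ _ (\sum_(0 <= k <oo) (1 / (2 ^ k.+1)%:R)%:E)%E); last first.
    exact: le_lt_trans (epsilon_trick0 xpredT (@ler01 R)) (ltry _).
  apply: lee_nneseries => [k _ _|k _].
    by apply: integral_ge0 => x _; rewrite lee_fin.
  by rewrite -Int_EFin// lee_fin.
have Si : lam.-integrable setT (fun x => \sum_(0 <= k <oo) (h k x)%:E)%E.
  apply/integrableP; split.
    by apply: ge0_emeasurable_sum => // k x _ _; rewrite lee_fin.
  have S0 x : (0 <= \sum_(0 <= k <oo) (h k x)%:E)%E.
    by apply: nneseries_ge0 => k _ _; rewrite lee_fin.
  by under eq_integral => x _ do rewrite (gee0_abs (S0 x)).
apply: filterS (integrable_ae measurableT Si) => x /(_ I) fx.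
apply: cvg_series_cvg_0.
apply: nondecreasing_is_cvgn.
  by apply: nondecreasing_series => k _ _; exact: h0.
exists (fine (\sum_(0 <= k <oo) (h k x)%:E)) => _ [n _ <-].
rewrite -lee_fin fineK//= /series/= -sumEFin.
by apply: nneseries_lim_ge => k _ _; rewrite lee_fin.
Qed.

(** A diagonal choice: the function number [n] is taken close on the cube of radius [n] with a
    summable error, and each point lies in all cubes from some radius on. *)
Lemma loc_approx (Q : (X -> R) -> Prop) f :
  (forall (n : nat) (e : R), 0 < e -> exists g, [/\ Q g,
    integ lam (fun x => `|g x - f x| * \1_(cube n%:R) x) &
    \int[lam]_x (`|g x - f x| * \1_(cube n%:R) x) <= e]) ->
  exists2 F : nat -> X -> R, forall n, Q (F n) &
    {ae lam, forall x, F ^~ x @ \oo --> f x}.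
Proof.
move=> H.
have /choice[F HF] : forall n : nat, exists g, [/\ Q g,
    integ lam (fun x => `|g x - f x| * \1_(cube n%:R) x) &
    \int[lam]_x (`|g x - f x| * \1_(cube n%:R) x) <= 1 / (2 ^ n.+1)%:R].
  by move=> n; apply: H; rewrite divr_gt0// ltr0n expn_gt0.
exists F => [n|]; first by case: (HF n).
apply: filterS (@ae_cvg_of_L1 (fun n x => `|F n x - f x| * \1_(cube n%:R) x) _ _ _).
- move=> x /cvgr0Pnorm_lt Hx; apply/cvgrPdist_lt => e e0.
  have [m _ xm] : (\bigcup_n cube n%:R) x by rewrite cube_bigcup.
  near=> n.
  have : `| `|F n x - f x| * \1_(cube n%:R) x | < e by near: n; exact: Hx.
  rewrite indicE mem_set ?mulr1 ?normr_id 1?distrC// => i.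
  apply: lt_le_trans (xm i) _; rewrite ler_nat; near: n.
  by exists m.
- by move=> k; case: (HF k).
- by move=> k x; rewrite mulr_ge0// indicE.
- by move=> k; case: (HF k).
Unshelve. all: by end_near. Qed.

(** Lower semicontinuity under local L^1 convergence, with one approximant per cube and tolerance,
    so that each limit passage only has to choose its parameters. *)
Lemma EE_lsc f (c : \bar R) : measurable_fun setT f ->
  (forall (n : nat) (e : R), 0 < e -> exists g, [/\ measurable_fun setT g,
    integ lam (fun x => `|g x - f x| * \1_(cube n%:R) x),
    \int[lam]_x (`|g x - f x| * \1_(cube n%:R) x) <= e & (EE g <= c)%E]) ->
  (EE f <= c)%E.
Proof.
move=> mf H.
have [|F HF aeF] := @loc_approx (fun g => measurable_fun setT g /\ (EE g <= c)%E) f.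
  by move=> n e e0; have [g [mg ig Ig gc]] := H n e e0; exists g.
apply: le_trans (EE_fatou (fun k => proj1 (HF k)) mf aeF) _.
rewrite limn_einf_lim; apply: lime_le.
  exact: is_cvg_einfs.
apply: nearW => k; apply: le_trans (ereal_inf_lbound _) (proj2 (HF k)).
by exists k => //=.
Qed.

End energy_form.

(** * Weak pairs: energy bound and symmetry *)

Section levy_pairs.
Context {R : realType} (N : nat).
Local Notation X := 'rV[R]_N.
Local Notation lam := (@lebesgue_rV R N).
Variable mu : {sigma_finite_measure set X -> \bar R}.
Hypothesis mu_even : forall A : set X, measurable A -> mu (-%R @^-1` A) = mu A.
Hypothesis mu_mw : integ mu (@mw R N).
Implicit Types (f g U W a v : X -> R) (d e : R).

(** The substitute for integrability of [W]. Since [phi] is only continuous at 0, [phi(u)] need not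
    be integrable, but for every [e] it is at most [e] plus an integrable function. *)
Definition vanishing W := forall e, 0 < e -> exists2 g, integ lam g &
  forall x, 0 <= g x /\ `|W x| <= e + g x.

(* [U = L W], tested against all translates of the kernels [kap d]. *)
Definition levy_pair U W := [/\ integ lam U, measurable_fun setT W,
  (exists S : R, forall x, `|W x| <= S), vanishing W &
  forall d y, 0 < d -> conv d U y = \int[lam]_x (W x * ell mu (kap d) (x - y))].

Lemma convB d f g y : integ lam (fun x => f x * kap d (x - y)) ->
  integ lam (fun x => g x * kap d (x - y)) ->
  conv d (fun x => f x - g x) y = conv d f y - conv d g y.
Proof.
by move=> fi gi; rewrite /conv -IntB//; apply: eq_Int => x; rewrite mulrBl.
Qed.

Lemma integ_kap d f y : integ lam f -> integ lam (fun x => f x * kap d (x - y)).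
Proof.
move=> fi; under eq_fun do rewrite mulrC.
apply: (integMb (C := 1)) fi.
  exact: (measurableT_comp (@kap_measurable R N d) (measurable_addmx (- y))).
by move=> x; rewrite ger0_norm ?kap_ge0// kap_le1.
Qed.

Lemma integ_ell d f (S : R) y : measurable_fun setT f -> (forall x, `|f x| <= S) ->
  integ lam (fun x => f x * ell mu (kap d) (x - y)).
Proof.
move=> mf fS; apply: integMb mf fS _.
by apply: (integ_shift (- y)); exact: ell_integ.
Qed.

Lemma levy_pairB U1 W1 U2 W2 : levy_pair U1 W1 -> levy_pair U2 W2 ->
  levy_pair (fun x => U1 x - U2 x) (fun x => W1 x - W2 x).
Proof.
move=> [i1 m1 [S1 s1] v1 e1] [i2 m2 [S2 s2] v2 e2]; split.
- exact: integB.
- exact: measurable_funB.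
- by exists (S1 + S2) => x; rewrite (le_trans (ler_normB _ _))// lerD.
- move=> e e0; have e20 : 0 < e / 2 by rewrite divr_gt0.
  have [g1 ig1 h1] := v1 _ e20; have [g2 ig2 h2] := v2 _ e20.
  exists (fun x => g1 x + g2 x) => [|x]; first exact: integD.
  have [p1 q1] := h1 x; have [p2 q2] := h2 x; split; first exact: addr_ge0.
  by rewrite (le_trans (ler_normB _ _))//; lra.
- move=> d y d0; rewrite convB ?integ_kap// e1// e2//.
  rewrite -IntB; [|exact: integ_ell s1|exact: integ_ell s2].
  by apply: eq_Int => x; rewrite mulrBl.
Qed.

(** After mollification [U = L W] holds at every point, and the second differences of [W] are
    controlled well enough to be integrated by parts. *)
Lemma levy_pair_mo U W d : levy_pair U W -> 0 < d ->
  (forall y, mo d U y = ell mu (mo d W) y) /\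
  exists K : R, forall y z, `|sd (mo d W) y z| <= K * mw z.
Proof.
move=> [iU mW [S WS] _ eqn] d0.
have [K K0 HK] := conv_sd_bound d mW WS.
have mc := conv_measurable d mW WS.
rewrite /mo; move: (_^-1) => c.
have sdc y z : sd (fun y => c * conv d W y) y z = c * sd (conv d W) y z.
  by rewrite /sd; move: (conv d W _) (conv d W _) (conv d W _) => p q r; ring.
have ic y : integ mu (sd (conv d W) y).
  apply: (integ_dom _ (HK y)); last exact: integZ.
  exact: (measurable_slice1 y (measurable_sd mc)).
split; last first.
  exists (`|c| * K) => y z; rewrite sdc normrM -mulrA ler_wpM2l//.
move=> y; rewrite eqn// (conv_ell mu_mw d y mW WS) /ell.
under [in RHS]eq_Int do rewrite sdc.
by rewrite (IntZ c (ic y)) mulrCA.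
Qed.

Lemma levy_pair_test U W d v : levy_pair U W -> 0 < d -> integ lam v ->
  let D z := \int[lam]_y ((mo d W (y + z) - mo d W y) * (v (y + z) - v y)) in
  integ mu D /\ \int[lam]_y (v y * mo d U y) = - (2^-1 * \int[mu]_z D z).
Proof.
move=> UW d0 iv D; have [E [K HK]] := levy_pair_mo UW d0.
case: UW => [iU mW [S WS] _ _].
have [iD ED] := Int_ell_parts mu_mw (mo_measurable d mW WS)
  (fun x => mo_bounded x d0 mW WS) HK iv.
split; first exact: iD.
by rewrite -ED; apply: eq_Int => y; rewrite E.
Qed.

Lemma mo_vanishing W d : 0 < d -> measurable_fun setT W ->
  (exists S : R, forall x, `|W x| <= S) -> vanishing W -> vanishing (mo d W).
Proof.
move=> d0 mW [S WS] vW e e0; have [g ig Hg] := vW e e0.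
exists (mo d g) => [|y]; first exact: mo_integ.
have ik := integ_shift (- y) (kap_integ N d).
have ig' := integ_kap d y ig.
have [c [c0 moE cE]] : exists c : R, [/\ 0 < c, forall f y, mo d f y = c^-1 * conv d f y &
    c = \int[lam]_x (kap d (x - y) : R)].
  exists (\int[lam]_x (kap d x : R)).
  split; [exact: kap_Int_gt0|by move=> f z; rewrite /mo|].
  by rewrite (Int_shift (- y) (@kap_measurable R N d)).
have c'0 : 0 < c^-1 by rewrite invr_gt0.
rewrite !moE /conv; split.
  apply: mulr_ge0; first exact: ltW.
  by apply: Int_ge0 => x; rewrite mulr_ge0 ?kap_ge0//; case: (Hg x).
rewrite normrM gtr0_norm// ler_pdivrMl// mulrDr mulrA divff ?gt_eqF// mul1r.
apply: (@le_trans _ _ (\int[lam]_x (e * kap d (x - y) + g x * kap d (x - y)))).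
  apply: Int_norm_le.
  - exact: bounded_kap_integ WS.
  - by apply: integD => //; exact: integZ.
  - move=> x; rewrite normrM [`|kap _ _|]ger0_norm ?kap_ge0// -mulrDl ler_wpM2r ?kap_ge0//.
    by case: (Hg x).
rewrite IntD//; last exact: integZ.
by rewrite IntZ// -cE mulrC.
Qed.

Lemma soft_integ W e : 0 < e -> measurable_fun setT W -> vanishing W ->
  integ lam (fun x => soft e (W x)).
Proof.
move=> e0 mW /(_ e e0)[g ig Hg]; apply: (integ_dom _ _ ig); first exact: soft_measurable.
by move=> x; have [g0 Wg] := Hg x; apply: soft_le => //; exact: ltW.
Qed.

Lemma soft_test W f e : 0 < e -> measurable_fun setT W ->
  (exists S : R, forall x, `|W x| <= S) -> vanishing W -> integ lam f ->
  `|\int[lam]_x (soft e (W x) * f x) - \int[lam]_x (W x * f x)| <= e * \int[lam]_x `|f x|.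
Proof.
move=> e0 mW [S WS] vW fi.
have mS := soft_measurable e mW.
have i1 : integ lam (fun x => soft e (W x) * f x).
  apply: (integMb (C := S)) => // x.
  by rewrite (le_trans (soft_le_norm _ (ltW e0))).
have i2 : integ lam (fun x => W x * f x) by exact: integMb mW WS fi.
rewrite -IntB// -IntZ; last exact: integ_norm.
apply: Int_norm_le; [exact: integB|exact/integZ/integ_norm|move=> x].
by rewrite -mulrBl normrM ler_wpM2r// soft_near// ltW.
Qed.

(** Testing the mollified equation with the integrable function [soft e (mo d W)], and applying
    [soft_mono] for each [z] separately. The factor 2 is the one between [EE] and the energy. *)
Lemma EE_soft U W d e : levy_pair U W -> 0 < d -> 0 < e ->
  (EE mu (fun x => soft e (mo d W x)) <= (- 2 * \int[lam]_y (soft e (mo d W y) * mo d U y))%:E)%E.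
Proof.
move=> UW d0 e0; have [iU mW bW vW _] := UW; have [S WS] := bW.
have ma := mo_measurable d mW WS.
have va := mo_vanishing d0 mW bW vW.
have aS y := mo_bounded y d0 mW WS.
have iv := soft_integ e0 ma va.
have [iD ->] := levy_pair_test UW d0 iv.
set v := fun x => _ in iv *; set D := fun z => _ in iD *.
have vS y : `|v y| <= S by rewrite (le_trans (soft_le_norm _ (ltW e0))).
rewrite (_ : -2 * _ = \int[mu]_z D z); last first.
  by rewrite mulrNN mulrA divff ?mul1r.
rewrite Int_EFin//; apply: ge0_le_int => z _.
  by apply: integral_ge0 => x _; rewrite lee_fin sqr_ge0.
have mdv : measurable_fun setT (fun x : X => v (x + z) - v x).
  exact: (measurable_slice2 z (measurable_diff (integ_meas iv))).
have mda : measurable_fun setT (fun x : X => mo d W (x + z) - mo d W x).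
  exact: (measurable_slice2 z (measurable_diff ma)).
have idv : integ lam (fun x : X => v (x + z) - v x).
  exact: (integB (integ_shift z iv) iv).
have b2 (f : X -> R) : (forall y, `|f y| <= S) -> forall x, `|f (x + z) - f x| <= S + S.
  by move=> fS x; rewrite (le_trans (ler_normB _ _))// lerD.
have i1 : integ lam (fun x : X => (v (x + z) - v x) ^+ 2).
  under eq_fun do rewrite expr2.
  exact: (integMb mdv (b2 _ vS)).
rewrite -Int_EFin// lee_fin /D; apply: Int_le => //.
  exact: (integMb mda (b2 _ aS)).
by move=> x; apply: soft_mono; exact: ltW.
Qed.

Lemma EE_mo U W d : levy_pair U W -> 0 < d ->
  (EE mu (mo d W) <= (- 2 * \int[lam]_y (mo d W y * mo d U y))%:E)%E.
Proof.
move=> UW d0; have [iU mW bW vW _] := UW; have [S WS] := bW.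
have ma := mo_measurable d mW WS.
have va := mo_vanishing d0 mW bW vW.
have aS y := mo_bounded y d0 mW WS.
have iUd := mo_integ d iU.
apply/lee_addgt0Pr => eta eta0; apply: EE_lsc => // n r r0.
pose V := \int[lam]_x \1_(cube n%:R) (x : X) : R.
have iV : integ lam (\1_(cube n%:R) : X -> R).
  by apply: integ_indic; [exact: cube_measurable|exact: cube_fin].
have V0 : 0 <= V by apply: Int_ge0 => x; rewrite indicE.
pose I := \int[lam]_y `|mo d U y|.
have I0 : 0 <= I by exact: Int_ge0.
(* The threshold moves a function by at most [e]: the first bound makes this at most [r] in L^1 on
   the cube of volume [V], the second makes the error [2 e I] in the pairing at most [eta]. *)
pose e := Num.min (r / (V + 1)) (eta / (2 * (I + 1))).
have e0 : 0 < e by rewrite lt_min !divr_gt0// ?mulr_gt0// ltr_wpDl.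
have e1 : e * V <= r.
  apply: (@le_trans _ _ (r / (V + 1) * (V + 1))); last by rewrite divfK// gt_eqF// ltr_wpDl.
  by rewrite ler_pM// ?(ltW e0)// ?ge_min ?lexx// lerDl.
have e2 : 2 * (e * I) <= eta.
  apply: (@le_trans _ _ (2 * (eta / (2 * (I + 1)) * (I + 1)))).
    by rewrite ler_wpM2l// ler_pM// ?(ltW e0)// ?ge_min ?lexx ?orbT// lerDl.
  rewrite le_eqVlt; apply/orP; left; apply/eqP; field.
  by rewrite gt_eqF// ltr_wpDl.
have m1 : measurable_fun setT (fun x => `|soft e (mo d W x) - mo d W x| * \1_(cube n%:R) x).
  apply: measurable_funM; last exact: integ_meas iV.
  by apply: measurableT_comp => //; apply: measurable_funB => //; exact: soft_measurable.
have b1 x : `|soft e (mo d W x) - mo d W x| * \1_(cube n%:R) x <= e * \1_(cube n%:R) x.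
  by rewrite ler_wpM2r ?indicE// soft_near// ltW.
have i1 : integ lam (fun x => `|soft e (mo d W x) - mo d W x| * \1_(cube n%:R) x).
  apply: (integ_dom m1 _ (integZ e iV)) => x.
  by rewrite ger0_norm// mulr_ge0// indicE.
exists (fun x => soft e (mo d W x)); split => //.
- exact: soft_measurable.
- by apply: le_trans e1; rewrite /V -IntZ//; apply: Int_le => //; exact: integZ.
- apply: le_trans (EE_soft UW d0 e0) _; rewrite -EFinD lee_fin.
  have := soft_test e0 ma (ex_intro _ S aS) va iUd.
  by rewrite -/I ler_norml => /andP[? ?]; lra.
Qed.

(** A mollified bounded function need not converge in a global norm. Adjointness moves the mollifier
    onto the integrable [f], and the convergence of [mo d f] in L^1 is used twice. *)
Lemma mo_pairing f g (S : R) : integ lam f -> measurable_fun setT g ->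
  (forall x, `|g x| <= S) -> forall e, 0 < e -> exists2 d0 : R, 0 < d0 &
  forall d, 0 < d < d0 ->
    `|\int[lam]_x (mo d g x * mo d f x) - \int[lam]_x (g x * f x)| <= e.
Proof.
move=> fi mg gS e e0.
have S0 : 0 <= S by exact: le_trans (normr_ge0 _) (gS 0).
have q0 : 0 < e / (2 * S + 1) by rewrite divr_gt0// ltr_wpDl// mulr_ge0.
have [d0 d00 H] := mo_cvg fi q0.
exists d0 => // d dd; have dp : 0 < d by case/andP: dd.
have mm := mo_measurable d mg gS.
have mS x := mo_bounded x dp mg gS.
have ifd := mo_integ d fi.
have idf : integ lam (fun x => mo d f x - f x) by exact: integB.
have bound (h : X -> R) : measurable_fun setT h -> (forall x, `|h x| <= S) ->
    `|\int[lam]_x (h x * (mo d f x - f x))| <= S * \int[lam]_x `|mo d f x - f x|.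
  move=> mh hS; rewrite -IntZ; last exact: integ_norm.
  apply: Int_norm_le; [exact: integMb mh hS idf|exact/integZ/integ_norm|move=> x].
  by rewrite normrM ler_wpM2r.
have i1 : integ lam (fun x => mo d g x * (mo d f x - f x)) by exact: integMb mm mS idf.
have i2 : integ lam (fun x => g x * (mo d f x - f x)) by exact: integMb mg gS idf.
have i3 : integ lam (fun x => mo d g x * f x) by exact: integMb mm mS fi.
have i4 : integ lam (fun x => g x * f x) by exact: integMb mg gS fi.
have i5 : integ lam (fun x => g x * mo d f x) by exact: integMb mg gS ifd.
have E : \int[lam]_x (mo d g x * mo d f x) - \int[lam]_x (g x * f x) =
    \int[lam]_x (mo d g x * (mo d f x - f x)) + \int[lam]_x (g x * (mo d f x - f x)).
  have -> : \int[lam]_x (mo d g x * mo d f x) =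
      \int[lam]_x (mo d g x * (mo d f x - f x)) + \int[lam]_x (mo d g x * f x).
    by rewrite -IntD//; apply: eq_Int => x; ring.
  have -> : \int[lam]_x (g x * (mo d f x - f x)) =
      \int[lam]_x (g x * mo d f x) - \int[lam]_x (g x * f x).
    by rewrite -IntB//; apply: eq_Int => x; ring.
  have -> : \int[lam]_x (mo d g x * f x) = \int[lam]_x (g x * mo d f x).
    under eq_Int do rewrite mulrC; rewrite (mo_adjoint d fi mg gS).
    by apply: eq_Int => x; rewrite mulrC.
  by rewrite addrA.
rewrite E (le_trans (ler_normD _ _))// (le_trans (lerD (bound _ mm mS) (bound _ mg gS)))//.
have := H d dd; rewrite ler_pdivlMr ?ltr_wpDl ?mulr_ge0//.
set I := \int[lam]_y _ => HI.
have I0 : 0 <= I by exact: Int_ge0.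
by apply: le_trans HI; nra.
Qed.

Lemma levy_pair_energy U W : levy_pair U W ->
  (EE mu W <= (- 2 * \int[lam]_x (W x * U x))%:E)%E.
Proof.
move=> UW; have [iU mW bW vW _] := UW; have [S WS] := bW.
apply/lee_addgt0Pr => eta eta0; apply: EE_lsc => // n r r0.
have [d1 d10 H1] := mo_cvg_loc mW WS n r0.
have q0 : 0 < eta / 2 by rewrite divr_gt0.
have [d2 d20 H2] := mo_pairing iU mW WS q0.
pose d := Num.min d1 d2 / 2.
have m0 : 0 < Num.min d1 d2 by rewrite lt_min d10.
have d0 : 0 < d by rewrite divr_gt0.
have dm : d < Num.min d1 d2 by rewrite /d; lra.
have dd1 : 0 < d < d1 by rewrite d0 (lt_le_trans dm)// ge_min lexx.
have dd2 : 0 < d < d2 by rewrite d0 (lt_le_trans dm)// ge_min lexx orbT.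
have iV : integ lam (\1_(cube n%:R) : X -> R).
  by apply: integ_indic; [exact: cube_measurable|exact: cube_fin].
have mm := mo_measurable d mW WS.
have m1 : measurable_fun setT (fun x => `|mo d W x - W x| * \1_(cube n%:R) x).
  apply: measurable_funM; last exact: integ_meas iV.
  by apply: measurableT_comp => //; exact: measurable_funB.
exists (mo d W); split => //.
- apply: (integ_dom m1 _ (integZ (S + S) iV)) => x.
  rewrite ger0_norm ?mulr_ge0 ?indicE// ler_wpM2r ?indicE//.
  by rewrite (le_trans (ler_normB _ _))// lerD//; exact: mo_bounded.
- exact: H1.
- apply: le_trans (EE_mo UW d0) _; rewrite -EFinD lee_fin.
  by have := H2 d dd2; rewrite ler_norml => /andP[? ?]; lra.
Qed.

Lemma EE_integ2 f : measurable_fun setT f -> (EE mu f < +oo)%E ->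
  integ (lam \x mu)%E (fun p => (f (p.1 + p.2) - f p.1) ^+ 2).
Proof.
move=> mf fo.
have m2 := measurable_diff2 mf.
apply/(@integrable21ltyP _ _ _ _ _ lam mu (EFin \o (fun p => (f (p.1 + p.2) - f p.1) ^+ 2))).
  exact: m2.
apply: le_lt_trans fo; apply: ge0_le_int => z _; first exact: integral_ge0.
by apply: ge0_le_int => x _ //=; rewrite ger0_norm ?sqr_ge0.
Qed.

(** The equation of the first pair is tested with thresholds of the second [W], which are
    integrable, and the threshold is sent to 0. The finite energies given by [EE_mo] make the
    bilinear form jointly integrable and dominate the limit. The resulting right-hand side is
    symmetric in the two pairs. *)
Lemma levy_pair_mo_form U1 W1 U2 W2 d : levy_pair U1 W1 -> levy_pair U2 W2 -> 0 < d ->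
  \int[lam]_y (mo d W2 y * mo d U1 y) = - (2^-1 * \int[(lam \x mu)%E]_p
    ((mo d W1 (p.1 + p.2) - mo d W1 p.1) * (mo d W2 (p.1 + p.2) - mo d W2 p.1))).
Proof.
move=> P1 P2 d0; have [iU1 mW1 [S1 WS1] vW1 _] := P1; have [iU2 mW2 bW2 vW2 _] := P2.
have [S2 WS2] := bW2.
have ma1 := mo_measurable d mW1 WS1; have ma2 := mo_measurable d mW2 WS2.
have aS2 y := mo_bounded y d0 mW2 WS2.
have va2 := mo_vanishing d0 mW2 bW2 vW2.
have iUd := mo_integ d iU1.
have E1 := EE_integ2 ma1 (le_lt_trans (EE_mo P1 d0) (ltry _)).
have E2 := EE_integ2 ma2 (le_lt_trans (EE_mo P2 d0) (ltry _)).
pose e (n : nat) : R := n.+1%:R^-1.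
have e0 n : 0 < e n by rewrite invr_gt0.
pose v n x := soft (e n) (mo d W2 x).
have mv n : measurable_fun setT (v n) by exact: soft_measurable.
pose Da1 (p : X * X) := mo d W1 (p.1 + p.2) - mo d W1 p.1.
pose Da2 (p : X * X) := mo d W2 (p.1 + p.2) - mo d W2 p.1.
pose Dv n (p : X * X) := v n (p.1 + p.2) - v n p.1.
have mP n : measurable_fun setT (fun p => Da1 p * Dv n p).
  by apply: measurable_funM; exact: measurable_diff.
(* The threshold is 1-Lipschitz, so differences of [v n] are bounded by those of [mo d W2]. *)
have bP n p : `|Da1 p * Dv n p| <= Da1 p ^+ 2 + Da2 p ^+ 2.
  have h : `|Dv n p| <= `|Da2 p| by exact: soft_lip (ltW (e0 n)).
  rewrite normrM; apply: (@le_trans _ _ (`|Da1 p| * `|Da2 p|)).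
    by rewrite ler_wpM2l.
  rewrite -(real_normK (num_real (Da1 p))) -(real_normK (num_real (Da2 p))).
  by have := normr_ge0 (Da1 p); have := normr_ge0 (Da2 p); nra.
have iP n : integ (lam \x mu)%E (fun p => Da1 p * Dv n p).
  exact: (integ_dom (mP n) (bP n) (integD E1 E2)).
have Tn n : \int[lam]_y (v n y * mo d U1 y) =
    - (2^-1 * \int[(lam \x mu)%E]_p (Da1 p * Dv n p)).
  have [_ ->] := levy_pair_test P1 d0 (soft_integ (e0 n) ma2 va2).
  by rewrite -(Int_fubini2 (iP n)).
have c1 : (fun n => \int[lam]_y (v n y * mo d U1 y)) @ \oo -->
    \int[lam]_y (mo d W2 y * mo d U1 y).
  pose I := \int[lam]_y `|mo d U1 y|.
  have I0 : 0 <= I by exact: Int_ge0.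
  have I1 : 0 < I + 1 by rewrite ltr_wpDl.
  apply/cvgrPdist_le => r r0; have q0 : 0 < r / (I + 1) by rewrite divr_gt0.
  near=> n.
  rewrite distrC; apply: le_trans (soft_test (e0 n) ma2 (ex_intro _ S2 aS2) va2 iUd) _.
  rewrite -/I.
  apply: (@le_trans _ _ (e n * (I + 1))); first by rewrite ler_wpM2l ?lerDl// ltW.
  rewrite -ler_pdivlMr//.
  near: n; have /cvgr0Pnorm_le/(_ _ q0) := @inv_succ_cvg0 R; apply: filterS => n.
  by rewrite ger0_norm.
have c2 : (fun n => \int[(lam \x mu)%E]_p (Da1 p * Dv n p)) @ \oo -->
    \int[(lam \x mu)%E]_p (Da1 p * Da2 p).
  apply: (Int_cvg mP _ _ (integD E1 E2)).
  - by apply: measurable_funM; exact: measurable_diff.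
  - apply: aeW => p; apply: cvgM; first exact: cvg_cst.
    have cs x : (fun n => v n x) @ \oo --> mo d W2 x.
      apply/cvgrPdist_le => r r0; near=> n.
      rewrite distrC (le_trans (soft_near _ (ltW (e0 n))))//.
      near: n; have /cvgr0Pnorm_le/(_ r r0) := @inv_succ_cvg0 R.
      by apply: filterS => n; rewrite ger0_norm.
    by apply: cvgB; exact: cs.
  - by apply: aeW => p n; exact: bP.
have c3 : (fun n => \int[lam]_y (v n y * mo d U1 y)) @ \oo -->
    - (2^-1 * \int[(lam \x mu)%E]_p (Da1 p * Da2 p)).
  under eq_fun do rewrite Tn.
  by apply: cvgN; apply: cvgM => //; exact: cvg_cst.
exact: (cvg_unique _ c1 c3).
Unshelve. all: by end_near. Qed.

(** Both pairings, once mollified, equal the same symmetric form; [mo_pairing] removes the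
    mollification. This is the symmetry of the operator, without any energy for the product of [W1]
    and [W2] being evaluated. *)
Lemma levy_pair_sym U1 W1 U2 W2 : levy_pair U1 W1 -> levy_pair U2 W2 ->
  \int[lam]_x (W2 x * U1 x) = \int[lam]_x (W1 x * U2 x).
Proof.
move=> P1 P2; have [iU1 mW1 [S1 WS1] _ _] := P1; have [iU2 mW2 [S2 WS2] _ _] := P2.
apply/eqP; rewrite -subr_eq0 -normr_le0; apply/ler_addgt0Pr => eta eta0; rewrite add0r.
have e20 : 0 < eta / 2 by rewrite divr_gt0.
have [d1 d10 H1] := mo_pairing iU1 mW2 WS2 e20.
have [d2 d20 H2] := mo_pairing iU2 mW1 WS1 e20.
pose d := Num.min d1 d2 / 2.
have m0 : 0 < Num.min d1 d2 by rewrite lt_min d10.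
have d0 : 0 < d by rewrite divr_gt0.
have dm : d < Num.min d1 d2 by rewrite /d; lra.
have dd1 : 0 < d < d1 by rewrite d0 (lt_le_trans dm)// ge_min lexx.
have dd2 : 0 < d < d2 by rewrite d0 (lt_le_trans dm)// ge_min lexx orbT.
have := H1 d dd1; have := H2 d dd2.
rewrite (levy_pair_mo_form P1 P2 d0) (levy_pair_mo_form P2 P1 d0).
under [X in `|- (2^-1 * X) - _| <= _ -> _]eq_Int do rewrite mulrC.
move: (Rintegral _ _ _) => M; rewrite !ler_norml => /andP[? ?] /andP[? ?].
by apply/andP; split; lra.
Qed.

End levy_pairs.

(** * Summation by parts in time *)

Section nonlinearity.
Context {R : realType}.
Variable phi : R -> R.
Hypothesis phi_cont : continuous phi.
Hypothesis phi_nd : {homo phi : a b / a <= b}.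
Hypothesis phi0 : phi 0 = 0.
Variable M : R.
Hypothesis M0 : 0 <= M.

(** A bound for [|phi|] on [[-M, M]]: by monotonicity the extreme values are at the endpoints. *)
Definition phisup : R := Num.max (phi M) (- phi (- M)).

Lemma phi_bounded a : `|a| <= M -> `|phi a| <= phisup.
Proof.
rewrite ler_norml => /andP[h1 h2]; rewrite ler_norml; apply/andP; split.
  by rewrite lerNl le_max; apply/orP; right; rewrite lerN2 phi_nd.
by rewrite le_max phi_nd.
Qed.

(** Uniform continuity in a form that can be integrated: a small constant plus a multiple of the
    distance. Nearby arguments are covered by [e]; for arguments at distance at least [r / 2] the
    linear term exceeds the oscillation of [phi]. *)
Lemma phi_modulus e : 0 < e -> exists2 C : R, 0 <= C & forall a b, `|a| <= M -> `|b| <= M ->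
  `|phi a - phi b| <= e + C * `|a - b|.
Proof.
move=> e0.
have : \forall r \near 0^'+, forall a, `[- M, M]%classic a ->
    forall b, `|a - b| < r -> `|phi a - phi b| <= e.
  have cK := @segment_compact R (- M) M.
  move/compact_near_coveringP : cK => /(_ R (0^'+) (fun r a =>
    forall b, `|a - b| < r -> `|phi a - phi b| <= e) _); apply => a _.
  have e20 : 0 < e / 2 by rewrite divr_gt0.
  have /cvgrPdist_le/(_ _ e20)[r /= r0 Hr] := @phi_cont a.
  have r20 : 0 < r / 2 by rewrite divr_gt0.
  exists (ball a (r / 2), [set s | s < r / 2]) => /=.
    split; first exact: nbhsx_ballx.
    exact: nbhs_right_lt.
  move=> [a' s] /= [aa' sr] b a'b.
  have ab : `|a - b| < r.
    rewrite (le_lt_trans (ler_distD a' _ _))// (splitr r) ltrD//.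
    exact: lt_trans sr.
  have aa : `|a - a'| < r by rewrite (lt_le_trans aa')//; lra.
  rewrite (le_trans (ler_distD (phi a) _ _))// (splitr e) lerD//.
    by rewrite distrC; exact: Hr.
  exact: Hr.
case=> r /= r0 Hr.
have S0 : 0 <= phisup.
  by rewrite le_max -[X in X <= phi M]phi0 phi_nd.
have r20 : 0 < r / 2 by rewrite divr_gt0.
exists (2 * phisup / (r / 2)) => [|a b aM bM]; first by rewrite divr_ge0 ?mulr_ge0// ltW.
have [abr|abr] := ltP `|a - b| (r / 2).
  rewrite (@le_trans _ _ e)//; last by rewrite lerDl mulr_ge0// divr_ge0 ?mulr_ge0// ltW.
  apply: (Hr (r / 2)) => //=; first by rewrite sub0r normrN gtr0_norm//; lra.
  by rewrite in_itv/= -ler_norml.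
apply: (@le_trans _ _ (2 * phisup)).
  by rewrite mulr_natl mulr2n (le_trans (ler_normB _ _))// lerD// phi_bounded.
apply: (@le_trans _ _ (2 * phisup / (r / 2) * `|a - b|)); last by rewrite lerDr ltW.
rewrite -mulrA ler_peMr// ?mulr_ge0// mulrC ler_pdivlMr// mul1r; exact: abr.
Qed.

End nonlinearity.

(** * Pairings under local convergence *)

Section loc_tools.
Context {R : realType} (N : nat).
Local Notation X := 'rV[R]_N.
Local Notation lam := (@lebesgue_rV R N).

Lemma integ_truncate (g : X -> R) e : integ lam g -> 0 < e ->
  exists n : nat, \int[lam]_x (`|g x| * (~~ ((`|g x| <= n%:R) && (x \in cube n%:R)))%:R) <= e.
Proof.
move=> gi e0; have mg := integ_meas gi.
pose A n : set X := [set x | `|g x| <= n%:R] `&` cube n%:R.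
have mA n : measurable (A n).
  apply: measurableI; last exact: cube_measurable.
  rewrite -[X in measurable X]setTI.
  by apply: (measurable_fun_le (f := fun x => `|g x|) (g := cst n%:R)) => //;
    apply: measurableT_comp.
have E n x : (~~ ((`|g x| <= n%:R) && (x \in cube n%:R)))%:R = 1 - \1_(A n) x :> R.
  rewrite indicE; have -> : (x \in A n) = (`|g x| <= n%:R) && (x \in cube n%:R).
    apply/idP/idP; rewrite inE; first by move=> [/= -> ?]; rewrite inE.
    by move=> /andP[? ?]; split => //=; rewrite -inE.
  by case: (_ && _); rewrite ?subrr ?subr0.
have : (fun n => \int[lam]_x (`|g x| * (1 - \1_(A n) x))) @ \oo --> \int[lam]_x (0 : R).
  apply: (Int_cvg (g := fun x => `|g x|)) => //.
  - move=> n; apply: measurable_funM; first exact: measurableT_comp.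
    by apply: measurable_funB => //; exact: measurable_indic.
  - apply: aeW => x; apply: cvg_near_cst.
    have [m _ xm] : (\bigcup_n cube n%:R) x by rewrite cube_bigcup.
    exists (maxn m (Num.truncn `|g x|).+1) => // n /= mn.
    rewrite indicE mem_set ?subrr ?mulr0//; split => /=.
      rewrite (le_trans (ltW (truncnS_gt _)))// ler_nat.
      exact: leq_trans (leq_maxr _ _) mn.
    move=> i; apply: lt_le_trans (xm i) _; rewrite ler_nat.
    exact: leq_trans (leq_maxl _ _) mn.
  - exact: integ_norm.
  - apply: aeW => x n; rewrite ger0_norm.
      by rewrite ler_piMr// lerBlDr lerDl indicE.
    by rewrite mulr_ge0// subr_ge0 indicE; case: (_ \in _).
rewrite Int0// => /cvgr0Pnorm_le/(_ _ e0)[n _ Hn]; exists n.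
apply: le_trans (Hn n (leqnn n)); apply: le_trans (ler_norm _).
by rewrite le_eqVlt; apply/orP; left; apply/eqP; apply: eq_Int => x; rewrite E.
Qed.

(** On bounded sets of functions, pairing with an integrable [g] is continuous for local L^1
    convergence, uniformly. Where [g] is at most [n] and the point is in the cube, the local
    distance counts at most [n] times; elsewhere the tail of [g] is small. *)
Lemma Int_pair_loc (g : X -> R) (S e : R) : integ lam g -> 0 < e ->
  exists n : nat, exists2 r : R, 0 < r & forall v v' : X -> R, measurable_fun setT v ->
    measurable_fun setT v' -> (forall x, `|v x| <= S) -> (forall x, `|v' x| <= S) ->
    \int[lam]_x (`|v x - v' x| * \1_(cube n%:R) x) <= r ->
    `|\int[lam]_x (g x * v x) - \int[lam]_x (g x * v' x)| <= e.
Proof.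
(* For [S < 0] no function satisfies the bound. *)
move=> gi e0; have [S0|S0] := ltP S 0.
  exists 0%N, 1 => // v v' _ _ /(_ 0) h; have := le_lt_trans h S0.
  by rewrite ltNge normr_ge0.
have e10 : 0 < e / 2 / (2 * S + 1) by rewrite !divr_gt0// ltr_wpDl// mulr_ge0.
have [n Hn] := integ_truncate gi e10.
exists n, (e / 2 / (n%:R + 1)) => [|v v' mv mv' vS vS']; first by rewrite !divr_gt0// ltr_wpDl.
set D := \int[lam]_x (`|v x - v' x| * _) => HD.
have mg := integ_meas gi.
have vv x : `|v x - v' x| <= 2 * S.
  by rewrite mulr_natl mulr2n (le_trans (ler_normB _ _))// lerD.
have mvv : measurable_fun setT (fun x => `|v x - v' x|).
  by apply: measurableT_comp => //; exact: measurable_funB.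
have iD : integ lam (fun x => `|v x - v' x| * \1_(cube n%:R) x).
  apply: (integMb (C := 2 * S)) => // [x|]; first by rewrite normr_id.
  by apply: integ_indic; [exact: cube_measurable|exact: cube_fin].
pose B x : bool := ~~ ((`|g x| <= n%:R) && (x \in cube n%:R)).
have mB : measurable_fun setT (fun x => (B x)%:R : R).
  have -> : (fun x => (B x)%:R : R) =
      (fun x => 1 - \1_([set x | `|g x| <= n%:R] `&` cube n%:R) x).
    apply/funext => x; rewrite indicE in_setI /B.
    have -> : (x \in [set x | `|g x| <= n%:R]) = (`|g x| <= n%:R).
      by apply/idP/idP; rewrite inE.
    by case: (_ && _); rewrite ?subrr ?subr0.
  apply: measurable_funB => //; apply: measurable_indic; apply: measurableI; last first.
    exact: cube_measurable.
  rewrite -[X in measurable X]setTI.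
  by apply: (measurable_fun_le (f := fun x => `|g x|) (g := cst n%:R)) => //;
    apply: measurableT_comp.
have iB : integ lam (fun x => `|g x| * (B x)%:R).
  apply: (integ_dom (g := fun x => `|g x|)); last exact: integ_norm.
    by apply: measurable_funM => //; exact: measurableT_comp.
  by move=> x; case: (B x); rewrite ?mulr1 ?mulr0 ?normr0// normr_id.
have i1 : integ lam (fun x => g x * v x).
  by under eq_fun do rewrite mulrC; exact: integMb mv vS gi.
have i2 : integ lam (fun x => g x * v' x).
  by under eq_fun do rewrite mulrC; exact: integMb mv' vS' gi.
rewrite -IntB//.
apply: (@le_trans _ _ (\int[lam]_x (n%:R * (`|v x - v' x| * \1_(cube n%:R) x) +
    2 * S * (`|g x| * (B x)%:R)))).
  apply: Int_norm_le; [exact: integB|by apply: integD; exact: integZ|move=> x].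
  rewrite -mulrBr normrM /B indicE.
  have [xn|xn] := boolP (x \in cube n%:R).
    have [gn|gn] := boolP (`|g x| <= n%:R); rewrite /= ?mulr0 ?mulr1 ?addr0.
      by rewrite ler_wpM2r.
    rewrite ler_wpDl ?mulr_ge0//; rewrite mulrC; exact: ler_wpM2r.
  rewrite andbF /= !mulr0 add0r mulr1 mulrC; exact: ler_wpM2r.
rewrite IntD ?IntZ//; [|exact: integZ|exact: integZ].
rewrite (splitr e) lerD//.
  apply: (@le_trans _ _ ((n%:R + 1) * (e / 2 / (n%:R + 1)))).
    by rewrite ler_pM// ?lerDl//; apply: Int_ge0 => x; rewrite mulr_ge0// indicE.
  by rewrite mulrC divfK// gt_eqF// ltr_wpDl.
apply: (@le_trans _ _ ((2 * S + 1) * (e / 2 / (2 * S + 1)))).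
  rewrite ler_pM ?lerDl ?mulr_ge0//.
  by apply: Int_ge0 => x; rewrite mulr_ge0.
by rewrite mulrC divfK// gt_eqF// ltr_wpDl// mulr_ge0.
Qed.

End loc_tools.

(** * Window integrals on the time axis *)

Section windows.
Context {R : realType}.
Local Notation TR := (measurableTypeR R).
Local Notation leb := (@lebesgue_measure R).
Implicit Types (a b c t s : R).

Lemma winE a b t : win a b t = \1_(`]a, b]%classic) t :> R.
Proof.
rewrite indicE /win; congr (nat_of_bool _)%:R.
by apply/idP/idP; rewrite inE /= in_itv.
Qed.

Lemma win_ge0 a b t : 0 <= win a b t :> R.
Proof. by rewrite /win. Qed.

Lemma win_le1 a b t : win a b t <= 1 :> R.
Proof. by rewrite /win; case: (_ && _). Qed.

Lemma win1 a b t : a < t -> t <= b -> win a b t = 1 :> R.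
Proof. by rewrite /win => -> ->. Qed.

Lemma win0 a b t : t <= a \/ b < t -> win a b t = 0 :> R.
Proof.
by rewrite /win => -[h|h]; [rewrite ltNge h|rewrite [t <= b]leNgt h andbF].
Qed.

Lemma win_neq0 a b t : win a b t != 0 :> R -> a < t /\ t <= b.
Proof. by rewrite /win; case: ltP => // _; case: leP => //=; rewrite eqxx. Qed.

Lemma win_sub a b c d t : c <= a -> b <= d -> win a b t <= win c d t :> R.
Proof.
move=> ca bd; rewrite /win ler_nat; case: (boolP (a < t)) => //= at_.
by rewrite (le_lt_trans ca at_)/=; case: (boolP (t <= b)) => // tb; rewrite (le_trans tb).
Qed.

Lemma win_shift a b t k : win a b (t + k) = win (a - k) (b - k) t :> R.
Proof. by rewrite /win ltrBlDr lerBrDr. Qed.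

Lemma integ_win a b : integ leb (win a b).
Proof.
rewrite (_ : win a b = \1_(`]a, b]%classic)); first exact: integ_itv.
by apply/funext => t; exact: winE.
Qed.

Lemma Int_win a b : a <= b -> \int[leb]_t win a b t = b - a.
Proof.
move=> ab; apply: EFin_inj; rewrite Int_EFin ?integ_win//.
under eq_integral do rewrite winE.
rewrite (integral_indic _ measurableT) ?setIT; last exact: measurable_itv.
rewrite [LHS]leb_itv; case: ifP => // /negbT; rewrite -leNgt => ba.
by rewrite (@le_anti _ _ a b) ?ab// subrr.
Qed.

Lemma measurable_TRid : measurable_fun (setT : set TR) (id : R -> R).
Proof. exact: measurable_id. Qed.

(** Fubini on the triangle below the diagonal of the square of side [s] shows that [s - h] and [h]
    have the same integral; together they give [s^2]. *)
Lemma Int_win_ramp s : 0 < s -> \int[leb]_h (win 0 s h * (s - h)) = s ^+ 2 / 2.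
Proof.
have half (a b : R) : a = b - a -> a = b / 2 by lra.
move=> s0; pose F (p : TR * TR) : R := win 0 s p.1 * ((0 < p.2)%R && (p.2 < p.1)%R)%:R.
have m1 : measurable_fun setT (fun p : TR * TR => p.1 : R) by exact: measurable_fst.
have m2 : measurable_fun setT (fun p : TR * TR => p.2 : R) by exact: measurable_snd.
have mF : measurable_fun setT F.
  apply: measurable_funM.
    by apply: measurable_win => //; exact: measurable_cst.
  by apply: measurable_natb; apply: measurable_and; apply: measurable_fun_ltr.
have iF : integ (leb \x leb)%E F.
  apply: (integ_dom mF _ (integ_tensor (integ_win 0 s) (integ_win 0 s))) => -[a b] /=.
  rewrite /F /= ger0_norm ?mulr_ge0 ?win_ge0//.
  have [wz|wz] := eqVneq (win 0 s a) 0; first by rewrite wz !mul0r.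
  have [a0 as_] := win_neq0 wz; rewrite ler_wpM2l ?win_ge0// /win ler_nat.
  case: (ltP 0 b) => //= _; case: (ltP b a) => //= ba.
  by rewrite (le_trans (ltW ba)).
have iA : integ leb (fun h => win 0 s h * h).
  apply: (@integ_dom _ TR R leb _ (fun h => s * win 0 s h)); last exact/integZ/integ_win.
    by apply: measurable_funM; [exact: integ_meas (integ_win 0 s)|exact: measurable_TRid].
  move=> h; have [wz|wz] := eqVneq (win 0 s h) 0; first by rewrite wz mul0r mulr0 normr0.
  have [h0 hs] := win_neq0 wz; rewrite normrM !ger0_norm ?win_ge0 ?(ltW h0)// mulrC.
  by rewrite ler_wpM2r ?win_ge0.
have E : \int[leb]_h (win 0 s h * (s - h)) = \int[leb]_h (win 0 s h * h).
  transitivity (\int[leb]_b \int[leb]_a F (a, b)).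
    apply: eq_Int => b; transitivity (\int[leb]_a (win 0 s b * win b s a)).
      have [wz|wz] := eqVneq (win 0 s b) 0; first by rewrite wz mul0r Int0// => a; rewrite mul0r.
      have [b0 bs] := win_neq0 wz.
      by rewrite IntZ ?Int_win//; exact: integ_win.
    apply: eq_Int => a; rewrite /F /= /win.
    case: (ltP 0 b) => b0; case: (leP b s) => bs; case: (leP a s) => as_; case: (ltP b a) => ba;
      rewrite /= ?andbT ?andbF ?mul0r ?mulr0 ?mulr1 ?mul1r//.
    - by rewrite (lt_trans b0 ba).
    - by have := lt_le_trans ba as_; rewrite ltNge (ltW bs).
  rewrite -(Int_fubini iF); apply: eq_Int => a.
  have [wz|wz] := eqVneq (win 0 s a) 0; first by rewrite wz mul0r Int0// => b; rewrite /F /= wz mul0r.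
  have [a0 as_] := win_neq0 wz.
  have E b : ((0 < b) && (b < a))%:R = \1_(`]0, a[%classic) b :> R.
    rewrite indicE; congr (nat_of_bool _)%:R.
    by apply/idP/idP; rewrite inE /= in_itv.
  rewrite /F /= IntZ; last by under eq_fun do rewrite E; exact: integ_itv.
  congr (_ * _); under eq_Int do rewrite E; apply: EFin_inj; rewrite Int_EFin; last exact: integ_itv.
  rewrite (integral_indic _ measurableT) ?setIT; last exact: measurable_itv.
  by rewrite [LHS]leb_itv a0 subr0.
have : \int[leb]_h (win 0 s h * (s - h)) = s ^+ 2 - \int[leb]_h (win 0 s h * h).
  have -> : s ^+ 2 = \int[leb]_h (s * win 0 s h).
    by rewrite IntZ ?Int_win ?subr0 ?ltW//; exact: integ_win.
  rewrite -IntB//; last exact/integZ/integ_win.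
  by apply: eq_Int => h; ring.
by rewrite {}E; exact: half.
Qed.

Lemma ae_shift (Q : R -> Prop) k : {ae leb, forall t : TR, Q t} ->
  {ae leb, forall t : TR, Q (t + k)}.
Proof.
move=> [A [mA A0 QA]]; exists ((fun t : R => t + k) @^-1` A); split.
- by have := measurable_addr k measurableT mA; rewrite setTI.
- by rewrite lebesgue_shift.
- by move=> t /= h; apply: QA.
Qed.

(** Fubini and the substitution [t = r + h]: pairing [u] with an increment of the primitive of [w]
    becomes an average, over the lags [h], of correlations of [u] with [w]. *)
Lemma Int_window (u w : R -> R) (C S tau sigma : R) :
  measurable_fun (setT : set TR) u -> measurable_fun (setT : set TR) w ->
  (forall t, `|u t| <= C) -> (forall r, `|w r| <= S * win 0 tau r) ->
  \int[leb]_t (u t * \int[leb]_r (w r * win r (r + sigma) t)) =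
  \int[leb]_r \int[leb]_h (u (r + h) * w r * win 0 sigma h).
Proof.
move=> mu_ mw_ uC wS.
pose F (p : TR * TR) : R := u p.1 * (w p.2 * win p.2 (p.2 + sigma) p.1).
have mF : measurable_fun setT F.
  apply: measurable_funM; first exact: (measurableT_comp mu_ measurable_fst).
  apply: measurable_funM; first exact: (measurableT_comp mw_ measurable_snd).
  apply: measurable_win; [exact: measurable_snd| |exact: measurable_fst].
  by apply: measurable_funD; [exact: measurable_snd|exact: measurable_cst].
have S0 : 0 <= S * win 0 tau 0 by exact: le_trans (wS 0).
have C0 : 0 <= C by exact: le_trans (uC 0).
have iF : integ (leb \x leb)%E F.
  have it := integ_tensor (integZ C (integ_win 0 (tau + sigma))) (integZ S (integ_win 0 tau)).
  apply: (integ_dom mF _ it) => -[t r] /=.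
  rewrite /F /= normrM -mulrA [`|w r * _|]normrM ler_pM//.
  rewrite [`|win r _ t|]ger0_norm ?win_ge0//.
  have [wr|wr] := eqVneq (win 0 tau r) 0.
    have := wS r; rewrite wr mulr0 normr_le0 => /eqP ->.
    by rewrite normr0 mul0r !mulr0.
  have [r0 rt] := win_neq0 wr.
  rewrite [X in _ <= X]mulrC; apply: ler_pM; rewrite ?win_ge0 ?wS//.
  rewrite /win ler_nat; case: (boolP (r < t)) => //= rt'.
  by rewrite (lt_trans r0 rt')/=; case: (boolP (t <= _)) => //= h; rewrite (le_trans h)// lerD2r.
transitivity (\int[leb]_t \int[leb]_r F (t, r)).
  apply: eq_Int => t; rewrite -IntZ//.
  apply: (@integ_dom _ TR R leb _ (fun r => S * win 0 tau r)); last exact/integZ/integ_win.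
    apply: measurable_funM => //; apply: measurable_win => //.
    exact: measurable_addr.
  move=> r; rewrite normrM (le_trans _ (wS r))// ler_piMr//.
  by rewrite ger0_norm ?win_ge0// win_le1.
rewrite (Int_fubini iF); apply: eq_Int => r.
rewrite -(Int_shift1 r (f := fun t => F (t, r))); last exact: (measurable_slice2 (r : TR) mF).
apply: eq_Int => h; rewrite /F /= (addrC h r) -mulrA; congr (_ * (_ * _)).
by rewrite /win ltrDl lerD2l.
Qed.

(** A telescoping sum. [f] itself is not integrable when its final value is nonzero, so it is cut
    off at [tau]: the cut-off part [g] cancels against its shift, and [k] collects the final value
    over a window of length [sigma]. *)
Lemma Int_shift_diff (f : R -> R) (tau sigma : R) : 0 < sigma -> 0 < tau ->
  (forall t, t <= 0 -> f t = 0) -> (forall t, tau <= t -> f t = f tau) ->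
  integ leb (fun t => f t * win 0 tau t) ->
  integ leb (fun t => f t - f (t - sigma)) /\
  \int[leb]_t (f t - f (t - sigma)) = sigma * f tau.
Proof.
move=> s0 t0 f0 f1 fi; have fis := integ_shift1 (- sigma) fi.
have mf := integ_meas fi.
pose g t := f t * win 0 tau t; pose k t := f tau * win tau (tau + sigma) t.
have ik : integ leb k by exact/integZ/integ_win.
have E t : f t - f (t - sigma) = g t - g (t - sigma) + k t.
  rewrite /g /k; have [tn|tp] := leP t 0.
    rewrite f0// [f (t - sigma)]f0; last by lra.
    by rewrite !mul0r win0 ?mulr0 ?addr0//; left; lra.
  have [ts|ts] := leP (t - sigma) 0.
    rewrite [f (t - sigma)]f0// mul0r !subr0.
    have [tt|tt] := leP t tau.
      by rewrite win1// mulr1 win0 ?mulr0 ?addr0//; left.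
    by rewrite win0 ?mulr0 ?add0r; [rewrite win1 ?mulr1 ?f1//; lra|right].
  have [tt|tt] := leP t tau.
    rewrite [win 0 tau t]win1// [win 0 tau _]win1//; last lra.
    by rewrite !mulr1 win0 ?mulr0 ?addr0//; left.
  have [tt'|tt'] := leP (t - sigma) tau.
    rewrite [win 0 tau t]win0; last by right.
    rewrite [win 0 tau _]win1// win1//; last lra.
    by rewrite f1; lra.
  rewrite [win 0 tau t]win0; last by right.
  rewrite [win 0 tau _]win0; last by right.
  rewrite [win tau _ _]win0; last by right; lra.
  by rewrite (f1 t) ?ltW// (f1 (t - sigma)) ?ltW//; lra.
split.
  by under eq_fun do rewrite E; apply: integD => //; exact: integB.
under eq_Int do rewrite E.
rewrite IntD//; last exact: integB.
rewrite IntB// (Int_shift1 (- sigma) mf) subrr add0r IntZ; last exact: integ_win.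
by rewrite Int_win; lra.
Qed.

End windows.

Section time_shift.
Context {R : realType} (N : nat).
Local Notation X := 'rV[R]_N.
Local Notation TR := (measurableTypeR R).
Local Notation leb := (@lebesgue_measure R).
Local Notation lam := (@lebesgue_rV R N).
Local Notation P := (lam \x leb)%E.
Implicit Type F : X * R -> R.

Lemma measurable_shiftP F k : measurable_fun (setT : set (X * TR)) F ->
  measurable_fun (setT : set (X * TR)) (fun p => F (p.1, p.2 + k)).
Proof.
move=> mF; apply: (measurableT_comp (g := fun p : X * TR => ((p.1, p.2 + k) : X * TR)) mF).
apply: measurable_fun_pair; first exact: measurable_fst.
by apply: measurable_funD; [exact: measurable_snd|exact: measurable_cst].
Qed.

Lemma integ_shiftP F k : integ P F -> integ P (fun p => F (p.1, p.2 + k)).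
Proof.
move=> Fi; have mF := integ_meas Fi; have mk := measurable_shiftP k mF.
apply/(@integrable12ltyP _ _ _ _ _ lam leb (EFin \o (fun p => F (p.1, p.2 + k)))).
  exact/measurable_EFinP.
have /(@integrable12ltyP _ _ _ _ _ lam leb (EFin \o F)) : integ P F by [].
move=> /(_ (proj2 (@measurable_EFinP _ _ _ _ _) mF)); apply: le_lt_trans.
rewrite le_eqVlt; apply/orP; left; apply/eqP; apply: eq_integral => x _.
apply: (ge0_integral_mp (measurable_addr k) (@lebesgue_shift R k)
  (f := fun t : TR => `|(F (x, t))%:E|%E)) => //.
apply: measurableT_comp => //; apply/measurable_EFinP.
exact: (measurable_slice1 x mF).
Qed.

Lemma Int_shiftP F k : integ P F -> \int[P]_p F (p.1, p.2 + k) = \int[P]_p F p.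
Proof.
move=> Fi; have Fki := integ_shiftP k Fi.
rewrite -(Int_fubini1 Fki) -(Int_fubini1 Fi); apply: eq_Int => x /=.
apply: (Int_shift1 k (f := fun t => F (x, t))).
exact: (measurable_slice1 x (integ_meas Fi)).
Qed.

End time_shift.

(** Here [i] and [j] are the integrals of [fD s 0] and [fD s (- s)], [k] is [fK 0] and [b] is
    [fB tau]: [j - i = 2 j - s b <= 2 j - 2 s k <= s^2 l]. *)
Lemma fG_Int_le_aux (R : realFieldType) (s k b i j l : R) : 0 < s ->
  i + j = s * b -> 2 * k <= b -> j <= s * k + l * (s ^+ 2 / 2) -> j - i <= s ^+ 2 * l.
Proof.
move=> s0 E kb h; have : s * (2 * k) <= s * b by rewrite ler_wpM2l// ltW.
by rewrite -E; move: h; rewrite expr2; lra.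
Qed.

(** Same notation as above: nonnegativity of [j - i] gives [s b >= 2 i], and [i] is nearly [s k]. *)
Lemma fK0_le_aux (R : realFieldType) (s k e b i j : R) : 0 < s ->
  s * (k - e / 2) <= i -> i + j = s * b -> 0 <= j - i -> 2 * k <= b + e.
Proof. by nra. Qed.

Lemma Int_mulBB d (T : measurableType d) (R : realType) (m : {measure set T -> \bar R})
    (f1 f2 g1 g2 : T -> R) :
  integ m (fun x => f1 x * g1 x) -> integ m (fun x => f1 x * g2 x) ->
  integ m (fun x => f2 x * g1 x) -> integ m (fun x => f2 x * g2 x) ->
  \int[m]_x ((f1 x - f2 x) * (g1 x - g2 x)) =
  \int[m]_x (f1 x * g1 x) - \int[m]_x (f1 x * g2 x) -
  (\int[m]_x (f2 x * g1 x) - \int[m]_x (f2 x * g2 x)).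
Proof.
move=> i11 i12 i21 i22; rewrite -!IntB//; try exact: integB.
by apply: eq_Int => x; ring.
Qed.

Lemma measurable_cube_indic (R : realType) (N n : nat) :
  measurable_fun setT (\1_(cube n%:R) : 'rV[R]_N -> R).
Proof. by apply: measurable_indic; exact: cube_measurable. Qed.

Section frozen.
Context {R : realType} (N : nat).
Local Notation X := 'rV[R]_N.
Local Notation TR := (measurableTypeR R).
Local Notation leb := (@lebesgue_measure R).
Local Notation lam := (@lebesgue_rV R N).
Local Notation P := (lam \x leb)%E.
Local Notation PS := (prod_sf lam leb).
Implicit Types (a b c h k r s t sigma : R).
Variables (phi : R -> R) (M tau : R) (alpha : X * R -> R) (u0 : X -> R).
Hypothesis phi_cont : continuous phi.
Hypothesis phi_nd : {homo phi : a b / a <= b}.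
Hypothesis phi0 : phi 0 = 0.
Hypothesis M0 : 0 <= M.
Hypothesis tau0 : 0 < tau.
Hypothesis malpha : measurable_fun (setT : set (X * TR)) alpha.
Hypothesis alphaM : forall p, `|alpha p| <= M.
Hypothesis u0M : forall x, `|u0 x| <= M.
Hypothesis iu0 : integ lam u0.
Hypothesis alpha_le0 : forall x t, t <= 0 -> alpha (x, t) = u0 x.
Hypothesis alpha_ge : forall x t, tau <= t -> alpha (x, t) = alpha (x, tau).
Hypothesis itau : integ lam (fun x => alpha (x, tau)).
Hypothesis ialpha : integ P (fun p => alpha p * win 0 tau p.2).

Local Notation S := (phisup phi M).

(* [alpha] is the solution frozen at [u0] before time 0 and at [alpha (_, tau)]
   after [tau]; [fU] and [fW] form the pair [U(t) = alpha(t) - u0],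
   [W(t) = int_0^t phi(alpha)]. *)
Definition fw (p : X * R) : R := phi (alpha p) * win 0 tau p.2.
Definition fU (p : X * R) : R := alpha p - u0 p.1.
Definition fW (p : X * R) : R := \int[leb]_r (fw (p.1, r) * (r < p.2)%R%:R).
Definition fA (p : X * R) : R :=
  2 * `|u0 p.1| + `|alpha (p.1, tau)| + `|alpha p * win 0 tau p.2|.

Let S0 : 0 <= S.
Proof. exact: le_trans (normr_ge0 _) (phi_bounded phi_nd (alphaM (0, 0))). Qed.

Let mphi : measurable_fun (setT : set R) phi.
Proof. exact: continuous_measurable_fun. Qed.

Lemma fw_measurable : measurable_fun (setT : set (X * TR)) fw.
Proof.
apply: measurable_funM; first exact: (measurableT_comp mphi malpha).
by apply: measurable_win => //; exact: measurable_cst.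
Qed.

Lemma fw_bound p : `|fw p| <= S * win 0 tau p.2.
Proof.
rewrite /fw normrM [`|win _ _ _|]ger0_norm ?win_ge0// ler_wpM2r ?win_ge0//.
exact: phi_bounded.
Qed.

Lemma fU_measurable : measurable_fun (setT : set (X * TR)) fU.
Proof.
apply: measurable_funB => //.
exact: (measurableT_comp (integ_meas iu0) measurable_fst).
Qed.

Lemma fU_bound p : `|fU p| <= M + M.
Proof. by rewrite (le_trans (ler_normB _ _))// lerD. Qed.

Lemma fU_fA p : `|fU p| <= fA p /\ `|alpha p| <= fA p.
Proof.
rewrite /fU /fA; case: p => x t /=.
have u00 := normr_ge0 (u0 x); have a0 := normr_ge0 (alpha (x, tau)).
have aw := normr_ge0 (alpha (x, t) * win 0 tau t).
have [t0|t0] := leP t 0.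
  by rewrite (alpha_le0 _ t0) subrr normr0 in aw *; split; lra.
have h := ler_normB (alpha (x, t)) (u0 x).
have [tt|tt] := leP tau t; first by rewrite (alpha_ge x tt) in aw h *; split; lra.
by rewrite (win1 t0 (ltW tt)) mulr1; split; lra.
Qed.

Lemma fA_ge0 p : 0 <= fA p.
Proof. exact: le_trans (normr_ge0 _) (proj1 (fU_fA p)). Qed.

Lemma fA_measurable : measurable_fun (setT : set (X * TR)) fA.
Proof.
apply: measurable_funD; last by apply: measurableT_comp => //; exact: integ_meas ialpha.
apply: measurable_funD.
  apply: measurable_funM => //; apply: measurableT_comp => //.
  exact: (measurableT_comp (integ_meas iu0) measurable_fst).
apply: measurableT_comp => //.
exact: (measurableT_comp (integ_meas itau) measurable_fst).
Qed.

Lemma fA_integ a b : integ P (fun p => fA p * win a b p.2).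
Proof.
have mw : measurable_fun (setT : set (X * TR)) (fun p => win a b p.2).
  by apply: measurable_win => //; exact: measurable_cst.
have i1 := integ_tensor (integD (integZ 2 (integ_norm iu0)) (integ_norm itau)) (integ_win a b).
have i2 : integ P (fun p => win a b p.2 * `|alpha p * win 0 tau p.2|).
  apply: (integMb (C := 1) mw) => [p|]; last exact: integ_norm.
  by rewrite ger0_norm ?win_ge0 ?win_le1.
apply: (integ_dom _ _ (integD i1 i2)).
  by apply: measurable_funM => //; exact: fA_measurable.
move=> p; rewrite ger0_norm; last by rewrite mulr_ge0 ?fA_ge0 ?win_ge0.
by rewrite /fA mulrDl [_ * `|_ * _|]mulrC.
Qed.

Lemma fU_integ_shift k : integ P (fun p => fU (p.1, p.2 + k) * fw p) /\
  \int[P]_p `|fU (p.1, p.2 + k) * fw p| <= S * \int[P]_p (fA p * win k (tau + k) p.2).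
Proof.
have i := integ_shiftP k (integZ S (fA_integ k (tau + k))).
have b (p : X * R) : `|fU (p.1, p.2 + k) * fw p| <= S * (fA (p.1, p.2 + k) * win k (tau + k) (p.2 + k)).
  rewrite normrM mulrCA; apply: ler_pM => //; first by case: (fU_fA (p.1, p.2 + k)).
  by rewrite win_shift subrr addrK fw_bound.
have m : measurable_fun (setT : set (X * TR)) (fun p => fU (p.1, p.2 + k) * fw p).
  apply: measurable_funM; last exact: fw_measurable.
  exact: (measurable_shiftP k fU_measurable).
have i' := integ_dom m b i; split => //.
rewrite -IntZ; last exact: fA_integ.
rewrite -(Int_shiftP k (integZ S (fA_integ k (tau + k)))).
by apply: Int_le => //; exact: integ_norm.
Qed.

Lemma fW_measurable : measurable_fun (setT : set (X * TR)) fW.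
Proof.
apply: (measurable_Int leb
  (F := fun q : (X * TR) * TR => fw (q.1.1, q.2) * (q.2 < q.1.2)%R%:R)).
apply: measurable_funM.
  apply: (measurableT_comp fw_measurable (g := fun q : (X * TR) * TR => (q.1.1, q.2) : X * TR)).
  apply: measurable_fun_pair; last exact: measurable_snd.
  exact: (measurableT_comp measurable_fst measurable_fst).
apply: measurable_natb; apply: measurable_fun_ltr; first exact: measurable_snd.
exact: (measurableT_comp measurable_snd measurable_fst).
Qed.

Let fwr_measurable x : measurable_fun (setT : set TR) (fun r => fw (x, r)).
Proof. exact: (measurable_slice1 x fw_measurable). Qed.

Let fwr_integ x (b : R -> R) : measurable_fun (setT : set TR) b ->
  (forall r, `|b r| <= 1) -> integ leb (fun r => fw (x, r) * b r).
Proof.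
move=> mb b1; apply: (@integ_dom _ TR R leb _ (fun r => S * win 0 tau r)).
- exact: measurable_funM.
- by move=> r; rewrite normrM -[leRHS]mulr1 ler_pM// (fw_bound (x, r)).
- exact/integZ/integ_win.
Qed.

Let measurable_ltb t : measurable_fun (setT : set TR) (fun r => (r < t)%R%:R : R).
Proof. by apply: measurable_natb; apply: measurable_fun_ltr => //; exact: measurable_TRid. Qed.

Lemma fWB x t sigma : 0 < sigma -> fW (x, t) - fW (x, t - sigma) =
  \int[leb]_r (fw (x, r) * win r (r + sigma) t).
Proof.
move=> s0; have nb (b : bool) : `|b%:R| <= 1 :> R by case: b; rewrite ?normr1 ?normr0.
rewrite /fW /= -IntB; [|exact: fwr_integ|exact: fwr_integ].
apply: eq_Int => r; rewrite -mulrBr; congr (_ * _).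
rewrite /win; have [rt|rt] := ltP r t; last first.
  by rewrite (_ : (r < t - sigma) = false) ?subr0//; apply/negbTE; rewrite -leNgt; lra.
by rewrite ltrBrDr [t <= _]leNgt; case: (_ < t); rewrite ?subrr ?subr0.
Qed.

Lemma fW_bound p : `|fW p| <= S * tau.
Proof.
have nb (b : bool) : `|b%:R| <= 1 :> R by case: b; rewrite ?normr1 ?normr0.
rewrite -[X in S * X](subr0 tau) -(Int_win (ltW tau0)) -IntZ; last exact: integ_win.
apply: Int_norm_le; [exact: fwr_integ|exact/integZ/integ_win|move=> r].
by rewrite normrM -[leRHS]mulr1 ler_pM// (fw_bound (p.1, r)).
Qed.

Lemma fWB_bound x t sigma : 0 < sigma ->
  `|fW (x, t) - fW (x, t - sigma)| <= S * tau * win 0 (tau + sigma) t.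
Proof.
move=> s0; rewrite fWB//; have [tn|tp] := leP t 0.
  rewrite Int0 ?normr0 ?mulr_ge0 ?win_ge0 ?(ltW tau0)// => r.
  have [rn|rp] := leP r 0; first by rewrite /fw /= win0 ?mulr0 ?mul0r//; left.
  by rewrite [win r _ t]win0 ?mulr0//; left; exact: le_trans tn (ltW rp).
have [tt|tt] := leP t (tau + sigma); last first.
  rewrite Int0 ?normr0 ?mulr_ge0 ?win_ge0 ?(ltW tau0)// => r.
  have [rn|rp] := ltP tau r; first by rewrite /fw /= win0 ?mulr0 ?mul0r//; right.
  by rewrite [win r _ t]win0 ?mulr0//; right; apply: le_lt_trans tt; rewrite lerD2r.
rewrite [win 0 _ _]win1// mulr1 -[X in S * X](subr0 tau) -(Int_win (ltW tau0)).
rewrite -IntZ; last exact: integ_win.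
have m : measurable_fun (setT : set TR) (fun r => win r (r + sigma) t).
  apply: measurable_win => //.
  exact: measurable_addr.
have b1 r : `|win r (r + sigma) t| <= 1 by rewrite ger0_norm ?win_ge0 ?win_le1.
apply: Int_norm_le; [exact: fwr_integ|exact/integZ/integ_win|move=> r].
by rewrite normrM -[leRHS]mulr1 ler_pM// (fw_bound (x, r)).
Qed.

Lemma fU_fWB_integ k sigma : 0 < sigma ->
  integ P (fun p => fU (p.1, p.2 + k) * (fW p - fW (p.1, p.2 - sigma))).
Proof.
move=> s0; have i := integ_shiftP k (integZ (S * tau) (fA_integ k (tau + sigma + k))).
apply: (integ_dom _ _ i).
  apply: measurable_funM; first exact: (measurable_shiftP k fU_measurable).
  apply: measurable_funB; first exact: fW_measurable.
  exact: (measurable_shiftP (- sigma) fW_measurable).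
move=> [x t] /=; rewrite normrM mulrCA; apply: ler_pM => //; first by case: (fU_fA (x, t + k)).
by rewrite win_shift subrr addrK fWB_bound.
Qed.

(** An increment of [W] is the integral of [W'] over a window of length [sigma]; with [h] the
    distance to the point of the window, the pairing with [fU] becomes an integral of correlations
    at the lags [h + k]. *)
Lemma time_average k sigma : 0 < sigma ->
  integ leb (fun h => win 0 sigma h * \int[P]_p (fU (p.1, p.2 + (h + k)) * fw p)) /\
  \int[P]_p (fU (p.1, p.2 + k) * (fW p - fW (p.1, p.2 - sigma))) =
  \int[leb]_h (win 0 sigma h * \int[P]_p (fU (p.1, p.2 + (h + k)) * fw p)).
Proof.
move=> s0.
pose Psi (q : (X * TR) * TR) : R :=
  fU (q.1.1, q.1.2 + (q.2 + k)) * fw q.1 * win 0 sigma q.2.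
have mPsi : measurable_fun setT Psi.
  apply: measurable_funM; last first.
    by apply: measurable_win; [exact: measurable_cst|exact: measurable_cst|exact: measurable_snd].
  apply: measurable_funM; last exact: (measurableT_comp fw_measurable measurable_fst).
  apply: (measurableT_comp fU_measurable
    (g := fun q : (X * TR) * TR => (q.1.1, q.1.2 + (q.2 + k)) : X * TR)).
  apply: measurable_fun_pair; first exact: (measurableT_comp measurable_fst measurable_fst).
  apply: measurable_funD; first exact: (measurableT_comp measurable_snd measurable_fst).
  by apply: measurable_funD; [exact: measurable_snd|exact: measurable_cst].
pose L : R := `|k| + sigma + tau.
(* For lags [h + k] with [0 < h <= sigma] all shifted windows lie in []- L, L]], which gives a bound
   uniform in [h]. *)
have [K wh] : exists K : R, forall h, 0 < h -> h <= sigma ->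
    \int[P]_p (fA p * win (h + k) (tau + (h + k)) p.2) <= K.
  exists (\int[P]_p (fA p * win (- L) L p.2)) => h h0 hs.
  apply: Int_le; [exact: fA_integ|exact: fA_integ|move=> p].
  have := ler_norm k; have := ler_norm (- k); rewrite normrN => k1 k2.
  rewrite ler_wpM2l ?fA_ge0//; have t0 := tau0; apply: win_sub; rewrite /L; lra.
have iPsi : integ (PS \x leb)%E Psi.
  have ig := integZ (S * K) (integ_win 0 sigma).
  apply: (@integ_prod2 _ _ _ _ R PS leb Psi (fun h => S * K * win 0 sigma h)).
  - exact: mPsi.
  - exact: ig.
  move=> h.
  have [wz|wz] := eqVneq (win 0 sigma h) 0.
    by rewrite integral0_eq ?wz ?mulr0// => p _; rewrite /Psi /= wz mulr0 normr0.
  have [h0 hs] := win_neq0 wz.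
  have [i1 b1] := fU_integ_shift (h + k).
  rewrite win1// mulr1.
  apply: (@le_trans _ _ (\int[P]_p `|fU (p.1, p.2 + (h + k)) * fw p|%:E)%E).
    by apply: ge0_le_int => p _ //; rewrite /Psi /= win1// mulr1.
  rewrite -Int_EFin ?lee_fin; last exact: integ_norm.
  by apply: le_trans b1 _; rewrite ler_wpM2l ?wh.
have E h : \int[PS]_p Psi (p, h) =
    win 0 sigma h * \int[P]_p (fU (p.1, p.2 + (h + k)) * fw p).
  have [i1 _] := fU_integ_shift (h + k).
  by rewrite Int_prod_sf -IntZ//; apply: eq_Int => p; rewrite /Psi mulrC.
split.
  by have := integ_fubini2 iPsi; under eq_fun do rewrite E.
under [RHS]eq_Int do rewrite -E.
rewrite -(Int_fubini iPsi) -(Int_fubini1 (fU_fWB_integ k s0)).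
have i1 := integ_fubini1 iPsi; rewrite integ_prod_sf in i1.
rewrite Int_prod_sf -(Int_fubini1 i1); apply: eq_Int => x /=.
have mu1 : measurable_fun (setT : set TR) (fun t => fU (x, t + k)).
  exact: (measurable_slice1 x (measurable_shiftP k fU_measurable)).
have H := Int_window sigma mu1 (fwr_measurable x)
  (fun t => fU_bound (x, t + k)) (fun r => fw_bound (x, r)).
under eq_Int do rewrite fWB//.
rewrite H; apply: eq_Int => r; apply: eq_Int => h.
by rewrite /Psi /= addrA.
Qed.

(* Correlation of [U] with [W' = phi(alpha)] at time lag [h]. *)
Definition fK h := \int[P]_p (fU (p.1, p.2 + h) * fw p).

Hypothesis alpha_cvg : forall t (n : nat) e, 0 < t <= tau -> 0 < e -> exists2 d : R, 0 < d &
  forall h, 0 < h < d ->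
    \int[lam]_x (`|alpha (x, t - h) - alpha (x, t)| * \1_(cube n%:R) x) <= e.

Let alpha_slice t : measurable_fun setT (fun x => alpha (x, t)).
Proof. exact: (measurable_slice2 (t : TR) malpha). Qed.

Let fw_slice t : measurable_fun setT (fun x => fw (x, t)).
Proof. exact: (measurable_slice2 (t : TR) fw_measurable). Qed.

Let fU_slice t : measurable_fun setT (fun x => fU (x, t)).
Proof. exact: (measurable_slice2 (t : TR) fU_measurable). Qed.

Let fW_slice t : measurable_fun setT (fun x => fW (x, t)).
Proof. exact: (measurable_slice2 (t : TR) fW_measurable). Qed.

Let fw_boundS p : `|fw p| <= S.
Proof.
by apply: le_trans (fw_bound p) _; rewrite ler_piMr// win_le1.
Qed.

Let iV (n : nat) : integ lam (\1_(cube n%:R) : X -> R).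
Proof. by apply: integ_indic; [exact: cube_measurable|exact: cube_fin]. Qed.

Let loc_integ (n : nat) (f g : X -> R) C : measurable_fun setT f -> measurable_fun setT g ->
  (forall x, `|f x| <= C) -> (forall x, `|g x| <= C) ->
  integ lam (fun x => `|f x - g x| * \1_(cube n%:R) x).
Proof.
move=> mf mg fC gC; apply: (integMb (C := C + C)) => //.
  by apply: measurableT_comp => //; exact: measurable_funB.
by move=> x; rewrite normr_id (le_trans (ler_normB _ _))// lerD.
Qed.

(** Left continuity passes from [alpha] to [phi(alpha)] through [phi_modulus]; the constant part of
    the modulus costs at most [e / 2] over the cube of volume [V]. *)
Lemma fw_cvg t (n : nat) e : 0 < t <= tau -> 0 < e -> exists2 d : R, 0 < d &
  forall h, 0 < h < d ->
    \int[lam]_x (`|fw (x, t - h) - fw (x, t)| * \1_(cube n%:R) x) <= e.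
Proof.
move=> /andP[t0 tt] e0.
pose V := \int[lam]_x \1_(cube n%:R) (x : X) : R.
have V0 : 0 <= V by apply: Int_ge0 => x; rewrite indicE.
have e1 : 0 < e / 2 / (V + 1) by rewrite !divr_gt0// ltr_wpDl.
have [C C0 HC] := phi_modulus phi_cont phi_nd phi0 M0 e1.
have e2 : 0 < e / 2 / (C + 1) by rewrite !divr_gt0// ltr_wpDl.
have [|d d0 Hd] := @alpha_cvg t n _ _ e2; first by rewrite t0.
(* Keeping [h < t] leaves [t - h] inside the time window, where [fw] is [phi(alpha)]. *)
exists (Num.min d t) => [|h]; first by rewrite lt_min d0.
rewrite lt_min => /andP[h0 /andP[hd ht]].
have := Hd h; rewrite h0 hd => /(_ isT) HI.
have ia := loc_integ n (alpha_slice (t - h)) (alpha_slice t)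
  (fun x => alphaM (x, t - h)) (fun x => alphaM (x, t)).
apply: (@le_trans _ _ (\int[lam]_x (e / 2 / (V + 1) * \1_(cube n%:R) x +
   C * (`|alpha (x, t - h) - alpha (x, t)| * \1_(cube n%:R) x)))).
  apply: Int_le.
  - exact: (loc_integ n (fw_slice (t - h)) (fw_slice t)
      (fun x => fw_boundS (x, t - h)) (fun x => fw_boundS (x, t))).
  - by apply: integD; exact: integZ.
  - move=> x; rewrite mulrA -mulrDl ler_wpM2r ?indicE// /fw /= !win1; try lra.
    by rewrite !mulr1; exact: HC.
rewrite IntD ?IntZ//; [|exact: integZ|exact: integZ].
rewrite [leRHS](splitr e) lerD//.
  apply: (@le_trans _ _ (e / 2 / (V + 1) * (V + 1))).
    by rewrite ler_wpM2l ?lerDl// ltW.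
  by rewrite divfK// gt_eqF// ltr_wpDl.
apply: (@le_trans _ _ ((C + 1) * (e / 2 / (C + 1)))).
  by rewrite ler_pM ?lerDl//; apply: Int_ge0 => x; rewrite mulr_ge0// indicE.
by rewrite mulrC divfK// gt_eqF// ltr_wpDl.
Qed.

Lemma fU_ae_integ L : {ae leb, forall t : TR, - L < t <= L -> integ lam (fun x => fU (x, t))}.
Proof.
apply: filterS (integ_ae2 (fA_integ (- L) L)) => t ht /andP[t1 t2].
apply: (integ_dom _ _ ht) => [|x]; first exact: fU_slice.
by rewrite /= win1// mulr1; case: (fU_fA (x, t)).
Qed.

(** The lag is moved from [fU] to the bounded factor [fw]: at a fixed time the integrable slice of
    [fU] is paired with slices of [fw] that converge locally from the left. Dominated convergence in
    time concludes, along a sequence [h n] contradicting the claim. *)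
Lemma fK_cvg e : 0 < e -> exists2 d : R, 0 < d &
  forall h, 0 < h < d -> `|fK h - fK 0| <= e.
Proof.
move=> e0; apply: contrapT => H.
have /choice[h hP] : forall n : nat, exists h, 0 < h < n.+1%:R^-1 /\ e < `|fK h - fK 0|.
  move=> n; apply: contrapT => Hn; apply: H; exists n.+1%:R^-1; first by rewrite invr_gt0.
  move=> h hh; rewrite leNgt; apply/negP => hK; apply: Hn; by exists h.
have h0 n : 0 < h n by case: (hP n) => /andP[].
have h1 n : h n <= 1.
  case: (hP n) => /andP[_ /ltW hn] _; apply: le_trans hn _.
  by rewrite invf_le1 ?ler1n.
have hc : h @ \oo --> (0 : R).
  apply: (squeeze_cvgr (f := fun=> 0) (h := fun n => n.+1%:R^-1)).
  - by apply: nearW => n; case: (hP n) => /andP[/ltW -> /ltW ->].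
  - exact: cvg_cst.
  - exact: inv_succ_cvg0.
pose F k (p : X * R) := fU p * fw (p.1, p.2 - k).
have mF k : measurable_fun (setT : set (X * TR)) (F k).
  apply: measurable_funM; first exact: fU_measurable.
  exact: (measurable_shiftP (- k) fw_measurable).
have FS k : F k = fun p => (fun q : X * R => fU (q.1, q.2 + k) * fw q) (p.1, p.2 - k).
  by apply/funext => -[x t]; rewrite /F /= subrK.
have iF k : integ P (F k).
  have [i _] := fU_integ_shift k.
  by have := integ_shiftP (- k) i; rewrite -(FS k).
have KE k : fK k = \int[leb]_t \int[lam]_x F k (x, t).
  have [i _] := fU_integ_shift k.
  by rewrite (Int_fubini2 (iF k)) (FS k); exact: esym (Int_shiftP (- k) i).
have : (fun n => \int[leb]_t \int[lam]_x F (h n) (x, t)) @ \oo -->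
    \int[leb]_t \int[lam]_x F 0 (x, t).
  have ig := integ_fubini2 (integZ S (fA_integ 0 (tau + 1))).
  apply: (Int_cvg _ _ _ ig).
  - by move=> n; exact: (measurable_Int2 lam (mF _)).
  - exact: (measurable_Int2 lam (mF _)).
  - apply: filterS (fU_ae_integ (tau + 1)) => t it.
    have [tn|tp] := leP t 0.
      have z k : \int[lam]_x F k (x, t) = 0.
        by apply: Int0 => x; rewrite /F /fU /= alpha_le0// subrr mul0r.
      by under eq_fun do rewrite z; rewrite z; exact: cvg_cst.
    (* Beyond [tau] the limit is 0, and the terms vanish as soon as [t - h n] exceeds [tau]. Before
       0 it was [fU] that vanished. *)
    have [tt|tt] := leP t tau; last first.
      rewrite (_ : \int[lam]_x F 0 (x, t) = 0); last first.
        by apply: Int0 => x; rewrite /F /fw /= subr0 win0 ?mulr0//; right.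
      apply: cvg_near_cst; have tt0 : 0 < t - tau by rewrite subr_gt0.
      move/cvgr0Pnorm_lt : hc => /(_ _ tt0); apply: filterS => n; rewrite gtr0_norm// => hn.
      by apply: Int0 => x; rewrite /F /fw /= win0 ?mulr0//; right; rewrite ltrBrDl -ltrBrDr.
    have {}it : integ lam (fun x => fU (x, t)) by apply: it; have := tau0; lra.
    apply/cvgrPdist_le => r r0.
    have [n [q q0 Hq]] := Int_pair_loc S it r0.
    have [|d d0 Hd] := @fw_cvg t n q _ q0; first by rewrite tp.
    move/cvgr0Pnorm_lt : hc => /(_ _ d0); apply: filterS => m; rewrite gtr0_norm// => hm.
    rewrite distrC /F; under [X in _ - X]eq_Int do rewrite /= subr0.
    apply: (Hq (fun x => fw (x, t - h m)) (fun x => fw (x, t))) => //.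
    by apply: Hd; rewrite h0.
  - apply: filterS (integ_ae2 (fA_integ 0 (tau + 1))) => t it n.
    apply: Int_norm_le.
    + apply: (integ_dom _ _ (integZ S it)) => [|x].
        exact: (measurable_slice2 (t : TR) (mF (h n))).
      rewrite /F normrM mulrCA; apply: ler_pM => //; first by case: (fU_fA (x, t)).
      apply: le_trans (fw_bound _) _; rewrite ler_wpM2l//=.
      by rewrite win_shift opprK add0r win_sub ?lerD2l// ltW.
    + exact: integZ.
    + move=> x; rewrite /F normrM mulrCA; apply: ler_pM => //; first by case: (fU_fA (x, t)).
      apply: le_trans (fw_bound _) _; rewrite ler_wpM2l//=.
      by rewrite win_shift opprK add0r win_sub ?lerD2l// ltW.
under eq_fun do rewrite -KE.
rewrite -KE => /cvgrPdist_le/(_ _ e0)[n _ Hn].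
have := Hn n (leqnn n); rewrite distrC leNgt; case: (hP n) => _ ->; by [].
Qed.

Lemma fW_tau x t : tau <= t -> fW (x, t) = fW (x, tau).
Proof.
move=> tt; rewrite /fW; apply: Int_ae.
- apply: measurable_funM => //; exact: measurable_ltb.
- apply: measurable_funM => //; exact: measurable_ltb.
- exists [set tau : TR]; split; first exact: measurable_set1.
    exact: lebesgue_measure_set1.
  move=> r /= h; apply: contrapT => rt; apply: h; rewrite /fw /=.
  have [rtau|rtau|//] := ltgtP r tau; first by rewrite (lt_le_trans rtau tt).
  by rewrite win0 ?mulr0 ?mul0r//; right.
Qed.

(** The difference quotient minus [fw(t)] is the average of [fw(r) - fw(t)] over [r] in [[t - sigma,
    t[]. After Fubini, left continuity bounds each of these differences. *)
Lemma fW_quotient_cvg t (n : nat) e : 0 < t <= tau -> 0 < e -> exists2 d : R, 0 < d &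
  forall sigma, 0 < sigma < d ->
    let q x := `|sigma^-1 * (fW (x, t) - fW (x, t - sigma)) - fw (x, t)| * \1_(cube n%:R) x in
    integ lam q /\ \int[lam]_x q x <= e.
Proof.
move=> tt e0; have [d dp Hd] := fw_cvg n tt e0.
exists d => // sigma /andP[s0 sd] q.
have si0 : 0 < sigma^-1 by rewrite invr_gt0.
pose k r := win r (r + sigma) t.
have kE r : k r = \1_(`[t - sigma, t[%classic) r :> R.
  rewrite indicE /k /win; congr (nat_of_bool _)%:R; apply/idP/idP.
    by rewrite inE/= in_itv/= lerBlDr => /andP[-> ->].
  by rewrite inE/= in_itv/= lerBlDr => /andP[-> ->].
have ik : integ leb k.
  by rewrite (funext kE : k = \1_(`[t - sigma, t[%classic)); exact: integ_itv.
have Ik : \int[leb]_r k r = sigma.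
  apply: EFin_inj; rewrite Int_EFin//; under eq_integral do rewrite kE.
  rewrite (integral_indic _ measurableT) ?setIT; last exact: measurable_itv.
  by rewrite [LHS]leb_itv gtrBl s0 opprB addrC subrK.
have k0 r : 0 <= k r by exact: win_ge0.
pose D (p : X * TR) : R := `|fw p - fw (p.1, t)| * \1_(cube n%:R) p.1 * k p.2.
have mft : measurable_fun (setT : set (X * TR)) (fun p => fw (p.1, t)).
  exact: (measurableT_comp (fw_slice t) measurable_fst).
have mD : measurable_fun setT D.
  apply: measurable_funM; last exact: (measurableT_comp (integ_meas ik) measurable_snd).
  apply: measurable_funM; last exact: (measurableT_comp (integ_meas (iV n)) measurable_fst).
  by apply: measurableT_comp => //; apply: measurable_funB => //; exact: fw_measurable.
have iD : integ P D.
  apply: (integ_dom mD _ (integZ (S + S) (integ_tensor (iV n) ik))) => p.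
  have c0 : 0 <= \1_(cube n%:R) p.1 * k p.2 :> R by rewrite indicE mulr_ge0.
  rewrite /D -mulrA normrM normr_id (ger0_norm c0) ler_wpM2r//.
  by rewrite (le_trans (ler_normB _ _))// lerD.
have isl x : integ leb (fun r => (fw (x, r) - fw (x, t)) * k r).
  apply: (integMb (C := S + S) _ _ ik).
    by apply: measurable_funB.
  by move=> r; rewrite (le_trans (ler_normB _ _))// lerD.
have E x : sigma^-1 * (fW (x, t) - fW (x, t - sigma)) - fw (x, t) =
    sigma^-1 * \int[leb]_r ((fw (x, r) - fw (x, t)) * k r).
  have -> : \int[leb]_r ((fw (x, r) - fw (x, t)) * k r) =
      \int[leb]_r (fw (x, r) * k r) - fw (x, t) * sigma.
    rewrite -[X in _ - _ * X]Ik -IntZ// -IntB; [|by apply: (integMb (C := S))|exact: integZ].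
    by apply: eq_Int => r; rewrite mulrBl.
  rewrite fWB// [RHS]mulrBr; congr (_ - _).
  by rewrite mulrCA mulVf ?mulr1// gt_eqF.
have qD x : q x <= sigma^-1 * \int[leb]_r D (x, r).
  rewrite /q E normrM gtr0_norm// -mulrA ler_wpM2l ?(ltW si0)//.
  rewrite -[X in _ * X]ger0_norm ?indicE// -normrM mulrC -IntZ; last exact: isl.
  have -> : (fun r => D (x, r)) = fun r => `|(x \in cube n%:R)%:R * ((fw (x, r) - fw (x, t)) * k r)|.
    apply/funext => r; rewrite /D /= !normrM indicE [`|k r|]ger0_norm// [`|_%:R|]ger0_norm//.
    by rewrite mulrA; congr (_ * _); rewrite mulrC.
  apply: Int_norm; exact/integZ/isl.
have iID := integZ sigma^-1 (integ_fubini1 iD).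
have mq : measurable_fun setT q.
  apply: measurable_funM; last exact: measurable_cube_indic.
  apply: measurableT_comp => //; apply: measurable_funB => //.
  by apply: measurable_funM => //; apply: measurable_funB.
have q0 x : 0 <= q x by rewrite mulr_ge0// indicE.
have iq : integ lam q by apply: (integ_dom mq _ iID) => x; rewrite ger0_norm.
split => //; apply: le_trans (Int_le iq iID qD) _.
rewrite IntZ; last exact: integ_fubini1 iD.
rewrite (Int_fubini iD) ler_pdivrMl// mulrC -Ik -IntZ//.
apply: Int_le; [exact: integ_fubini2 iD|exact: integZ|move=> r].
have [kz|kz] := eqVneq (k r) 0.
  by rewrite kz mulr0 Int0// => x; rewrite /D /= kz mulr0.
have [h1 h2] := win_neq0 kz; have k1 : k r = 1 by exact: win1.
rewrite k1 mulr1; have hh : 0 < t - r < d.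
  by rewrite subr_gt0 h1/= (le_lt_trans _ sd)// lerBlDl.
have := Hd _ hh; rewrite (_ : t - (t - r) = r); last by ring.
apply: le_trans; rewrite le_eqVlt; apply/orP; left; apply/eqP.
by apply: eq_Int => x; rewrite /D /= k1 mulr1.
Qed.

Lemma fK_average k sigma : 0 < sigma ->
  integ leb (fun h => win 0 sigma h * fK (h + k)) /\
  \int[P]_p (fU (p.1, p.2 + k) * (fW p - fW (p.1, p.2 - sigma))) =
  \int[leb]_h (win 0 sigma h * fK (h + k)).
Proof. exact: time_average. Qed.

Variable mu : {sigma_finite_measure set X -> \bar R}.
Hypothesis mu_mw : integ mu (@mw R N).
Hypothesis pairs : {ae leb, forall t : TR,
  levy_pair mu (fun x => fU (x, t)) (fun x => fW (x, t))}.

(* [fB tau] is the boundary term of the summation by parts, [fD] the discrete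
   analogue of [int U dW] with [U] delayed by [- k]. *)
Definition fG sigma t := - \int[lam]_x
  ((fU (x, t) - fU (x, t - sigma)) * (fW (x, t) - fW (x, t - sigma))).
Definition fB t := \int[lam]_x (fU (x, t) * fW (x, t)).
Definition fD sigma k t := \int[lam]_x (fU (x, t + k) * (fW (x, t) - fW (x, t - sigma))).

Lemma fD_integ sigma k : 0 < sigma -> integ leb (fD sigma k) /\
  \int[leb]_t fD sigma k t = \int[leb]_h (win 0 sigma h * fK (h + k)).
Proof.
move=> s0; have i := fU_fWB_integ k s0; split; first exact: (integ_fubini2 i).
have [_ <-] := fK_average k s0; exact: (Int_fubini2 i).
Qed.

(** Expanding the product of increments gives four pairings. The first identity is algebra; the
    second needs the two mixed pairings to be equal, which is [levy_pair_sym]; the bound is the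
    energy estimate for the difference of the pairs at [t] and [t - sigma]. *)
Lemma fG_fD sigma : {ae leb, forall t : TR,
  [/\ fG sigma t = fD sigma (- sigma) t - fD sigma 0 t,
      fD sigma 0 t + fD sigma (- sigma) t = fB t - fB (t - sigma) &
      (EE mu (fun x => (fW (x, t) - fW (x, t - sigma))%R) <= (2 * fG sigma t)%:E)%E]}.
Proof.
have ps := ae_shift (- sigma) pairs.
apply: filterS2 pairs ps => t P1 P2.
have [i1 _ _ _ _] := P1; have [i2 _ _ _ _] := P2.
have iUW (u : X -> R) s : integ lam u -> integ lam (fun x => u x * fW (x, s)).
  move=> iu; under eq_fun do rewrite mulrC.
  exact: (integMb (fW_slice s) (fun x => fW_bound (x, s)) iu).
have i11 := iUW _ t i1; have i12 := iUW _ (t - sigma) i1.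
have i21 := iUW _ t i2; have i22 := iUW _ (t - sigma) i2.
have D0 : fD sigma 0 t = fB t - \int[lam]_x (fU (x, t) * fW (x, t - sigma)).
  rewrite /fD /fB -IntB//; apply: eq_Int => x; by rewrite addr0 mulrBr.
have Ds : fD sigma (- sigma) t =
    \int[lam]_x (fU (x, t - sigma) * fW (x, t)) - fB (t - sigma).
  by rewrite /fD /fB -IntB//; apply: eq_Int => x; rewrite mulrBr.
have sym := levy_pair_sym mu_mw P1 P2.
have E1 : \int[lam]_x (fU (x, t) * fW (x, t - sigma)) =
    \int[lam]_x (fU (x, t - sigma) * fW (x, t)).
  transitivity (\int[lam]_x (fW (x, t - sigma) * fU (x, t))).
    by apply: eq_Int => x; rewrite mulrC.
  by rewrite sym; apply: eq_Int => x; rewrite mulrC.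
have GE : fG sigma t = fD sigma (- sigma) t - fD sigma 0 t.
  by rewrite D0 Ds /fG (Int_mulBB i11 i12 i21 i22) opprB.
split; [exact: GE|by rewrite D0 Ds E1 addrA subrK|].
apply: le_trans (levy_pair_energy mu_mw (levy_pairB mu_mw P1 P2)) _.
rewrite lee_fin /fG mulNr mulrN lerN2 le_eqVlt; apply/orP; left; apply/eqP; congr (_ * _).
by apply: eq_Int => x; rewrite mulrC.
Qed.

(** The second identity of [fG_fD] telescopes in time: [fB] vanishes before 0 and is frozen after
    [tau]. *)
Lemma fB_tau sigma : 0 < sigma ->
  \int[leb]_t fD sigma 0 t + \int[leb]_t fD sigma (- sigma) t = sigma * fB tau.
Proof.
move=> s0; have [i0 _] := fD_integ 0 s0; have [is_ _] := fD_integ (- sigma) s0.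
have mB : measurable_fun (setT : set TR) fB.
  apply: (measurable_Int2 lam (F := fun p => fU p * fW p)).
  by apply: measurable_funM; [exact: fU_measurable|exact: fW_measurable].
have iB : integ leb (fun t => fB t * win 0 tau t).
  have iF : integ P (fun p => fU p * fW p * win 0 tau p.2).
    apply: (integ_dom _ _ (integZ (S * tau) (fA_integ 0 tau))).
      apply: measurable_funM; last by apply: measurable_win => //; exact: measurable_cst.
      by apply: measurable_funM; [exact: fU_measurable|exact: fW_measurable].
    move=> p; rewrite normrM normrM mulrA [`|win _ _ _|]ger0_norm ?win_ge0//.
    rewrite ler_wpM2r ?win_ge0// mulrC; apply: ler_pM => //; first exact: fW_bound.
    by case: (fU_fA p).
  have := integ_fubini2 iF; congr integ; apply/funext => t /=.
  have [wz|wz] := eqVneq (win 0 tau t) 0.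
    by rewrite wz mulr0; apply: Int0 => x; rewrite mulr0.
  have [h1 h2] := win_neq0 wz; rewrite win1// mulr1.
  by apply: eq_Int => x; rewrite mulr1.
have [||ib ibE] := @Int_shift_diff R fB tau sigma s0 tau0 _ _ iB.
- by move=> t t0; apply: Int0 => x; rewrite /fU /= alpha_le0// subrr mul0r.
- move=> t tt; apply: eq_Int => x; rewrite (fW_tau _ tt); congr (_ * _).
  by rewrite /fU /= alpha_ge.
rewrite -ibE -IntD//; apply: Int_ae.
- exact: measurable_funD (integ_meas i0) (integ_meas is_).
- exact: integ_meas ib.
- by apply: filterS (fG_fD sigma) => t [].
Qed.

Lemma fG_ge0 sigma : {ae leb, forall t : TR, 0 <= fG sigma t}.
Proof.
apply: filterS (fG_fD sigma) => t [_ _ h].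
have : (0%:E <= (2 * fG sigma t)%:E)%E by apply: le_trans h; exact: EE_ge0.
by rewrite lee_fin pmulr_rge0.
Qed.

Lemma fG_integ sigma : 0 < sigma -> integ leb (fG sigma) /\
  \int[leb]_t fG sigma t = \int[leb]_t fD sigma (- sigma) t - \int[leb]_t fD sigma 0 t.
Proof.
move=> s0; have [i0 _] := fD_integ 0 s0; have [is_ _] := fD_integ (- sigma) s0.
have mG : measurable_fun (setT : set TR) (fG sigma).
  apply: measurable_funN; apply: (measurable_Int2 lam (F := fun p =>
    (fU p - fU (p.1, p.2 - sigma)) * (fW p - fW (p.1, p.2 - sigma)))).
  apply: measurable_funM; apply: measurable_funB.
  - exact: fU_measurable.
  - exact: (measurable_shiftP (- sigma) fU_measurable).
  - exact: fW_measurable.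
  - exact: (measurable_shiftP (- sigma) fW_measurable).
have iD := integB is_ i0.
have ae1 : {ae leb, forall t : TR, fD sigma (- sigma) t - fD sigma 0 t = fG sigma t}.
  by apply: filterS (fG_fD sigma) => t [].
split; first exact: (integ_ae (integ_meas iD) mG ae1 iD).
rewrite -IntB//; apply: esym.
by apply: Int_ae; [exact: integ_meas iD|exact: mG|exact: ae1].
Qed.

(** Since [fG >= 0], the integral of [fD sigma 0] is at most half of [sigma * fB tau]. Divided by
    [sigma] it is an average of [fK] over lags in []0, sigma]], which tends to [fK 0]. *)
Lemma fK0_le : 2 * fK 0 <= fB tau.
Proof.
apply/ler_addgt0Pr => e e0; have e20 : 0 < e / 2 by rewrite divr_gt0.
have [d d0 Hd] := fK_cvg e20; have s0 : 0 < d / 2 by rewrite divr_gt0.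
have [iG GE] := fG_integ s0; have [i0 D0] := fD_integ 0 s0.
have G0 : 0 <= \int[leb]_t fG (d / 2) t.
  rewrite -(Int0 leb (f := fun=> 0))//.
  apply: ae_Int_le => //; [exact: integ0|exact: fG_ge0].
have := fB_tau s0; rewrite GE in G0 => BE.
have [iK _] := fK_average 0 s0.
have : d / 2 * (fK 0 - e / 2) <= \int[leb]_t fD (d / 2) 0 t.
  rewrite D0 -[X in X * _](subr0 (d / 2)) -(Int_win (ltW s0)) mulrC -IntZ; last exact: integ_win.
  apply: Int_le => //; first exact/integZ/integ_win.
  move=> h; rewrite addr0 mulrC.
  have [wz|wz] := eqVneq (win 0 (d / 2) h) 0; first by rewrite wz !mul0r.
  have [h0 hd] := win_neq0 wz; rewrite ler_wpM2l ?win_ge0//.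
  have hd' : 0 < h < d by rewrite h0 (le_lt_trans hd)// ltr_pdivrMr// ltr_pMr// ltr1n.
  by have := Hd h hd'; rewrite ler_distl => /andP[].
by move=> IE; exact: (fK0_le_aux s0 IE BE G0).
Qed.

Variables (Phi : R -> R) (c d0 : R).
Hypothesis mPhi : measurable_fun setT Phi.
Hypothesis Phi_convex : forall a b, phi a * (b - a) <= Phi b - Phi a.
Hypothesis Phi_bound : forall a, `|a| <= M -> `|Phi a| <= S * `|a|.

Definition fF t := \int[lam]_x Phi (alpha (x, t)).

Hypothesis d0_gt0 : 0 < d0.
Hypothesis d0_lt : d0 < tau.
Hypothesis fF_ge : {ae leb, forall t : TR, tau - d0 <= t <= tau -> c <= fF t}.

Lemma Phi_integ a b : integ P (fun p => Phi (alpha p) * win a b p.2).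
Proof.
apply: (integ_dom _ _ (integZ S (fA_integ a b))).
  apply: measurable_funM; first exact: (measurableT_comp mPhi malpha).
  by apply: measurable_win => //; exact: measurable_cst.
move=> p; rewrite normrM mulrA [`|win _ _ _|]ger0_norm ?win_ge0// ler_wpM2r ?win_ge0//.
apply: le_trans (Phi_bound (alphaM p)) _; rewrite ler_wpM2l//.
by case: (fU_fA p).
Qed.

(** Convexity bounds [phi(alpha(t)) (alpha(t - k) - alpha(t))] by the increment of [Phi]. Integrated
    over []0, tau]], the shift gains [k int Phi(u0)] at the start, where [alpha] is frozen, and
    loses the integral of [fF] over the last interval of length [k], which is at least [k c]. *)
Lemma fK_le k : 0 <= k <= d0 ->
  fK (- k) - fK 0 <= k * (\int[lam]_x Phi (u0 x) - c).
Proof.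
move=> /andP[k0 kd].
have [iKk _] := fU_integ_shift (- k); have [iK0 _] := fU_integ_shift 0.
have j0 := Phi_integ 0 tau.
have j1 : integ P (fun p => Phi (alpha (p.1, p.2 - k)) * win 0 tau p.2).
  have := integ_shiftP (- k) (Phi_integ (- k) (tau - k)); congr integ.
  by apply/funext => p /=; rewrite win_shift !opprK addNr subrK.
apply: (@le_trans _ _ (\int[P]_p (Phi (alpha (p.1, p.2 - k)) * win 0 tau p.2) -
    \int[P]_p (Phi (alpha p) * win 0 tau p.2))).
  rewrite /fK -IntB// -[leRHS]IntB//; apply: Int_le; [exact: integB|exact: integB|].
  move=> [x t] /=; rewrite -!mulrBl /fw mulrA ler_wpM2r ?win_ge0//.
  apply: le_trans (Phi_convex _ _); rewrite /fU /= addr0 mulrC.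
  by rewrite le_eqVlt; apply/orP; left; apply/eqP; ring.
have winF (f : R -> X -> R) t :
    \int[lam]_x (f t x * win 0 tau t) = \int[lam]_x f t x * win 0 tau t.
  have [wz|wz] := eqVneq (win 0 tau t) 0.
    by rewrite wz mulr0; apply: Int0 => x; rewrite mulr0.
  have [h1 h2] := win_neq0 wz; rewrite win1// mulr1.
  by apply: eq_Int => x; rewrite mulr1.
pose g t := fF t * win 0 tau t.
have ig : integ leb g.
  have := integ_fubini2 j0; congr integ; apply/funext => t /=.
  exact: (winF (fun t x => Phi (alpha (x, t)))).
have igk : integ leb (fun t => g (t - k)) := integ_shift1 (- k) ig.
have mg := integ_meas ig.
have iw : integ leb (fun t => g (t - k) * win tau (tau + k) t).
  under eq_fun do rewrite mulrC.
  apply: (integMb (C := 1) _ _ igk); first exact: integ_meas (integ_win _ _).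
  by move=> t; rewrite ger0_norm ?win_ge0 ?win_le1.
rewrite -(Int_fubini2 j0) -(Int_fubini2 j1).
have -> : \int[leb]_t \int[lam]_x (Phi (alpha ((x, t).1, (x, t).2 - k)) * win 0 tau (x, t).2) =
    \int[leb]_t (\int[lam]_x Phi (u0 x) * win 0 k t + (g (t - k) - g (t - k) * win tau (tau + k) t)).
  apply: eq_Int => t /=; rewrite (winF (fun t x => Phi (alpha (x, t - k)))) -/(fF (t - k)).
  have kt := le_lt_trans kd d0_lt.
  rewrite /g; have [tn|tp] := leP t 0.
    rewrite !win0 ?mulr0 ?mul0r ?subrr ?addr0//; left => //; lra.
  have [tk|tk] := leP t k.
    rewrite (win1 tp); last exact: ltW (le_lt_trans tk kt).
    rewrite (win1 tp tk) [win 0 tau (t - k)]win0; last by left; rewrite subr_le0.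
    rewrite !mulr0 mul0r subrr addr0 !mulr1; apply: eq_Int => x.
    by rewrite alpha_le0// subr_le0.
  have tk0 : 0 < t - k by rewrite subr_gt0.
  rewrite [win 0 k t]win0 ?mulr0 ?add0r; last by right.
  have [tt|tt] := leP t tau.
    rewrite (win1 tp tt) [win 0 tau (t - k)]win1 ?mulr1//; last by lra.
    by rewrite win0 ?mulr0 ?subr0//; left.
  rewrite [win 0 tau t]win0 ?mulr0//; last by right.
  have [tt'|tt'] := leP t (tau + k).
    by rewrite [win tau _ t]win1// mulr1 subrr.
  by rewrite [win 0 tau _]win0 ?mulr0 ?mul0r ?subrr//; right; lra.
have -> : \int[leb]_t \int[lam]_x (Phi (alpha (x, t)) * win 0 tau (x, t).2) = \int[leb]_t g t.
  by apply: eq_Int => t; exact: (winF (fun t x => Phi (alpha (x, t)))).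
rewrite IntD; [|exact/integZ/integ_win|exact: integB].
rewrite IntB// IntZ ?Int_win ?subr0//; last exact: integ_win.
rewrite (Int_shift1 (- k) mg).
have : c * k <= \int[leb]_t (g (t - k) * win tau (tau + k) t).
  rewrite -[X in _ * X](_ : \int[leb]_t win tau (tau + k) t = k); last first.
    by rewrite Int_win ?lerDl// addrC addKr.
  rewrite -IntZ; last exact: integ_win.
  apply: ae_Int_le => //; first exact/integZ/integ_win.
  have fk := ae_shift (- k) fF_ge; apply: filterS fk => t h.
  have [wz|wz] := eqVneq (win tau (tau + k) t) 0; first by rewrite wz !mulr0.
  have [h1 h2] := win_neq0 wz; rewrite ler_wpM2r ?win_ge0//.
  have kt := le_lt_trans kd d0_lt.
  rewrite /g win1 ?mulr1; [apply: h; apply/andP; split| |]; lra.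
move=> h; rewrite mulrBr mulrC [k * c]mulrC; lra.
Qed.

(** By [fK_le] the lag [h - sigma] costs at most [sigma - h] times the drop of [int Phi]. Averaging
    this ramp gives [sigma^2 / 2], and the summation by parts doubles it. *)
Lemma fG_Int_le sigma : 0 < sigma <= d0 ->
  \int[leb]_t fG sigma t <= sigma ^+ 2 * (\int[lam]_x Phi (u0 x) - c).
Proof.
move=> /andP[s0 sd]; have [_ ->] := fG_integ s0.
have BE := fB_tau s0; have KB := fK0_le.
have [iK _] := fK_average (- sigma) s0; have [_ DE] := fD_integ (- sigma) s0.
set L := _ - c.
have ir : integ leb (fun h => win 0 sigma h * (sigma - h)).
  apply: (@integ_dom _ TR R leb _ (fun h => sigma * win 0 sigma h)); last exact/integZ/integ_win.
    apply: measurable_funM; first exact: integ_meas (integ_win 0 sigma).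
    by apply: measurable_funB => //; exact: measurable_TRid.
  move=> h; have [wz|wz] := eqVneq (win 0 sigma h) 0.
    by rewrite wz mul0r mulr0 normr0.
  have [h0 hs] := win_neq0 wz; rewrite normrM mulrC ger0_norm ?subr_ge0//.
  by rewrite ger0_norm ?win_ge0// ler_wpM2r ?win_ge0// gerBl ltW.
have : \int[leb]_t fD sigma (- sigma) t <= sigma * fK 0 + L * (sigma ^+ 2 / 2).
  rewrite DE -(Int_win_ramp s0) -(IntZ L ir).
  have -> : sigma * fK 0 = \int[leb]_h (fK 0 * win 0 sigma h).
    by rewrite IntZ ?Int_win ?subr0 ?ltW 1?mulrC//; exact: integ_win.
  rewrite -IntD; [|exact/integZ/integ_win|exact: integZ].
  apply: Int_le => //; first by apply: integD; [exact/integZ/integ_win|exact: integZ].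
  move=> h; have [wz|wz] := eqVneq (win 0 sigma h) 0; first by rewrite wz !(mul0r, mulr0) addr0.
  have [h0 hs] := win_neq0 wz; rewrite win1// mulr1 !mul1r -lerBlDl.
  have := @fK_le (sigma - h); rewrite opprB [L * _]mulrC; apply.
  by rewrite subr_ge0 hs/= (le_trans _ sd)// gerBl ltW.
exact: fG_Int_le_aux s0 BE KB.
Qed.

End frozen.

(** * The weak equation integrated in time *)

Section clipping.
Context {R : realType}.
Variable M : R.
Hypothesis M0 : 0 <= M.
Implicit Types a b : R.

Definition clip a : R := Num.max (- M) (Num.min M a).

Lemma clip_bound a : `|clip a| <= M.
Proof.
have hM : - M <= M by rewrite ge0_cp.
by rewrite ler_norml /clip le_max lexx ge_max hM ge_min lexx.
Qed.

Lemma clip_id a : `|a| <= M -> clip a = a.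
Proof. by rewrite ler_norml => /andP[h1 h2]; rewrite /clip (min_idPr h2) (max_idPr h1). Qed.

Lemma clip_lip a b : `|clip a - clip b| <= `|a - b|.
Proof.
wlog ab : a b / a <= b.
  by move=> H; have [/H//|/ltW/H] := leP a b; rewrite distrC [leRHS]distrC.
rewrite [leRHS]distrC [leRHS]ger0_norm ?subr_ge0// ler_norml /clip.
by case: (ltP M a) => ?; case: (ltP M b) => ?; case: (ltP (- M) M) => ?;
  case: (ltP (- M) a) => ?; case: (ltP (- M) b) => ?; apply/andP; split; lra.
Qed.

Lemma clip0 : clip 0 = 0.
Proof. by rewrite clip_id// normr0. Qed.

Lemma clip_le_norm a : `|clip a| <= `|a|.
Proof. by have := clip_lip a 0; rewrite clip0 !subr0. Qed.

Lemma clip_measurable d (T : measurableType d) (f : T -> R) :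
  measurable_fun setT f -> measurable_fun setT (fun x => clip (f x)).
Proof. by move=> mf; apply: measurable_maxr => //; exact: measurable_minr. Qed.

End clipping.

Section slices.
Context {R : realType} (N : nat).
Local Notation X := 'rV[R]_N.
Local Notation TR := (measurableTypeR R).
Local Notation leb := (@lebesgue_measure R).
Local Notation lam := (@lebesgue_rV R N).
Local Notation P := (lam \x leb)%E.

Lemma ae_slice (Q : X * TR -> Prop) : {ae P, forall p : X * TR, Q p} ->
  {ae leb, forall t : TR, {ae lam, forall x : X, Q (x, t)}}.
Proof.
move=> [A [mA A0 QA]].
have m1 : measurable_fun setT (fun p : X * TR => (\1_A p : R)%:E).
  by apply/measurable_EFinP; exact: measurable_indic.
have h0 : (\int[leb]_t \int[lam]_x (\1_A (x, t) : R)%:E = 0)%E.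
  rewrite -(@fubini_tonelli2 _ _ _ _ R lam leb _ m1); last by move=> p; rewrite lee_fin indicE.
  by rewrite integral_indic// setIT.
have mG : measurable_fun (setT : set TR) (fun t => \int[lam]_x (\1_A (x, t) : R)%:E)%E.
  by apply: (measurable_fun_fubini_tonelli_G (m1 := lam) (fun p => (\1_A p : R)%:E)).
have := (proj1 (ae_eq_integral_abs leb measurableT mG)).
rewrite (_ : integral _ _ _ = 0)%E; last first.
  rewrite -[RHS]h0; apply: eq_integral => t _; rewrite gee0_abs//.
  by apply: integral_ge0 => x _; rewrite lee_fin indicE.
move=> /(_ erefl); apply: filterS => t /(_ I) /= Ht.
exists (ysection A t); split.
- exact: measurable_ysection.
- transitivity (\int[lam]_x (\1_(ysection A t) x : R)%:E)%E.
    by rewrite (integral_indic _ measurableT) ?setIT//; exact: measurable_ysection.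
  rewrite -[RHS]Ht; apply: eq_integral => x _; rewrite !indicE; congr (nat_of_bool _)%:R%:E.
  by apply/idP/idP; rewrite /ysection !inE /= ?inE.
- by move=> x /= h; rewrite /ysection /= inE; apply: QA.
Qed.

(** A null set contains no interval of positive length; this selects good times near a given one. *)
Lemma ae_witness (Q : R -> Prop) a b : {ae leb, forall t : TR, Q t} -> a < b ->
  exists2 t, a < t < b & Q t.
Proof.
move=> [A [mA A0 QA]] ab; apply: contrapT => H.
have sub : `]a, b[%classic `<=` A.
  move=> t /=; rewrite in_itv/= => tab; apply: QA => /= Qt; apply: H; by exists t.
have : (leb `]a, b[%classic <= leb A)%E.
  by apply: le_measure => //; rewrite inE//; exact: measurable_itv.
by rewrite A0 [X in (X <= _)%E]leb_itv ab lee_fin subr_le0 leNgt ab.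
Qed.

End slices.

(** * A version of the solution that is bounded everywhere *)

Section truncated_solution.
Context {R : realType} (N : nat).
Local Notation X := 'rV[R]_N.
Local Notation TR := (measurableTypeR R).
Local Notation leb := (@lebesgue_measure R).
Local Notation lam := (@lebesgue_rV R N).
Local Notation P := (lam \x leb)%E.
Variables (T M : R) (u : X * R -> R).
Hypothesis M0 : 0 <= M.
Hypothesis u_L1 : in_L1 P (QT T) u.
Hypothesis u_bd : {ae P, forall p : X * TR, QT T p -> `|u p| <= M}.
Hypothesis u_cont : C_L1_loc T u.

(** Closed cubes, because continuity in time is given on compact sets, while local distances are
    measured on the open [cube]. *)
Definition ccube (n : nat) : set X := [set x | forall i, x 0 i \in `[- n%:R, n%:R]].

Lemma ccube_compact n : compact (ccube n).
Proof. by apply: (@rV_compact R N (fun=> `[- n%:R, n%:R]%classic)) => i; exact: segment_compact. Qed.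

Lemma ccube_measurable n : measurable (ccube n).
Proof.
have := cbox_measurable (const_mx (- n%:R) : X) (const_mx n%:R); congr measurable.
by apply/seteqP; split => x H i; have := H i; rewrite !mxE.
Qed.

Lemma cube_ccube n : cube n%:R `<=` ccube n.
Proof. by move=> x H i; rewrite in_itv/= -ler_norml ltW//; exact: H. Qed.

Lemma QT_measurable : measurable (QT T : set (X * TR)).
Proof. by apply: measurableX => //; exact: measurable_itv. Qed.

Lemma u_slice_measurable t : t \in `[0, T] -> measurable_fun setT (fun x => u (x, t)).
Proof.
move=> tT; have -> : [set: X] = \bigcup_n ccube n.
  apply/seteqP; split => // x _; have [n _ xn] : (\bigcup_n cube n%:R) x by rewrite cube_bigcup.
  by exists n => //; exact: cube_ccube.
apply/(measurable_fun_bigcup _ (fun n => ccube_measurable n)) => n.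
have [/(_ t tT) h _] := u_cont (@ccube_compact n).
by have mh := measurable_int _ h; exact/measurable_EFinP.
Qed.

Lemma u_cont_loc t0 n (e : R) : t0 \in `[0, T] -> 0 < e -> exists2 d : R, 0 < d &
  forall t, t \in `[0, T] -> `|t - t0| < d ->
  (\int[lam]_(x in ccube n) `|u (x, t) - u (x, t0)|%:E <= e%:E)%E.
Proof.
move=> t0T e0; have [_ /(_ t0 t0T) h] := u_cont (@ccube_compact n).
have := h [set y : \bar R | (y < e%:E)%E] _.
have o : nbhs (0%E : \bar R) [set y : \bar R | (y < e%:E)%E].
  exists e => //= y; rewrite /ball_/= sub0r normrN => ye.
  by rewrite lte_fin (le_lt_trans (ler_norm _)).
move=> /(_ o)[d /= d0 Hd]; exists d => // t tT td.
by apply: ltW; apply: Hd => //=; rewrite distrC.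
Qed.

(* The bound on [u] holds only almost everywhere, and [u] is measurable only on
   [QT T]; [ubar] is a globally measurable version bounded everywhere. *)
Definition ubar (p : X * R) : R := clip M ((u \_ (QT T)) p).

Lemma ubarE x t : 0 < t < T -> ubar (x, t) = clip M (u (x, t)).
Proof.
by move=> h; rewrite /ubar patchE mem_set//; split => //=; rewrite in_itv.
Qed.

Lemma ubar_out x t : ~~ (0 < t < T) -> ubar (x, t) = 0.
Proof.
move=> h; rewrite /ubar patchE memNset ?clip0// => -[_] /=.
by rewrite in_itv/= (negbTE h).
Qed.

Lemma ubar_bound p : `|ubar p| <= M.
Proof. exact: clip_bound. Qed.

Lemma u_restrict_integ : integ P (u \_ (QT T)).
Proof.
have := u_L1; rewrite /in_L1 (integrable_mkcond _ QT_measurable); congr (_.-integrable _ _).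
by apply/funext => p; rewrite /= !patchE; case: ifP.
Qed.

Lemma ubar_measurable : measurable_fun (setT : set (X * TR)) ubar.
Proof. by apply: clip_measurable; exact: integ_meas u_restrict_integ. Qed.

Lemma ubar_integ : integ P ubar.
Proof.
apply: (integ_dom ubar_measurable _ (integ_norm u_restrict_integ)) => p.
exact: clip_le_norm.
Qed.

Lemma clip_loc t t0 n (e : R) : t \in `[0, T] -> t0 \in `[0, T] ->
  (\int[lam]_(x in ccube n) `|u (x, t) - u (x, t0)|%:E <= e%:E)%E ->
  \int[lam]_x (`|clip M (u (x, t)) - clip M (u (x, t0))| * \1_(cube n%:R) x) <= e.
Proof.
move=> tT t0T h.
have mc s : s \in `[0, T] -> measurable_fun setT (fun x => clip M (u (x, s))).
  by move=> sT; apply: clip_measurable; exact: u_slice_measurable.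
have iV : integ lam (\1_(cube n%:R) : X -> R).
  by apply: integ_indic; [exact: cube_measurable|exact: cube_fin].
have i : integ lam (fun x => `|clip M (u (x, t)) - clip M (u (x, t0))| * \1_(cube n%:R) x).
  apply: (integMb (C := M + M)) => //.
    by apply: measurableT_comp => //; apply: measurable_funB; exact: mc.
  by move=> x; rewrite normr_id (le_trans (ler_normB _ _))// lerD// clip_bound.
rewrite -lee_fin Int_EFin//; apply: le_trans h; rewrite [leRHS]integral_mkcond.
apply: ge0_le_int => x _; first by rewrite lee_fin mulr_ge0// indicE.
rewrite patchE indicE; have [xc|xc] := boolP (x \in cube n%:R).
  rewrite mem_set; last by apply: cube_ccube; rewrite -inE.
  by rewrite mulr1 lee_fin clip_lip.
by rewrite /= mulr0; case: ifP => _ //; rewrite lee_fin.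
Qed.

Lemma clip_cont t0 n (e : R) : t0 \in `[0, T] -> 0 < e -> exists2 d : R, 0 < d &
  forall t, t \in `[0, T] -> `|t - t0| < d ->
  \int[lam]_x (`|clip M (u (x, t)) - clip M (u (x, t0))| * \1_(cube n%:R) x) <= e.
Proof.
move=> t0T e0; have [d d0 Hd] := u_cont_loc n t0T e0; exists d => // t tT td.
by apply: clip_loc => //; exact: Hd.
Qed.

Lemma u_slice_clip : {ae leb, forall t : TR, 0 < t < T ->
  {ae lam, forall x : X, u (x, t) = clip M (u (x, t))}}.
Proof.
apply: filterS (ae_slice u_bd) => t h tT; move: h; apply: filterS => x h.
by rewrite clip_id//; apply: h; split => //=; rewrite in_itv.
Qed.

(** The space-time bound gives the bound on slices at almost every time; continuity in time, local
    in L^1, then extends it to every time, including [T]. *)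
Lemma u_clip t : 0 < t <= T -> {ae lam, forall x : X, u (x, t) = clip M (u (x, t))}.
Proof.
move=> /andP[t0 tT]; have tI : t \in `[0, T] by rewrite in_itv/= (ltW t0).
have mu_ := u_slice_measurable tI.
have mcu := clip_measurable M mu_.
suff H n : (\int[lam]_x ((`|u (x, t) - clip M (u (x, t))| * \1_(cube n%:R) x)%:E) = 0)%E.
  have : {ae lam, forall x : X, forall n, (`|u (x, t) - clip M (u (x, t))| * \1_(cube n%:R) x)%:E = 0%E}.
    apply: ae_foralln => n.
    have m : measurable_fun setT (fun x : X => (`|u (x, t) - clip M (u (x, t))| * \1_(cube n%:R) x)%:E).
      apply/measurable_EFinP; apply: measurable_funM; last exact: measurable_cube_indic.
      by apply: measurableT_comp => //; exact: measurable_funB.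
    have := proj1 (ae_eq_integral_abs lam measurableT m).
    rewrite (_ : integral _ _ _ = 0)%E; last first.
      rewrite -[RHS](H n); by apply: eq_integral => x _; rewrite gee0_abs// lee_fin mulr_ge0// indicE.
    by move=> /(_ erefl); apply: filterS => x /(_ I).
  apply: filterS => x Hx.
  have [n _ xn] : (\bigcup_n cube n%:R) x by rewrite cube_bigcup.
  have /= := Hx n; rewrite indicE mem_set// mulr1 => -[] /eqP.
  by rewrite normr_eq0 subr_eq0 => /eqP.
apply: le_anti; apply/andP; split; last first.
  by apply: integral_ge0 => x _; rewrite lee_fin mulr_ge0// indicE.
apply/lee_addgt0Pr => e e0; rewrite add0e.
have e20 : 0 < e / 2 by rewrite divr_gt0.
have [d d0 Hd] := u_cont_loc n tI e20.
(* A good time is taken just before [t], so that it exists also for [t = T]. *)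
have [|s /andP[s1 s2] us] := ae_witness (a := Num.max 0 (t - d)) (b := t) u_slice_clip.
  by rewrite gt_max t0 gtrBl.
have [s0 sd] : 0 < s /\ t - d < s by move: s1; rewrite gt_max => /andP[].
have sT : s < T by exact: lt_le_trans tT.
have sI : s \in `[0, T] by rewrite in_itv/= !ltW.
have {}Hd := Hd s sI; rewrite ltr_distlC in Hd.
have {}Hd : (\int[lam]_(x in ccube n) `|u (x, s) - u (x, t)|%:E <= (e / 2)%:E)%E.
  by apply: Hd; apply/andP; split; lra.
have c2 := clip_loc sI tI Hd.
have {}us := us _; have ust : {ae lam, forall x : X, u (x, s) = clip M (u (x, s))}.
  by apply: us; rewrite s0.
have ms := u_slice_measurable sI; have mcs := clip_measurable M ms.
have m1 : measurable_fun setT (fun x : X => `|u (x, s) - u (x, t)|%:E).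
  by apply/measurable_EFinP/measurableT_comp => //; exact: measurable_funB.
have iV : integ lam (\1_(cube n%:R) : X -> R).
  by apply: integ_indic; [exact: cube_measurable|exact: cube_fin].
have i2 : integ lam (fun x => `|clip M (u (x, s)) - clip M (u (x, t))| * \1_(cube n%:R) x).
  apply: (integMb (C := M + M)) => //.
    by apply: measurableT_comp => //; exact: measurable_funB.
  by move=> x; rewrite normr_id (le_trans (ler_normB _ _))// lerD// clip_bound.
apply: (@le_trans _ _ (\int[lam]_x ((fun x => `|u (x, s) - u (x, t)|%:E) \_ (ccube n)) x +
    \int[lam]_x (`|clip M (u (x, s)) - clip M (u (x, t))| * \1_(cube n%:R) x)%:E)%E).
  rewrite -ge0_integralD//.
  - apply: ae_ge0_le_integral => //.
    + apply/measurable_EFinP; apply: measurable_funM; last exact: measurable_cube_indic.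
      by apply: measurableT_comp => //; exact: measurable_funB.
    + by move=> x _; apply: adde_ge0; [rewrite patchE; case: ifP|rewrite lee_fin mulr_ge0// indicE].
    + have mi2 := integ_meas i2; apply: emeasurable_funD; last exact/measurable_EFinP.
      by apply/(measurable_restrictT _ (ccube_measurable n)); exact: measurable_funTS.
    + move: ust; apply: filterS => x Hx _; rewrite patchE indicE.
      have [xc|xc] := boolP (x \in cube n%:R); last first.
        by rewrite /= !mulr0 adde0; case: ifP => _ //; rewrite lee_fin.
      rewrite mem_set; last by apply: cube_ccube; rewrite -inE.
      rewrite !mulr1 -EFinD lee_fin -Hx distrC.
      rewrite [X in _ <= X](_ : _ = `|u (x, t) - u (x, s)| + `|u (x, s) - clip M (u (x, t))|).
        by rewrite distrC; exact: ler_distD.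
      by rewrite distrC.
  - by move=> x _; rewrite patchE; case: ifP.
  - by apply/(measurable_restrictT _ (ccube_measurable n)); exact: measurable_funTS.
  - by have mi2 := integ_meas i2; exact/measurable_EFinP.
rewrite -integral_mkcond -(Int_EFin i2) (splitr e) EFinD; apply: leeD => //.
Qed.

End truncated_solution.

(** * From test functions to the time-integrated equation *)

Section weak_equation.
Context {R : realType} (N : nat).
Local Notation X := 'rV[R]_N.
Local Notation TR := (measurableTypeR R).
Local Notation leb := (@lebesgue_measure R).
Local Notation lam := (@lebesgue_rV R N).
Local Notation P := (lam \x leb)%E.
Variables (phi : R -> R) (T M : R) (u : X * R -> R) (u0 : X -> R).
Variable mu : {sigma_finite_measure set X -> \bar R}.
Hypothesis mu_even : forall A : set X, measurable A -> mu (-%R @^-1` A) = mu A.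
Hypothesis mu_mw : integ mu (@mw R N).
Hypothesis phi_cont : continuous phi.
Hypothesis phi_nd : {homo phi : a b / a <= b}.
Hypothesis phi0 : phi 0 = 0.
Hypothesis M0 : 0 <= M.
Hypothesis u_L1 : in_L1 P (QT T) u.
Hypothesis u_bd : {ae P, forall p : X * TR, QT T p -> `|u p| <= M}.
Hypothesis u_cont : C_L1_loc T u.
Hypothesis u_sol : distributional_solution mu phi T u0 u.

Local Notation S := (phisup phi M).
Local Notation ub := (ubar T M u).

Let mub := ubar_measurable M u_L1.

Let mphi : measurable_fun (setT : set R) phi.
Proof. exact: continuous_measurable_fun. Qed.

Let ell_measurable d y : measurable_fun setT (fun x : X => ell mu (kap d) (x - y)).
Proof. exact: integ_meas (integ_shift (- y) (ell_integ mu_mw d)). Qed.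

Let kap_measurable' d y : measurable_fun setT (fun x : X => kap d (x - y)).
Proof. exact: (measurableT_comp (@kap_measurable R N d) (measurable_addmx (- y))). Qed.

Let w (p : X * R) := phi (ub p).

Let mw_ : measurable_fun (setT : set (X * TR)) w.
Proof. exact: (measurableT_comp mphi mub). Qed.

Lemma phi_ubar_bound p : `|phi (ub p)| <= S * win 0 T p.2.
Proof.
have h := phi_bounded phi_nd (ubar_bound T u M0 p).
have S0 : 0 <= S := le_trans (normr_ge0 _) h.
case: p h => x t h /=; have [/andP[t0 tT]|tn] := boolP (0 < t < T).
  by rewrite win1 ?mulr1// ltW.
by rewrite ubar_out// phi0 normr0 mulr_ge0 ?win_ge0.
Qed.

Lemma weak_kap d y t e (th th' b : R -> R) : t + e < T -> smooth1 th ->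
  (forall s, is_derive s (1 : R) th (th' s)) -> (forall s, 0 <= s -> th' s = - b s) ->
  (forall s, s <= - 3 \/ t + e <= s -> th s = 0) -> th 0 = 1 ->
  measurable_fun (setT : set TR) b ->
  \int[P]_p (ub p * (kap d (p.1 - y) * - b p.2) + w p * (th p.2 * ell mu (kap d) (p.1 - y))) +
  conv d u0 y = 0.
Proof.
move=> teT sth Dth bth th0 th1 mb.
have [_ H] := u_sol.
have := H _ (kap_test_function d y sth teT th0).
have mth : measurable_fun (setT : set TR) th.
  exact: (continuous_measurable_fun (smooth1_continuous sth)).
have m1 : measurable_fun (setT : set (X * TR)) (fun p => kap d (p.1 - y) * - b p.2).
  apply: measurable_funM; first exact: (measurableT_comp (kap_measurable' d y) measurable_fst).
  by apply: measurable_funN; exact: (measurableT_comp mb measurable_snd).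
have m2 : measurable_fun (setT : set (X * TR)) (fun p => th p.2 * ell mu (kap d) (p.1 - y)).
  apply: measurable_funM; first exact: (measurableT_comp mth measurable_snd).
  exact: (measurableT_comp (ell_measurable d y) measurable_fst).
have mu_ : measurable_fun (QT T : set (X * TR)) u.
  have h := measurable_int _ u_L1; exact/measurable_EFinP.
have -> : \int[P]_(p in QT T) (u p * derive1 (fun s => kap d ((p.1, s).1 - y) * th (p.1, s).2) p.2 +
      phi (u p) * levy_op mu (fun x => kap d ((x, p.2).1 - y) * th (x, p.2).2) p.1) =
    \int[P]_(p in QT T) (u p * (kap d (p.1 - y) * - b p.2) +
      phi (u p) * (th p.2 * ell mu (kap d) (p.1 - y))).
  apply: eq_Rintegral => -[x s]; rewrite inE => -[_] /=; rewrite in_itv/= => /andP[s0 sT].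
  rewrite (levy_op_kap mu_even mu_mw); congr (_ * _ + _).
  rewrite -bth ?ltW// derive1E.
  by have D := is_deriveZ (kap d (x - y)) (Dth s); exact: derive_val.
rewrite (@Int_ae_dom _ _ R P _ _ (fun p =>
  ub p * (kap d (p.1 - y) * - b p.2) + w p * (th p.2 * ell mu (kap d) (p.1 - y)))).
- move=> <-; congr (_ + _); rewrite /conv; apply: eq_Int => x.
  by rewrite th1 mulr1.
- exact: QT_measurable.
- apply: measurable_funD; apply: measurable_funM => //; try exact: measurable_funTS.
  exact: (measurableT_comp mphi mu_).
- by apply: measurable_funD; apply: measurable_funM.
- move=> [x s] nQ; rewrite /w ubar_out ?phi0 ?mul0r ?addr0//.
  by apply/negP => h; apply: nQ; split => //=; rewrite in_itv.
- move: u_bd; apply: filterS => -[x s] h Q; have := h Q => us.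
  rewrite /w ubarE ?clip_id//.
  by move: Q => -[_] /=; rewrite in_itv.
Qed.

Lemma half_add_le (e a b c i m : R) : `|i - m| <= e / 2 -> `|b - c| <= e / 2 ->
  - i + b + a = 0 -> `|m - a - c| <= e.
Proof. by rewrite !ler_norml => /andP[? ?] /andP[? ?] ?; apply/andP; split; lra. Qed.

Lemma dist_natb_le1 (a : R) (b : bool) : 0 <= a <= 1 -> `|a - b%:R| <= 1.
Proof. by move=> /andP[? ?]; case: b; rewrite ler_norml /=; apply/andP; split; lra. Qed.

(** The test function is a translated kernel times a time cutoff. As the transition shrinks, [b]
    tends to a Dirac mass at [t], where the slices are continuous in L^1_loc, and [th] tends to the
    indicator of []0, t[], with an error controlled by the boundedness of [phi(ubar)]. *)
Lemma weak_equation t d y : 0 < t < T ->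
  conv d (fun x => ub (x, t)) y - conv d u0 y =
  \int[lam]_x (\int[leb]_r (w (x, r) * ((0 < r)%R && (r < t)%R)%:R) * ell mu (kap d) (x - y)).
Proof.
move=> /andP[t0 tT]; apply/eqP; rewrite -subr_eq0 -normr_le0.
apply/ler_addgt0Pr => e e0; rewrite add0r; have e20 : 0 < e / 2 by rewrite divr_gt0.
have S0 : 0 <= S := le_trans (normr_ge0 _) (phi_bounded phi_nd (ubar_bound T u M0 (0, 0))).
have iell := integ_norm (integ_shift (- y) (ell_integ mu_mw d)).
pose L := \int[lam]_x `|ell mu (kap d) (x - y)|.
have L0 : 0 <= L by exact: Int_ge0.
(* A cube large enough to contain the support of the translated kernel. *)
pose n := (Num.truncn (d + `|y|)).+1.
have kn x : kap d (x - y) <= \1_(cube n%:R) x.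
  have [kz|kz] := eqVneq (kap d (x - y)) 0; first by rewrite kz indicE.
  rewrite indicE mem_set ?kap_le1// => i.
  have := kap_support kz i; rewrite !mxE => h.
  apply: le_lt_trans (truncnS_gt (d + `|y|)).
  rewrite -[x 0 i](subrK (y 0 i)) (le_trans (ler_normD _ _))// lerD ?(ltW h)//.
  exact: coord_le_norm.
have tI : t \in `[0, T] by rewrite in_itv/= !ltW.
have [d1 d10 Hd1] := clip_cont M0 u_cont n tI e20.
(* The first bound keeps the transition inside []0, T[] and within the radius [d1] of continuity;
   the second makes the error of the cutoff, at most [S L] times its width [2 eta], smaller than
   [e / 2]. *)
pose eta := Num.min (Num.min d1 (Num.min t (T - t)) / 2) (e / 4 / (S * L + 1)).
have SL1 : 0 < S * L + 1 by rewrite ltr_wpDl// mulr_ge0.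
have m0 : 0 < Num.min d1 (Num.min t (T - t)) by rewrite !lt_min d10 t0 subr_gt0.
have eta0 : 0 < eta by rewrite lt_min !divr_gt0.
have eh : eta < Num.min d1 (Num.min t (T - t)).
  by rewrite /eta gt_min ltr_pdivrMr// ltr_pMr// ltr1n.
have [ed [et eT]] : eta < d1 /\ eta < t /\ eta < T - t.
  by move: eh; rewrite !lt_min => /and3P[].
have e2 : S * (L * (eta + eta)) <= e / 2.
  have eq : eta <= e / 4 / (S * L + 1) by rewrite /eta ge_min lexx orbT.
  rewrite mulrA; apply: le_trans (ler_wpM2l (mulr_ge0 S0 L0) (lerD eq eq)) _.
  apply: (@le_trans _ _ ((S * L + 1) * (e / 4 / (S * L + 1) + e / 4 / (S * L + 1)))).
    by rewrite ler_wpM2r ?lerDl// addr_ge0 ?divr_ge0 ?ltW// divr_gt0.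
  rewrite mulrDr mulrC divfK ?gt_eqF// le_eqVlt; apply/orP; left; apply/eqP.
  by field.
have [th [th' [b [sth Dth bth [th01 th1 th0] [ib Ib b0 bz]]]]] := cutoff eta0 et.
have teT : t + eta < T by rewrite -ltrBrDl.
have th_0 : th 0 = 1 by apply: th1; rewrite lexx subr_ge0 ltW.
have mb := integ_meas ib.
have W := weak_kap d y teT sth Dth bth th0 th_0 mb.
have mth : measurable_fun (setT : set TR) th.
  exact: (continuous_measurable_fun (smooth1_continuous sth)).
have ik := integ_shift (- y) (kap_integ N d).
have i1 : integ P (fun p => ub p * (kap d (p.1 - y) * - b p.2)).
  apply: (integMb mub (ubar_bound T u M0)).
  exact: (integ_tensor ik (integN ib)).
have iw (f : X * R -> R) : measurable_fun (setT : set (X * TR)) f ->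
    (forall p, 0 <= p.2 -> `|f p| <= 1) ->
    integ P (fun p => w p * (f p * ell mu (kap d) (p.1 - y))).
  move=> mf f1; apply: (integ_dom _ _ (integ_tensor iell (integZ S (integ_win 0 T)))).
    apply: measurable_funM => //; apply: measurable_funM => //.
    exact: (measurableT_comp (ell_measurable d y) measurable_fst).
  move=> p; rewrite 2!normrM mulrA [X in _ <= X]mulrC ler_wpM2r//.
  have [p0|p0] := leP 0 p.2.
    by rewrite -[leRHS]mulr1 ler_pM// ?f1//; exact: phi_ubar_bound.
  have := phi_ubar_bound p; rewrite win0 ?mulr0; last by left; exact: ltW.
  by rewrite normr_le0 /w => /eqP ->; rewrite normr0 mul0r.
have i2 : integ P (fun p => w p * (th p.2 * ell mu (kap d) (p.1 - y))).
  apply: (iw (fun p => th p.2)); first exact: (measurableT_comp mth measurable_snd).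
  by move=> p p0; have /andP[h1 h2] := th01 _ p0; rewrite ger0_norm.
pose ind (s : R) : R := ((0 < s) && (s < t))%:R.
have mind : measurable_fun (setT : set TR) ind.
  by apply: measurable_natb; apply: measurable_and; apply: measurable_fun_ltr => //; exact: measurable_TRid.
have i3 : integ P (fun p => w p * (ind p.2 * ell mu (kap d) (p.1 - y))).
  apply: (iw (fun p => ind p.2)); first exact: (measurableT_comp mind measurable_snd).
  by move=> p _; rewrite /ind; case: (_ && _); rewrite ?normr1 ?normr0.
have J : \int[lam]_x (\int[leb]_r (w (x, r) * ind r) * ell mu (kap d) (x - y)) =
    \int[P]_p (w p * (ind p.2 * ell mu (kap d) (p.1 - y))).
  rewrite -(Int_fubini1 i3); apply: eq_Int => x /=.
  rewrite mulrC -IntZ; first by apply: eq_Int => r; rewrite mulrC mulrA.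
  apply: (@integ_dom _ TR R leb _ (fun r => S * win 0 T r)); last exact/integZ/integ_win.
    apply: measurable_funM => //; exact: (measurable_slice1 x mw_).
  move=> r; rewrite normrM -[leRHS]mulr1 ler_pM ?(phi_ubar_bound (x, r))//.
  by rewrite /ind; case: (_ && _); rewrite ?normr1 ?normr0.
have I1 : \int[P]_p (ub p * (kap d (p.1 - y) * - b p.2)) =
    - \int[leb]_s (conv d (fun x => ub (x, s)) y * b s).
  rewrite -(Int_fubini2 i1) -IntN.
    apply: eq_Int => s /=; rewrite /conv mulrC -mulNr -IntZ; last first.
      exact: (bounded_kap_integ d y (measurable_slice2 (s : TR) mub)
        (fun x => ubar_bound T u M0 (x, s))).
    by apply: eq_Int => x; ring.
  have := integN (integ_fubini2 i1); congr integ; apply/funext => s /=.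
  rewrite /conv mulrC -IntZ; last first.
    exact: (bounded_kap_integ d y (measurable_slice2 (s : TR) mub)
      (fun x => ubar_bound T u M0 (x, s))).
  rewrite -IntN; last first.
    have h := bounded_kap_integ d y (measurable_slice2 (s : TR) mub)
      (fun x => ubar_bound T u M0 (x, s)).
    have := integZ (- b s) h; congr integ; apply/funext => x; ring.
  by apply: eq_Int => x; ring.
rewrite IntD// I1 in W.
rewrite J; apply: half_add_le W.
(* As [b] has mass 1, the difference is an average over [s] near [t] of differences of slices. *)
- have mt : \int[leb]_s (conv d (fun x => ub (x, t)) y * b s) = conv d (fun x => ub (x, t)) y.
    by rewrite IntZ// Ib mulr1.
  have ibm : integ leb (fun s => conv d (fun x => ub (x, s)) y * b s).
    have := integN (integ_fubini2 i1); congr integ; apply/funext => s /=.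
    rewrite /conv mulrC -IntZ; last first.
      exact: (bounded_kap_integ d y (measurable_slice2 (s : TR) mub)
        (fun x => ubar_bound T u M0 (x, s))).
    rewrite -IntN; last first.
      have h := bounded_kap_integ d y (measurable_slice2 (s : TR) mub)
        (fun x => ubar_bound T u M0 (x, s)).
      have := integZ (- b s) h; congr integ; apply/funext => x; ring.
    by apply: eq_Int => x; ring.
  rewrite -[X in _ - X]mt -IntB//; last exact: integZ.
  have -> : e / 2 = \int[leb]_s (e / 2 * b s) by rewrite IntZ// Ib mulr1.
  apply: Int_norm_le; [by apply: integB => //; exact: integZ|exact: integZ|move=> s].
  rewrite -mulrBl normrM [`|b s|]ger0_norm//.
  have [st|st] := boolP ((s <= t - eta) || (t + eta <= s)).
    by rewrite bz ?mulr0//; exact/orP.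
  move: st; rewrite negb_or -!ltNge => /andP[s1 s2].
  rewrite ler_wpM2r//.
  have s0T : 0 < s < T by rewrite (lt_trans _ teT)// andbT (le_lt_trans _ s1)// subr_ge0 ltW.
  have sI : s \in `[0, T] by case/andP: s0T => *; rewrite in_itv/= !ltW.
  have std : `|s - t| < d1.
    by rewrite (lt_trans _ ed)// ltr_distl s1 s2.
  have := Hd1 s sI std; apply: le_trans.
  have mus : measurable_fun setT (fun x => ub (x, s)) := measurable_slice2 (s : TR) mub.
  have mut : measurable_fun setT (fun x => ub (x, t)) := measurable_slice2 (t : TR) mub.
  have iV : integ lam (\1_(cube n%:R) : X -> R).
    by apply: integ_indic; [exact: cube_measurable|exact: cube_fin].
  rewrite /conv -IntB; [|exact: bounded_kap_integ (fun x => ubar_bound T u M0 (x, s))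
    |exact: bounded_kap_integ (fun x => ubar_bound T u M0 (x, t))].
  apply: Int_norm_le.
  + by apply: integB; [exact: bounded_kap_integ (fun x => ubar_bound T u M0 (x, s))
    |exact: bounded_kap_integ (fun x => ubar_bound T u M0 (x, t))].
  + apply: (integMb (C := M + M)) => //.
      apply: measurableT_comp => //; apply: measurable_funB.
        by apply: clip_measurable; exact: (u_slice_measurable u_cont sI).
      by apply: clip_measurable; exact: (u_slice_measurable u_cont tI).
    by move=> x; rewrite normr_id (le_trans (ler_normB _ _))// lerD// clip_bound.
  + move=> x; rewrite -mulrBl normrM [`|kap _ _|]ger0_norm ?kap_ge0//.
    by rewrite !ubarE ?t0// ler_pM ?kap_ge0.
(* The cutoff and the indicator differ by at most 1, and only inside the transition window. *)
- rewrite -IntB//; apply: le_trans e2.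
  have tt : t - eta <= t + eta by rewrite lerD2l ge0_cp// ltW.
  have it := integ_tensor iell (integZ S (integ_win (t - eta) (t + eta))).
  apply: (@le_trans _ _ (\int[P]_p (`|ell mu (kap d) (p.1 - y)| *
      (S * win (t - eta) (t + eta) p.2)))).
    apply: Int_norm_le => //; first exact: integB.
    move=> [x s] /=; rewrite -mulrBr -mulrBl normrM normrM mulrA [X in _ <= X]mulrC.
    rewrite ler_wpM2r//.
    have [s0|s0] := leP s 0.
      have := phi_ubar_bound (x, s); rewrite win0 ?mulr0; last by left.
      by rewrite normr_le0 /w => /eqP ->; rewrite normr0 mul0r mulr_ge0 ?win_ge0.
    apply: ler_pM => //; first exact: phi_bounded (ubar_bound T u M0 (x, s)).
    rewrite /ind s0 /=; have [st|st] := leP s (t - eta).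
      have -> : th s = 1 by apply: th1; rewrite (ltW s0) st.
      by rewrite (le_lt_trans st) ?gtrBl// subrr normr0 win_ge0.
    have [st'|st'] := leP (t + eta) s.
      rewrite th0; last by right.
      have -> : (s < t) = false by apply/negbTE; rewrite -leNgt (le_trans _ st')// lerDl ltW.
      by rewrite subrr normr0 win_ge0.
    rewrite win1//; last exact: ltW.
    exact: dist_natb_le1 (th01 _ (ltW s0)).
  rewrite -(Int_fubini1 it) /=.
  under eq_Int => x.
    rewrite (IntZ `|ell mu (kap d) (x - y)| (integZ S (integ_win (t - eta) (t + eta)))).
    rewrite (IntZ S (integ_win _ _)) Int_win//.
    over.
  rewrite (_ : t + eta - (t - eta) = eta + eta); last by ring.
  under eq_Int do rewrite mulrC.
  by rewrite (IntZ _ iell) -/L -mulrA [X in S * X]mulrC.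
Qed.

End weak_equation.

Lemma limn_einf_lt (R : realType) (v : nat -> \bar R) (r : \bar R) (n : nat) :
  (limn_einf v < r)%E -> exists2 m : nat, (n <= m)%N & (v m < r)%E.
Proof.
move=> vr; apply: contrapT => H.
have : (r <= limn_einf v)%E.
  rewrite limn_einf_lim; apply: lime_ge; first exact: is_cvg_einfs.
  exists n => // k /= nk; apply: le_ereal_inf_tmp => _ [j /= kj <-].
  by rewrite leNgt; apply/negP => vj; apply: H; exists j => //; exact: leq_trans kj.
by rewrite leNgt vr.
Qed.

(** * Passage to the limit in the time step *)

Section assembly.
Context {R : realType} (N : nat).
Local Notation X := 'rV[R]_N.
Local Notation TR := (measurableTypeR R).
Local Notation leb := (@lebesgue_measure R).
Local Notation lam := (@lebesgue_rV R N).
Local Notation P := (lam \x leb)%E.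
Implicit Types (t s r e sigma tau c : R).
Variables (phi Phi : R -> R) (T M : R) (u : X * R -> R) (u0 : X -> R).
Variable mu : {sigma_finite_measure set X -> \bar R}.
Hypothesis mu_mw : integ mu (@mw R N).
Hypothesis phi_cont : continuous phi.
Hypothesis phi_nd : {homo phi : a b / a <= b}.
Hypothesis phi0 : phi 0 = 0.
Hypothesis M0 : 0 <= M.
Hypothesis u_L1 : in_L1 P (QT T) u.
Hypothesis u_bd : {ae P, forall p : X * TR, QT T p -> `|u p| <= M}.
Hypothesis u_cont : C_L1_loc T u.
Hypothesis iu0 : integ lam u0.
Hypothesis u0M : forall x, `|u0 x| <= M.
Local Notation S := (phisup phi M).
Local Notation ub := (ubar T M u).
Hypothesis weq : forall t d y, 0 < t < T ->
  conv d (fun x => ub (x, t)) y - conv d u0 y =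
  \int[lam]_x (\int[leb]_r (phi (ub (x, r)) * ((0 < r)%R && (r < t)%R)%:R) *
    ell mu (kap d) (x - y)).
Hypothesis mPhi : measurable_fun (setT : set R) Phi.
Hypothesis Phi_convex : forall a b, phi a * (b - a) <= Phi b - Phi a.
Hypothesis Phi_bound : forall a, `|a| <= M -> `|Phi a| <= S * `|a|.

Let mub := ubar_measurable M u_L1.

(* [ubar] frozen at [tau]; on [t <= tau] the pair [(fU, fW)] of [fal tau] is
   [(Ui, Wi)], which no longer depends on [tau]. *)
Definition fal tau (p : X * R) : R :=
  u0 p.1 * (p.2 <= 0)%R%:R + ub (p.1, Num.min p.2 tau) * (0 < p.2)%R%:R.

Definition Ui (p : X * R) : R :=
  u0 p.1 * (p.2 <= 0)%R%:R + ub p * (0 < p.2)%R%:R - u0 p.1.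
Definition Wi (p : X * R) : R :=
  \int[leb]_r (phi (ub (p.1, r)) * ((0 < r)%R && (r < p.2)%R)%:R).
Definition Gi sigma t := - \int[lam]_x
  ((Ui (x, t) - Ui (x, t - sigma)) * (Wi (x, t) - Wi (x, t - sigma))).

Lemma fal_measurable tau : measurable_fun (setT : set (X * TR)) (fal tau).
Proof.
apply: measurable_funD; apply: measurable_funM.
- exact: (measurableT_comp (integ_meas iu0) measurable_fst).
- by apply: measurable_natb; apply: measurable_fun_ler => //; exact: measurable_cst.
- apply: (measurableT_comp mub (g := fun p : X * TR => (p.1, Num.min p.2 tau) : X * TR)).
  apply: measurable_fun_pair; first exact: measurable_fst.
  by apply: measurable_minr => //; exact: measurable_cst.
- by apply: measurable_natb; apply: measurable_fun_ltr => //; exact: measurable_cst.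
Qed.

Lemma fal_le0 tau x t : t <= 0 -> fal tau (x, t) = u0 x.
Proof. by move=> t0; rewrite /fal /= t0 ltNge t0 mulr0 addr0 mulr1. Qed.

Lemma fal_gt0 tau x t : 0 < t -> fal tau (x, t) = ub (x, Num.min t tau).
Proof. by move=> t0; rewrite /fal /= t0 leNgt t0 mulr0 add0r mulr1. Qed.

Lemma fal_in tau x t : 0 < t <= tau -> fal tau (x, t) = ub (x, t).
Proof. by move=> /andP[t0 tt]; rewrite fal_gt0// (min_idPl tt). Qed.

Lemma fal_bound tau p : `|fal tau p| <= M.
Proof.
case: p => x t; have [t0|t0] := leP t 0; first by rewrite fal_le0.
by rewrite fal_gt0// ubar_bound.
Qed.

Lemma fal_ge tau x t : 0 < tau -> tau <= t -> fal tau (x, t) = fal tau (x, tau).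
Proof.
move=> tau0 tt; rewrite !fal_gt0//; last exact: lt_le_trans tt.
by rewrite minxx (min_idPr tt).
Qed.

Lemma fal_cvg tau t (n : nat) e : tau < T -> 0 < t <= tau -> 0 < e -> exists2 d : R, 0 < d &
  forall h, 0 < h < d ->
    \int[lam]_x (`|fal tau (x, t - h) - fal tau (x, t)| * \1_(cube n%:R) x) <= e.
Proof.
move=> tT /andP[t0 tt] e0; have tI : t \in `[0, T] by rewrite in_itv/= !ltW// (le_lt_trans tt).
have [d d0 Hd] := clip_cont M0 u_cont n tI e0.
exists (Num.min d t) => [|h]; first by rewrite lt_min d0.
rewrite lt_min => /andP[h0 /andP[hd ht]].
have th : 0 < t - h < T by rewrite subr_gt0 ht/= (lt_le_trans _ (ltW (le_lt_trans tt tT)))// gtrBl.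
have thI : t - h \in `[0, T] by case/andP: th => *; rewrite in_itv/= !ltW.
have := Hd _ thI; rewrite addrC addKr normrN gtr0_norm// => /(_ hd); apply: le_trans.
rewrite le_eqVlt; apply/orP; left; apply/eqP; apply: eq_Int => x.
rewrite !fal_in ?t0//; last first.
  by case/andP: th => -> _ /=; rewrite (le_trans _ tt)// gerBl ltW.
by rewrite !ubarE// t0 (le_lt_trans tt).
Qed.

Lemma fU_Ui tau x s : s <= tau -> fU (fal tau) u0 (x, s) = Ui (x, s).
Proof.
move=> st; rewrite /fU /Ui /=; have [s0|s0] := leP s 0.
  by rewrite fal_le0// mulr1 mulr0 addr0.
by rewrite fal_in ?s0// mulr0 add0r mulr1.
Qed.

Lemma fW_Wi tau x s : s <= tau -> fW phi tau (fal tau) (x, s) = Wi (x, s).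
Proof.
move=> st; apply: eq_Int => r; rewrite /fw /=.
have [r0|r0] := leP r 0; first by rewrite win0 ?mulr0 ?mul0r//; left.
have [rs|rs] := ltP r s; last by rewrite !mulr0.
have rt := le_trans (ltW rs) st.
have h : 0 < r <= tau by rewrite r0.
by rewrite win1// (fal_in _ h) !mulr1.
Qed.

(** Freezing at [t] itself identifies [Wi] with [fW] at all times up to [t], and only the left limit
    matters. *)
Lemma Wi_quotient_cvg t (n : nat) e : 0 < t < T -> 0 < e -> exists2 d : R, 0 < d &
  forall sigma, 0 < sigma < d ->
    let q x := `|sigma^-1 * (Wi (x, t) - Wi (x, t - sigma)) - phi (ub (x, t))| *
      \1_(cube n%:R) x in
    integ lam q /\ \int[lam]_x q x <= e.
Proof.
move=> /andP[t0 tT] e0; have tt : 0 < t <= t by rewrite t0 lexx.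
have ac s m r : 0 < s <= t -> 0 < r -> exists2 d : R, 0 < d & forall h, 0 < h < d ->
    \int[lam]_x (`|fal t (x, s - h) - fal t (x, s)| * \1_(cube m%:R) x) <= r.
  by move=> *; exact: fal_cvg.
have [d d0 Hd] := @fW_quotient_cvg _ _ phi M t (fal t) phi_cont phi_nd phi0 M0
  (fal_measurable t) (fal_bound t) ac t n e tt e0.
exists d => // sigma sd; have /= := Hd sigma sd.
have E x : fw phi t (fal t) (x, t) = phi (ub (x, t)).
  by rewrite /fw /= win1// mulr1 fal_in.
have s0 : 0 < sigma by case/andP: sd.
rewrite (_ : (fun x => `|_ * (fW phi t (fal t) (x, t) - _) - _| * _) =
  (fun x => `|sigma^-1 * (Wi (x, t) - Wi (x, t - sigma)) - phi (ub (x, t))| *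
      \1_(cube n%:R) x))//.
by apply/funext => x; rewrite E !fW_Wi// gerBl ltW.
Qed.

Lemma levy_pair0 : levy_pair mu (fun=> 0) (fun=> 0).
Proof.
split.
- exact: integ0.
- exact: measurable_cst.
- by exists 0 => x; rewrite normr0.
- by move=> e e0; exists (fun=> 0) => [|x]; [exact: integ0|by rewrite lexx normr0 addr0 ltW].
- by move=> d y d0; rewrite /conv !Int0// => x; rewrite mul0r.
Qed.

(** The relation between the two members is the integrated weak equation; the point to prove is that
    [Wi] vanishes at infinity. *)
Lemma Wi_pair s : 0 < s < T -> integ lam (fun x => ub (x, s)) ->
  levy_pair mu (fun x => ub (x, s) - u0 x) (fun x => Wi (x, s)).
Proof.
move=> sT is_; have s0 : 0 < s by case/andP: sT.
have ms : measurable_fun setT (fun x => Wi (x, s)).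
  have := measurable_slice2 (s : TR) (fW_measurable s phi_cont (fal_measurable s)).
  by congr measurable_fun; apply/funext => x; rewrite fW_Wi.
split.
- exact: integB.
- exact: ms.
- exists (S * s) => x; rewrite -(fW_Wi x (lexx s)).
  exact: (fW_bound phi_cont phi_nd s0 (fal_measurable s) (fal_bound s)).
(* The modulus at 0 bounds [|phi(ubar)|] by [e / s + C |ubar|]. Over []0, s[] the first term
   contributes at most [e], the second a function integrable in [x]. *)
- move=> e e0; have e1 : 0 < e / s by rewrite divr_gt0.
  have [C C0 HC] := phi_modulus phi_cont phi_nd phi0 M0 e1.
  have iub := ubar_integ M0 u_L1.
  have mw : measurable_fun (setT : set (X * TR)) (fun p => win 0 s p.2).
    by apply: measurable_win => //; exact: measurable_cst.
  have iw : integ P (fun p => win 0 s p.2 * `|ub p|).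
    apply: (integMb (C := 1) mw); last exact: integ_norm.
    by move=> p; rewrite ger0_norm ?win_ge0 ?win_le1.
  exists (fun x => C * \int[leb]_r (win 0 s r * `|ub (x, r)|)).
    exact/integZ/(integ_fubini1 iw).
  move=> x; split.
    by apply: mulr_ge0 => //; apply: Int_ge0 => r; rewrite mulr_ge0 ?win_ge0.
  have mx : measurable_fun (setT : set TR) (fun r => ub (x, r)).
    exact: (measurable_slice1 x mub).
  have mphi : measurable_fun (setT : set R) phi by exact: continuous_measurable_fun.
  have iux : integ leb (fun r => win 0 s r * `|ub (x, r)|).
    apply: (@integ_dom _ TR R leb _ (fun r => M * win 0 s r)); last exact/integZ/integ_win.
      apply: measurable_funM; first exact: integ_meas (integ_win 0 s).
      exact: measurableT_comp.
    move=> r; rewrite normrM normr_id mulrC ger0_norm ?win_ge0//.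
    by rewrite ler_wpM2r ?win_ge0// ubar_bound.
  apply: (@le_trans _ _ (\int[leb]_r (e / s * win 0 s r + C * (win 0 s r * `|ub (x, r)|)))).
    apply: Int_norm_le.
    + apply: (@integ_dom _ TR R leb _ (fun r => S * win 0 s r)); last exact/integZ/integ_win.
        apply: measurable_funM; first exact: (measurableT_comp mphi mx).
        by apply: measurable_natb; apply: measurable_and; apply: measurable_fun_ltr => //; exact: measurable_TRid.
      move=> r /=; rewrite normrM ler_pM//; first exact: phi_bounded (ubar_bound T u M0 _).
      rewrite /win ger0_norm// ler_nat; case: (ltP 0 r) => //= _.
      by case: (ltP r s) => //= /ltW ->.
    + apply: integD; first exact/integZ/integ_win.
      exact: integZ.
    + move=> r /=; have [r0|r0] := leP r 0.
        by rewrite mulr0 normr0 win0 ?mul0r ?mulr0 ?addr0//; left.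
      have [rs|rs] := ltP r s; last first.
        rewrite /= mulr0 normr0; apply: addr_ge0; apply: mulr_ge0 => //.
        - exact: ltW.
        - by apply: mulr_ge0; first exact: win_ge0.
      rewrite (win1 r0 (ltW rs)) !mulr1 mul1r.
      have := HC (ub (x, r)) 0; rewrite phi0 !subr0; apply; last by rewrite normr0.
      exact: ubar_bound.
  rewrite IntD; [|exact/integZ/integ_win|exact: integZ].
  rewrite IntZ; last exact: integ_win.
  by rewrite (Int_win (ltW s0)) subr0 divfK ?gt_eqF// (IntZ C iux).
- move=> d y d0; rewrite convB ?integ_kap//; exact: weq.
Qed.

Lemma ub_good : {ae leb, forall t : TR, integ lam (fun x => ub (x, t))}.
Proof. exact: (integ_ae2 (ubar_integ M0 u_L1)). Qed.

(** After [tau] the pair is constantly the one at [tau], hence the requirement that this slice be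
    integrable. Before 0 both members are 0. *)
Lemma frozen_pairs tau : 0 < tau < T -> integ lam (fun x => ub (x, tau)) ->
  {ae leb, forall t : TR,
    levy_pair mu (fun x => fU (fal tau) u0 (x, t)) (fun x => fW phi tau (fal tau) (x, t))}.
Proof.
move=> tT it; have t0 : 0 < tau by case/andP: tT.
apply: filterS ub_good => t gt_.
have [tn|tp] := leP t 0.
  rewrite (_ : (fun x => fU _ _ _) = fun=> 0); last first.
    by apply/funext => x; rewrite /fU /= fal_le0// subrr.
  rewrite (_ : (fun x => fW _ _ _ _) = fun=> 0); first exact: levy_pair0.
  apply/funext => x; apply: Int0 => r; rewrite /fw /=.
  have [r0|r0] := leP r 0; first by rewrite win0 ?mulr0 ?mul0r//; left.
  by rewrite ltNge (le_trans tn (ltW r0)) mulr0.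
have [tt|tt] := ltP t tau.
  have tT' : 0 < t < T by case/andP: tT => _ ?; rewrite tp (lt_trans tt).
  have := Wi_pair tT' gt_; congr levy_pair; apply/funext => x.
    by rewrite /fU /= fal_in// tp ltW.
  by rewrite fW_Wi// ltW.
have := Wi_pair tT it; congr levy_pair; apply/funext => x.
  by rewrite /fU /= fal_ge// fal_in// t0 lexx.
by rewrite (fW_tau phi_cont (fal_measurable tau) x tt) fW_Wi.
Qed.

Lemma frozen_ialpha tau : 0 < tau -> integ P (fun p => fal tau p * win 0 tau p.2).
Proof.
move=> t0; have mw : measurable_fun (setT : set (X * TR)) (fun p => win 0 tau p.2).
  by apply: measurable_win => //; exact: measurable_cst.
have := integMb (C := 1) mw _ (ubar_integ M0 u_L1).
rewrite (_ : (fun p => win 0 tau p.2 * ub p) = (fun p => fal tau p * win 0 tau p.2)).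
  by apply => p; rewrite ger0_norm ?win_ge0 ?win_le1.
apply/funext => -[x t] /=; have [wz|wz] := eqVneq (win 0 tau t) 0; first by rewrite wz mulr0 mul0r.
by have [h1 h2] := win_neq0 wz; rewrite fal_in ?h1// mulrC.
Qed.

Lemma Gi_energy tau sigma : 0 < tau < T -> integ lam (fun x => ub (x, tau)) -> 0 < sigma ->
  {ae leb, forall t : TR, 0 < t < tau ->
    (EE mu (fun x => (Wi (x, t) - Wi (x, t - sigma))%R) <= (2 * Gi sigma t)%:E)%E}.
Proof.
move=> tT it s0; have t0 : 0 < tau by case/andP: tT.
have := fG_fD phi_cont phi_nd t0 (fal_measurable tau) (fal_bound tau) mu_mw
  (frozen_pairs tT it) sigma.
apply: filterS => t [_ _ h] /andP[tp tt].
have tts : t - sigma <= tau by rewrite (le_trans _ (ltW tt))// gerBl ltW.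
move: h; rewrite (_ : (fun x => (fW _ _ _ _ - _)%R) = (fun x => (Wi (x, t) - Wi (x, t - sigma))%R)).
  congr (_ <= (2 * - _)%:E)%E; apply: eq_Int => x.
  by rewrite !fU_Ui ?fW_Wi ?(ltW tt).
by apply/funext => x; rewrite !fW_Wi ?(ltW tt).
Qed.

Lemma Gi_measurable sigma : measurable_fun (setT : set TR) (Gi sigma).
Proof.
have mU : measurable_fun (setT : set (X * TR)) Ui.
  apply: measurable_funB; last exact: (measurableT_comp (integ_meas iu0) measurable_fst).
  apply: measurable_funD; apply: measurable_funM => //.
  - exact: (measurableT_comp (integ_meas iu0) measurable_fst).
  - by apply: measurable_natb; apply: measurable_fun_ler => //; exact: measurable_cst.
  - by apply: measurable_natb; apply: measurable_fun_ltr => //; exact: measurable_cst.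
have mphi : measurable_fun (setT : set R) phi by exact: continuous_measurable_fun.
have mW : measurable_fun (setT : set (X * TR)) Wi.
  apply: (measurable_Int leb (F := fun q : (X * TR) * TR =>
    phi (ub (q.1.1, q.2)) * ((0 < q.2)%R && (q.2 < q.1.2)%R)%:R)).
  apply: measurable_funM.
    apply: (measurableT_comp mphi).
    apply: (measurableT_comp mub (g := fun q : (X * TR) * TR => (q.1.1, q.2) : X * TR)).
    apply: measurable_fun_pair; last exact: measurable_snd.
    exact: (measurableT_comp measurable_fst measurable_fst).
  apply: measurable_natb; apply: measurable_and; apply: measurable_fun_ltr.
  - exact: measurable_cst.
  - exact: measurable_snd.
  - exact: measurable_snd.
  - exact: (measurableT_comp measurable_snd measurable_fst).
apply: measurable_funN; apply: (measurable_Int2 lam (F := fun p =>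
  (Ui p - Ui (p.1, p.2 - sigma)) * (Wi p - Wi (p.1, p.2 - sigma)))).
apply: measurable_funM; apply: measurable_funB => //.
- exact: (measurable_shiftP (- sigma) mU).
- exact: (measurable_shiftP (- sigma) mW).
Qed.

Lemma Gi_Int_le tau sigma c d0 : 0 < tau < T -> integ lam (fun x => ub (x, tau)) ->
  0 < sigma <= d0 -> d0 < tau ->
  {ae leb, forall t : TR, tau - d0 <= t <= tau -> c <= \int[lam]_x Phi (ub (x, t))} ->
  (\int[leb]_(t in `]0%R, tau[) (Num.max 0 (Gi sigma t))%:E <=
    (sigma ^+ 2 * (\int[lam]_x Phi (u0 x) - c))%:E)%E.
Proof.
move=> tT it sd dt Fc; have t0 : 0 < tau by case/andP: tT.
have s0 : 0 < sigma by case/andP: sd.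
have prs := frozen_pairs tT it.
have itau : integ lam (fun x => fal tau (x, tau)).
  by under eq_fun do rewrite fal_in ?t0 ?lexx//.
have age x s : tau <= s -> fal tau (x, s) = fal tau (x, tau) by exact: fal_ge.
have [iG _] := fG_integ phi_cont phi_nd t0 (fal_measurable tau) (fal_bound tau) u0M iu0
  (fal_le0 tau) age itau (frozen_ialpha t0) mu_mw prs s0.
have G0 := fG_ge0 phi_cont phi_nd t0 (fal_measurable tau) (fal_bound tau) mu_mw prs sigma.
have ac s m r : 0 < s <= tau -> 0 < r -> exists2 d : R, 0 < d & forall h, 0 < h < d ->
    \int[lam]_x (`|fal tau (x, s - h) - fal tau (x, s)| * \1_(cube m%:R) x) <= r.
  by move=> *; apply: fal_cvg => //; case/andP: tT.
have Fc' : {ae leb, forall t : TR, tau - d0 <= t <= tau -> c <= fF (fal tau) Phi t}.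
  move: Fc; apply: filterS => t h th; have := h th; rewrite /fF.
  congr (_ <= _); apply: eq_Int => x; rewrite fal_in//.
  by case/andP: th => h1 ->; rewrite andbT (lt_le_trans _ h1)// subr_gt0.
have GI := fG_Int_le phi_cont phi_nd phi0 M0 t0 (fal_measurable tau) (fal_bound tau) u0M iu0
  (fal_le0 tau) age itau (frozen_ialpha t0) ac mu_mw prs mPhi Phi_convex Phi_bound dt Fc' sd.
rewrite -lee_fin in GI; apply: le_trans GI.
have im : integ leb (fun t => Num.max 0 (fG phi tau (fal tau) u0 sigma t)).
  apply: (integ_dom _ _ (integ_norm iG)).
    by apply: measurable_maxr; [exact: measurable_cst|exact: integ_meas iG].
  by move=> t; rewrite ger0_norm ?le_max ?lexx// ge_max normr_ge0 ler_norm.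
rewrite (_ : \int[leb]_t fG _ _ _ _ _ t =
    \int[leb]_t Num.max 0 (fG phi tau (fal tau) u0 sigma t)); last first.
  apply: Int_ae; [exact: integ_meas iG|exact: integ_meas im|].
  by move: G0; apply: filterS => t /max_idPr ->.
rewrite (Int_EFin im) [leLHS]integral_mkcond; apply: ge0_le_int => t _.
  by rewrite patchE; case: ifP => // _; rewrite lee_fin le_max lexx.
rewrite patchE; case: ifPn => [|_]; last by rewrite lee_fin le_max lexx.
rewrite inE /= in_itv/= => /andP[tp tt].
have tts : t - sigma <= tau by rewrite (le_trans _ (ltW tt))// gerBl ltW.
rewrite lee_fin le_eqVlt; apply/orP; left; apply/eqP; congr (Num.max _ (- _)).
by apply: eq_Int => x; rewrite !fU_Ui ?fW_Wi ?(ltW tt).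
Qed.

Lemma phi_u_clip t : 0 < t < T ->
  {ae lam, forall x : X, phi (ub (x, t)) = phi (u (x, t))}.
Proof.
move=> /andP[t0 tT]; have t1 : 0 < t <= T by rewrite t0 ltW.
have := u_clip M0 u_bd u_cont t1; apply: filterS => x ->.
by rewrite ubarE ?t0// clip_id// clip_bound.
Qed.

(** The bound is asked for arbitrarily large [m] only, because it will come from a lower limit. The
    rescaled increments along these [m] converge locally to [phi(u(t))], and [EE_lsc] concludes. *)
Lemma EE_phi_le t r : 0 < t < T ->
  (forall n : nat, exists2 m : nat, (n <= m)%N &
    (EE mu (fun x => (Wi (x, t) - Wi (x, t - m.+1%:R^-1))%R) <=
      (m.+1%:R^-1 ^+ 2 * r)%:E)%E) ->
  (EE mu (fun x => phi (u (x, t))) <= r%:E)%E.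
Proof.
move=> tT H; have [t0 tT'] := andP tT.
have tI : t \in `[0, T] by rewrite in_itv/= !ltW.
have mphi : measurable_fun (setT : set R) phi by exact: continuous_measurable_fun.
have mf : measurable_fun setT (fun x => phi (u (x, t))).
  exact: (measurableT_comp mphi (u_slice_measurable u_cont tI)).
apply: EE_lsc => // n e e0.
have [d d0 Hd] := Wi_quotient_cvg n tT e0.
have [m1 _ Hm1] : \forall m \near \oo, m.+1%:R^-1 < d.
  have /cvgr0Pnorm_lt/(_ _ d0) := @inv_succ_cvg0 R.
  by apply: filterS => m; rewrite ger0_norm.
have [m m1m Hm] := H m1; set s := m.+1%:R^-1 in Hm.
have s0 : 0 < s by rewrite invr_gt0.
have sd : 0 < s < d by rewrite s0; exact: Hm1.
have [iq Iq] := Hd s sd.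
(* Any freezing time not before [t - s'] identifies [Wi] with [fW] there. *)
have mW s' : measurable_fun setT (fun x => Wi (x, t - s')).
  have := measurable_slice2 ((t - s') : TR)
    (fW_measurable (Num.max (t - s') T) phi_cont (fal_measurable (Num.max (t - s') T))).
  by congr measurable_fun; apply/funext => x; rewrite fW_Wi// le_max lexx.
have mWt : measurable_fun setT (fun x => Wi (x, t)) by have := mW 0; rewrite subr0.
have mD : measurable_fun setT (fun x => Wi (x, t) - Wi (x, t - s)) by exact: measurable_funB.
exists (fun x => s^-1 * (Wi (x, t) - Wi (x, t - s))); split.
- exact: measurable_funM.
- have aeq : {ae lam, forall x : X,
      `|s^-1 * (Wi (x, t) - Wi (x, t - s)) - phi (ub (x, t))| * \1_(cube n%:R) x =
      `|s^-1 * (Wi (x, t) - Wi (x, t - s)) - phi (u (x, t))| * \1_(cube n%:R) x}.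
    by move: (phi_u_clip tT); apply: filterS => x ->.
  apply: (integ_ae (integ_meas iq) _ aeq iq).
  apply: measurable_funM; last exact: measurable_cube_indic.
  by apply: measurableT_comp => //; apply: measurable_funB => //; exact: measurable_funM.
- apply: le_trans Iq; rewrite le_eqVlt; apply/orP; left; apply/eqP; apply: Int_ae.
  + apply: measurable_funM; last exact: measurable_cube_indic.
    by apply: measurableT_comp => //; apply: measurable_funB => //; exact: measurable_funM.
  + exact: integ_meas iq.
  + by move: (phi_u_clip tT); apply: filterS => x ->.
- apply: (@le_trans _ _ ((s^-1 ^+ 2)%:E * EE mu (fun x => (Wi (x, t) - Wi (x, t - s))%R))%E).
    have c0 : (0 <= (s^-1 ^+ 2)%:E)%E by rewrite lee_fin sqr_ge0.
    rewrite /EE -ge0_integralZl//; last 2 first.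
    + exact: (EE_slice_measurable mD).
    + by move=> z _; apply: integral_ge0 => x _; rewrite lee_fin sqr_ge0.
    apply: ge0_le_int => z _; first by apply: integral_ge0 => x _; rewrite lee_fin sqr_ge0.
    rewrite -ge0_integralZl//; last 2 first.
    + exact: (measurable_slice2 z (measurable_diff2 mD)).
    + by move=> x _; rewrite lee_fin sqr_ge0.
    apply: ge0_le_int => x _; first by rewrite lee_fin sqr_ge0.
    by rewrite -EFinM lee_fin -exprMn -mulrBr.
  apply: le_trans (lee_wpmul2l _ Hm) _; first by rewrite lee_fin sqr_ge0.
  by rewrite -EFinM lee_fin mulrA -exprMn mulVf ?gt_eqF// expr1n mul1r.
Qed.

(** Fatou's lemma in time for the rescaled forms [h n]: their integrals are bounded by the drop of
    [int Phi], and twice their lower limit bounds [EE] of [phi(u(t))] for almost every [t]. *)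
Lemma truncated_energy tau c d : 0 < tau <= T -> 0 < d < tau ->
  {ae leb, forall t : TR, tau - d <= t < tau -> c <= \int[lam]_x Phi (ub (x, t))} ->
  (\int[leb]_(t in `]0%R, tau[) ((2^-1)%:E * EE mu (fun x => phi (u (x, t)))) <=
    (\int[lam]_x Phi (u0 x) - c)%:E)%E.
Proof.
move=> /andP[tau0 tauT] /andP[d0 dtau] Fc.
pose s (n : nat) : R := n.+1%:R^-1.
have s0 n : 0 < s n by rewrite invr_gt0.
(* Only almost every time slice is integrable, so [tau] is approached along good
   freezing times [tk n]. *)
have /choice[tk tkP] : forall n, exists q : R, [/\ tau - s n < q, tau - d / 2 < q, q < tau, 0 < q &
    integ lam (fun x => ub (x, q))].
  move=> n; have [|q /andP[q1 q2] iq] := ae_witness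
      (a := Num.max (tau - s n) (tau - d / 2)) (b := tau) ub_good.
    by rewrite gt_max !gtrBl s0 divr_gt0.
  move: q1; rewrite gt_max => /andP[q0 q1]; exists q; split => //.
  by apply: lt_trans q1; lra.
pose ind n (t : R) : R := ((0 < t) && (t < tk n))%:R.
pose h n (t : R) : R := Num.max 0 (Gi (s n) t) / s n ^+ 2 * ind n t.
have h0 n t : 0 <= h n t.
  by apply: mulr_ge0 => //; apply: divr_ge0; [rewrite le_max lexx|exact: sqr_ge0].
have mh n : measurable_fun (setT : set TR) (fun t => (h n t)%:E).
  apply/measurable_EFinP; apply: measurable_funM.
    apply: measurable_funM => //; apply: measurable_maxr; first exact: measurable_cst.
    exact: Gi_measurable.
  by apply: measurable_natb; apply: measurable_and; apply: measurable_fun_ltr => //; exact: measurable_TRid.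
pose L (t : TR) : \bar R := limn_einf (fun n => (h n t)%:E).
have L0 t : (0 <= L t)%E.
  rewrite /L limn_einf_lim; apply: lime_ge; first exact: is_cvg_einfs.
  by apply: nearW => k; apply: le_ereal_inf_tmp => _ [j _ <-]; rewrite lee_fin.
have mL : measurable_fun (setT : set TR) L.
  apply: (measurableT_comp (@oppe_measurable R setT)).
  apply: (@measurable_fun_limn_esup _ TR R setT (fun n t => (- (h n t)%:E)%E)) => n.
  exact: (measurableT_comp (@oppe_measurable R setT) (mh n)).
pose L0F := \int[lam]_x Phi (u0 x) - c.
have IL : (\int[leb]_t L t <= L0F%:E)%E.
  have h0' n t : (setT : set TR) t -> (0 <= (h n t)%:E)%E by rewrite lee_fin.
  apply: le_trans (fatou leb measurableT mh h0') _.
  rewrite limn_einf_lim; apply: lime_le; first exact: is_cvg_einfs.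
  apply: nearW => k.
  (* Since [tau - d / 2 < tk m < tau], the interval [[tk m - d / 4, tk m]] stays inside [[tau - d,
     tau[], where [c] is a lower bound; [Gi_Int_le] is used with this margin, which must exceed the
     step. *)
  have [m1 _ Hm1] : \forall m \near \oo, s m < d / 4.
    have d40 : 0 < d / 4 by rewrite divr_gt0.
    have /cvgr0Pnorm_lt/(_ _ d40) := @inv_succ_cvg0 R.
    by apply: filterS => m; rewrite ger0_norm.
  pose m := maxn k m1; apply: (@le_trans _ _ (\int[leb]_t (h m t)%:E)%E).
    by apply: ereal_inf_lbound; exists m => //=; exact: leq_maxl.
  have sm : s m < d / 4 by apply: Hm1; exact: leq_maxr.
  have [q1 q2 q3 q4 q5] := tkP m.
  have qT : 0 < tk m < T by rewrite q4 (lt_le_trans q3).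
  have sd : 0 < s m <= d / 4 by rewrite s0 ltW.
  have dq : d / 4 < tk m by apply: lt_trans q2; lra.
  have Fc' : {ae leb, forall t : TR, tk m - d / 4 <= t <= tk m -> c <= \int[lam]_x Phi (ub (x, t))}.
    move: Fc; apply: filterS => t H /andP[h1 h2]; apply: H.
    rewrite (le_lt_trans h2 q3) andbT (le_trans _ h1)//; lra.
  have := Gi_Int_le qT q5 sd dq Fc'; rewrite -/L0F => GI.
  have si : 0 <= (s m ^+ 2)^-1 by rewrite invr_ge0 sqr_ge0.
  apply: (@le_trans _ _ ((s m ^+ 2)^-1%:E *
     \int[leb]_(t in `]0%R, tk m[) (Num.max 0 (Gi (s m) t))%:E)%E).
    rewrite [X in (_ <= _ * X)%E]integral_mkcond -ge0_integralZl//; last 2 first.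
    - apply/(measurable_restrictT _ (measurable_itv `]0, tk m[)); apply: measurable_funTS.
      apply/measurable_EFinP; apply: measurable_maxr; first exact: measurable_cst.
      exact: Gi_measurable.
    - by move=> t _; rewrite patchE; case: ifP => // _; rewrite lee_fin le_max lexx.
    apply: ge0_le_int => t _; first by rewrite lee_fin.
    rewrite patchE /h /ind; case: ifPn => [|].
      by rewrite inE /= in_itv/= => ->; rewrite mulr1 -EFinM lee_fin mulrC.
    rewrite notin_setE /= in_itv/= => /negP/negbTE ->.
    by rewrite mulr0 mule0.
  apply: le_trans (lee_wpmul2l _ GI) _; first by rewrite lee_fin.
  by rewrite -EFinM lee_fin mulrA mulVf ?mul1r// gt_eqF// exprn_gt0.
have ptw : {ae leb, forall t : TR, 0 < t < tau ->
    (EE mu (fun x => phi (u (x, t))) <= 2%:E * L t)%E}.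
  have aeG : {ae leb, forall t : TR, forall k n : nat, 0 < t < tk k ->
      (EE mu (fun x => (Wi (x, t) - Wi (x, t - s n))%R) <= (2 * Gi (s n) t)%:E)%E}.
    apply: ae_foralln => k; apply: ae_foralln => n.
    have [q1 q2 q3 q4 q5] := tkP k.
    by apply: (@Gi_energy (tk k) (s n)) => //; rewrite q4 (lt_le_trans q3).
  move: aeG; apply: filterS => t HG tt; have [t0 ttau] := andP tt.
  have tT : 0 < t < T by rewrite t0 (lt_le_trans ttau).
  have [m1 _ Hm1] : \forall m \near \oo, t < tk m.
    have dt : 0 < tau - t by rewrite subr_gt0.
    have /cvgr0Pnorm_lt/(_ _ dt) := @inv_succ_cvg0 R.
    apply: filterS => m; rewrite ger0_norm// => hm.
    have [q1 _ _ _ _] := tkP m; apply: lt_trans q1.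
    by rewrite ltrBrDr addrC -ltrBrDr.
  suff H r : (L t < r%:E)%E -> (EE mu (fun x => phi (u (x, t))) <= (2 * r)%:E)%E.
    case: (L t) H (L0 t) => [l H _| H _|//]; last by rewrite gt0_muley ?lte_fin// leey.
    rewrite -EFinM; apply/lee_addgt0Pr => e e0; rewrite -EFinD.
    have := H (l + e / 2); rewrite lte_fin ltrDl divr_gt0// => /(_ isT).
    by rewrite mulrDr mulrCA divff ?mulr1.
  move=> Lr; apply: EE_phi_le => // n.
  have [m nm hm] := limn_einf_lt (maxn n m1) Lr.
  exists m; first exact: leq_trans (leq_maxl _ _) nm.
  have tm : 0 < t < tk m by rewrite t0 Hm1//= (leq_trans (leq_maxr n m1)).
  have GE := HG m m tm; apply: le_trans GE _; rewrite lee_fin.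
  move: hm; rewrite lte_fin /h /ind tm mulr1 ltr_pdivrMr ?exprn_gt0// => hm.
  have : Gi (s m) t <= Num.max 0 (Gi (s m) t) by rewrite le_max lexx orbT.
  by rewrite -/(s m); move: hm; set g := Num.max _ _ => *; lra.
case: ptw => Z [mZ Z0 HZ].
(* The comparison is made to hold at every time by adding a function that is infinite on the
   exceptional null set and has integral 0; the measurability of [EE] in time then does not
   enter. *)
pose E := (fun=> +oo%E : \bar R) \_ Z : TR -> \bar R.
have E0 t : (0 <= E t)%E by rewrite /E patchE; case: ifP.
have mE : measurable_fun (setT : set TR) E.
  by apply/(measurable_restrictT _ mZ); exact: measurable_cst.
apply: (@le_trans _ _ (\int[leb]_t (L t + E t))%E).
  rewrite integral_mkcond; apply: ge0_le_int => t _.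
    by rewrite patchE; case: ifP => // _; apply: mule_ge0; rewrite ?lee_fin//; exact: EE_ge0.
  rewrite patchE; case: ifPn => [|_]; last by rewrite adde_ge0.
  rewrite inE /= in_itv/= => tt; rewrite /E patchE; case: ifPn => tZ.
    by rewrite addeC addye ?leey// gt_eqF// (lt_le_trans (ltNyr 0)).
  rewrite adde0; have : ~ Z t by move: tZ; rewrite notin_setE.
  move=> nZ; have : (EE mu (fun x => phi (u (x, t))) <= 2%:E * L t)%E.
    by apply: contrapT => H; apply: nZ; apply: HZ => /= K; exact/H/K.
  move=> /(lee_wpmul2l (_ : 0 <= (2^-1)%:E)%E) H; apply: le_trans (H _) _.
    by rewrite lee_fin.
  by rewrite muleA -EFinM mulVf ?mul1e.
rewrite ge0_integralD//; apply: le_trans IL.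
rewrite (_ : (\int[leb]_t E t)%E = 0%E) ?adde0//.
by rewrite /E -integral_mkcond; apply: null_set_integral => //; exact: measurable_cst.
Qed.

End assembly.

(** * The energy inequality *)

Section primitive.
Context {R : realType}.
Local Notation TR := (measurableTypeR R).
Local Notation leb := (@lebesgue_measure R).
Variable phi : R -> R.
Hypothesis phi_cont : continuous phi.
Hypothesis phi_nd : {homo phi : a b / a <= b}.
Hypothesis phi0 : phi 0 = 0.

Let mphi : measurable_fun (setT : set TR) phi.
Proof. exact: continuous_measurable_fun. Qed.

Lemma phi_win_integ a b : integ leb (fun t => phi t * win a b t).
Proof.
apply: (@integ_dom _ TR R leb _ (fun t => (`|phi a| + `|phi b|) * win a b t)).
- by apply: measurable_funM => //; exact: integ_meas (integ_win a b).
- move=> t; rewrite normrM [`|win _ _ _|]ger0_norm ?win_ge0//.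
  have [wz|wz] := eqVneq (win a b t) 0; first by rewrite wz !mulr0.
  have [h1 h2] := win_neq0 wz; rewrite ler_wpM2r ?win_ge0//.
  have := phi_nd (ltW h1); have := phi_nd h2 => p1 p2.
  have [pt|pt] := leP 0 (phi t).
    by rewrite (ger0_norm pt) (le_trans p1)// (le_trans (ler_norm _))// lerDr.
  by rewrite (ltr0_norm pt) (le_trans _ (_ : `|phi a| <= _)) ?lerDl// -normrN ler_normr lerN2 p2.
- exact/integZ/integ_win.
Qed.

(** One formula for both signs of [a], since the window with reversed endpoints is empty. The closed
    interval of the definition and the window differ in one point. *)
Lemma primitive0_win a : primitive0 phi a =
  \int[leb]_t (phi t * win 0 a t) - \int[leb]_t (phi t * win a 0 t).
Proof.
have E b c : b <= c -> \int[leb]_(t in `[b, c]) phi t = \int[leb]_t (phi t * win b c t).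
  move=> bc; apply: (@Int_ae_dom _ TR R leb `[b, c]%classic phi) => //.
  - exact: measurable_funTS.
  - exact: integ_meas (phi_win_integ b c).
  - move=> t /= /negP; rewrite in_itv/= negb_and -!ltNge => /orP[h|h].
      by rewrite win0 ?mulr0//; left; exact: ltW.
    by rewrite win0 ?mulr0//; right.
  - exists [set b : TR]; split; first exact: measurable_set1.
      exact: lebesgue_measure_set1.
    move=> t /= h; apply: contrapT => tb; apply: h; rewrite in_itv/= => /andP[h1 h2].
    by rewrite win1 ?mulr1// lt_neqAle h1 andbT eq_sym; exact/eqP.
have W0 b c : c <= b -> \int[leb]_t (phi t * win b c t) = 0.
  move=> cb; apply: Int0 => t; have [h|h] := leP t b; first by rewrite win0 ?mulr0//; left.
  by rewrite win0 ?mulr0//; right; exact: le_lt_trans h.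
rewrite /primitive0; case: (leP 0 a) => a0; first by rewrite E// (W0 a 0 a0) subr0.
by rewrite (E _ _ (ltW a0)) (W0 0 a (ltW a0)) sub0r.
Qed.

Lemma primitive0_diff a b : a <= b ->
  primitive0 phi b - primitive0 phi a = \int[leb]_t (phi t * win a b t).
Proof.
move=> ab; rewrite !primitive0_win -!IntB; try exact: phi_win_integ;
  try by apply: integB; exact: phi_win_integ.
apply: eq_Int => t; rewrite -!mulrBr; congr (_ * _).
rewrite /win; case: (ltP 0 t); case: (ltP a t); case: (ltP b t) => /=; lra.
Qed.

Lemma primitive0_convex a b : phi a * (b - a) <= primitive0 phi b - primitive0 phi a.
Proof.
have [ab|ba] := leP a b.
  rewrite (primitive0_diff ab) -(Int_win ab) -IntZ; last exact: integ_win.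
  apply: Int_le; [exact/integZ/integ_win|exact: phi_win_integ|move=> t].
  have [wz|wz] := eqVneq (win a b t) 0; first by rewrite wz !mulr0.
  have [h1 h2] := win_neq0 wz; rewrite ler_wpM2r ?win_ge0//; exact/phi_nd/ltW.
rewrite -lerN2 -mulrN !opprB (primitive0_diff (ltW ba)) -(Int_win (ltW ba)).
rewrite -IntZ; last exact: integ_win.
apply: Int_le; [exact: phi_win_integ|exact/integZ/integ_win|move=> t].
have [wz|wz] := eqVneq (win b a t) 0; first by rewrite wz !mulr0.
have [h1 h2] := win_neq0 wz; rewrite ler_wpM2r ?win_ge0//; exact: phi_nd.
Qed.

Lemma primitive0_0 : primitive0 phi 0 = 0.
Proof. by rewrite primitive0_win subrr. Qed.

Lemma primitive0_ge0 a : 0 <= primitive0 phi a.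
Proof. by have := primitive0_convex 0 a; rewrite phi0 mul0r primitive0_0 subr0. Qed.

Lemma primitive0_bound M a : `|a| <= M -> `|primitive0 phi a| <= phisup phi M * `|a|.
Proof.
move=> aM; rewrite ger0_norm ?primitive0_ge0//.
have := primitive0_convex a 0; rewrite primitive0_0 !sub0r mulrN lerN2 => h.
apply: le_trans h _; apply: le_trans (ler_norm _) _; rewrite normrM ler_wpM2r//.
exact: phi_bounded.
Qed.

(** The convexity inequality at [a] and at [b] bounds the difference from both sides by a local
    bound of [phi] times [|a - b|]. *)
Lemma primitive0_continuous : continuous (primitive0 phi).
Proof.
move=> a; apply/cvgrPdist_le => e e0.
pose C := `|phi (a - 1)| + `|phi (a + 1)|.
have C0 : 0 <= C by rewrite addr_ge0.
have C1 : 0 < C + 1 by rewrite ltr_wpDl.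
exists (Num.min 1 (e / (C + 1))) => /=; first by rewrite lt_min ltr01 divr_gt0.
move=> b /=; rewrite lt_min => /andP[ab1 abe].
have phiC x : a - 1 <= x <= a + 1 -> `|phi x| <= C.
  move=> /andP[h1 h2]; have := phi_nd h1; have := phi_nd h2 => p1 p2.
  rewrite ler_norml /C; have := ler_norm (phi (a + 1)).
  have := ler_norm (- phi (a - 1)); rewrite normrN.
  have := normr_ge0 (phi (a + 1)); have := normr_ge0 (phi (a - 1)).
  by move=> *; apply/andP; split; lra.
have ha : `|phi a| <= C by apply: phiC; apply/andP; split; lra.
have hb : `|phi b| <= C.
  by apply: phiC; move: ab1; rewrite distrC ltr_distl => /andP[? ?]; apply/andP; split; lra.
have K : C * `|a - b| <= e.
  apply: (@le_trans _ _ ((C + 1) * (e / (C + 1)))).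
    by rewrite ler_pM ?lerDl// ltW.
  by rewrite mulrC divfK ?gt_eqF.
have h1 := primitive0_convex a b; have h2 := primitive0_convex b a.
apply: le_trans K; rewrite ler_norml; apply/andP; split.
  rewrite -lerN2 opprK opprB; apply: le_trans (_ : phi b * (b - a) <= _).
    by rewrite -lerN2 -mulrN !opprB.
  by rewrite (le_trans (ler_norm _))// normrM distrC ler_wpM2r.
apply: le_trans (_ : phi a * (a - b) <= _); first by rewrite -lerN2 -mulrN !opprB.
by rewrite (le_trans (ler_norm _))// normrM ler_wpM2r.
Qed.

End primitive.

(** * Integrability and sigma-finiteness of the Levy measure *)

Section levy_measure.
Context {R : realType} (N : nat).
Local Notation X := 'rV[R]_N.
Variable mu : {measure set X -> \bar R}.
Hypothesis mu_radon : radon_punctured mu.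
Hypothesis mu_even : even_measure mu.
Hypothesis mu_levy : levy_integrable mu.

Lemma even_preimage (A : set X) : measurable A -> mu (-%R @^-1` A) = mu A.
Proof.
move=> mA; rewrite [RHS]mu_even//; congr (mu _); apply/seteqP; split=> x /=.
  by move=> h; exists (- x) => //; rewrite opprK.
by move=> [y Ay <-]; rewrite opprK.
Qed.

Let msmall : measurable [set z : X | enorm z <= 1].
Proof. exact: enorm_ball_measurable. Qed.

Let m2 : measurable_fun setT (fun z : X => (enorm z ^+ 2)%:E).
Proof. by apply/measurable_EFinP; apply: measurable_funX; exact: enorm_measurable. Qed.

Let small_lty : (\int[mu]_(z in [set z | (enorm z <= 1)%R]) (enorm z ^+ 2)%:E < +oo)%E.
Proof. by apply: le_lt_trans mu_levy; rewrite leeDl. Qed.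

Let large_lty : (mu [set z | (1 < enorm z)%R] < +oo)%E.
Proof.
apply: le_lt_trans mu_levy; rewrite leeDr//; apply: integral_ge0 => z _.
by rewrite lee_fin sqr_ge0.
Qed.

Let mlarge : measurable [set z : X | 1 < enorm z].
Proof.
rewrite (_ : mkset _ = ~` [set z : X | enorm z <= 1]); first exact: measurableC.
by apply/seteqP; split => z /=; rewrite ltNge => /negP.
Qed.

Lemma levy_mw_integ : integ mu (@mw R N).
Proof.
have mm : measurable_fun setT (@mw R N).
  apply: measurable_minr; first exact: measurable_cst.
  apply: measurable_funX; apply: measurable_continuous; exact: norm_continuous.
apply: (integ_ge0 mm); first exact: mw_ge0.
apply: (@le_lt_trans _ _ (\int[mu]_z (((fun z => (enorm z ^+ 2)%:E) \_ [set z | (enorm z <= 1)%R]) z +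
    (\1_[set z | (1 < enorm z)%R] z : R)%:E))%E).
  apply: ge0_le_int => z _; first by rewrite lee_fin mw_ge0.
  rewrite patchE indicE; case: ifPn => [|/negP zs].
    rewrite inE /= => z1; rewrite memNset; last by move=> /=; rewrite ltNge z1.
    rewrite adde0 lee_fin /mw ge_min; apply/orP; right.
    by rewrite ler_sqr ?nnegrE ?sqrtr_ge0// norm_le_enorm.
  rewrite mem_set; last by rewrite /= ltNge; apply/negP => h; apply: zs; rewrite inE.
  by rewrite add0e lee_fin /mw ge_min lexx.
rewrite ge0_integralD//.
- rewrite -integral_mkcond integral_indic// setIT; exact: mu_levy.
- by move=> z _; rewrite patchE; case: ifP => // _; rewrite lee_fin sqr_ge0.
- by apply/(measurable_restrictT _ msmall); exact: measurable_funTS.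
- exact/measurable_EFinP/measurable_indic.
Qed.

(** The space is covered by the sets where [enorm z > 1 / (n + 1)], each joined with the origin,
    which has measure 0. Such a set has finite measure: its part beyond radius 1 by hypothesis, the
    rest by Chebyshev's inequality for the second moment. *)
Lemma levy_sigma_finite : sigma_finite setT mu.
Proof.
have [mu0 _ _] := mu_radon.
pose A (n : nat) : set X := [set z | n.+1%:R^-1 < enorm z].
have mA n : measurable (A n).
  rewrite (_ : A n = @enorm R N @^-1` `]n.+1%:R^-1, +oo[%classic); last first.
    by apply/seteqP; split => z /=; rewrite in_itv/= andbT.
  by rewrite -[X in measurable X]setTI; apply: enorm_measurable => //; exact: measurable_itv.
have m0 : measurable [set (0 : X)].
  rewrite (_ : [set 0] = ~` (\bigcup_n A n)); first exact/measurableC/bigcup_measurable.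
  apply/seteqP; split => z.
    have e0 : enorm (0 : X) = 0.
      by rewrite /enorm big1 ?sqrtr0// => i _; rewrite mxE expr0n.
    by move=> z0 [n _]; rewrite /A /= z0 e0 ltNge invr_ge0 ler0n.
  move=> nz; apply: contrapT => /eqP z0; apply: nz.
  have nz : 0 < enorm z by apply: lt_le_trans (norm_le_enorm z); rewrite normr_gt0.
  have [n _ Hn] : \forall n \near \oo, n.+1%:R^-1 < enorm z.
    have /cvgr0Pnorm_lt/(_ _ nz) := @inv_succ_cvg0 R.
    by apply: filterS => n; rewrite ger0_norm.
  by exists n => //; exact: (Hn n (leqnn n)).
exists (fun n => A n `|` [set 0]).
  apply/seteqP; split => // z _; have [->|z0] := eqVneq z 0; first by exists 0%N => //; right.
  have nz : 0 < enorm z by apply: lt_le_trans (norm_le_enorm z); rewrite normr_gt0.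
  have [n _ Hn] : \forall n \near \oo, n.+1%:R^-1 < enorm z.
    have /cvgr0Pnorm_lt/(_ _ nz) := @inv_succ_cvg0 R.
    by apply: filterS => n; rewrite ger0_norm.
  by exists n => //; left; exact: (Hn n (leqnn n)).
move=> n; split; first exact: measurableU.
apply: (@le_lt_trans _ _ (mu (A n) + mu [set (0%R : X)])%E); first exact: measureU2.
rewrite mu0 adde0.
pose q : R := n.+1%:R^-1.
have q0 : 0 < q by rewrite invr_gt0.
have sub : A n `<=` ([set z | enorm z <= 1] `&` A n) `|` [set z | 1 < enorm z].
  by move=> z Az; have [z1|z1] := leP (enorm z) 1; [left|right].
have mI : measurable ([set z | enorm z <= 1] `&` A n) by exact: measurableI.
have := le_measure mu (mem_set (mA n)) (mem_set (measurableU _ _ mI mlarge)) sub.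
move=> /le_lt_trans; apply.
apply: (@le_lt_trans _ _ (mu ([set z | (enorm z <= 1)%R] `&` A n) + mu [set z | (1 < enorm z)%R])%E).
  exact: measureU2.
apply: lte_add_pinfty => //.
(* Chebyshev: on this set the integrand [enorm z ^+ 2] is at least [q ^+ 2]. *)
have : ((q ^+ 2)%:E * mu ([set z | (enorm z <= 1)%R] `&` A n) <
    +oo)%E.
  apply: le_lt_trans small_lty.
  rewrite -[X in (_ * mu X)%E]setIT -integral_indic// -ge0_integralZl//; last 2 first.
  - exact/measurable_EFinP/measurable_indic.
  - by rewrite lee_fin sqr_ge0.
  rewrite [leRHS]integral_mkcond; apply: ge0_le_int => z _.
    by rewrite mule_ge0// lee_fin ?sqr_ge0// indicE.
  rewrite patchE indicE in_setI; case: ifPn => [_|_] /=.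
    have [zA|_] := boolP (z \in A n); last by rewrite mule0 lee_fin sqr_ge0.
    move: zA; rewrite inE /= mule1 lee_fin => qz.
    by rewrite ler_sqr ?nnegrE ?sqrtr_ge0 ?(ltW q0)// ltW.
  by rewrite mule0.
rewrite lt_neqAle => /andP[h _]; rewrite ltey; apply: contra h => /eqP ->.
by rewrite gt0_muley// lte_fin exprn_gt0.
Qed.

End levy_measure.

Section energy_identity.
Context {R : realType} (N : nat).
Local Notation X := 'rV[R]_N.
Local Notation lam := (@lebesgue_rV R N).
Variable mu : {sigma_finite_measure set X -> \bar R}.

(** Tonelli exchanges the integrals, and restricting [z] to [0 < enorm z] can only lower the
    value. *)
Lemma energy_EE (f : X -> R) : measurable_fun setT f ->
  (energy mu f <= (2^-1)%:E * EE mu f)%E.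
Proof.
move=> mf; rewrite /energy; apply: lee_wpmul2l; first by rewrite lee_fin.
pose F (p : X * X) : \bar R := ((f (p.1 + p.2) - f p.1) ^+ 2)%:E.
have mF : measurable_fun setT F by exact: measurable_diff2.
have F0 p : (0 <= F p)%E by rewrite lee_fin sqr_ge0.
apply: (@le_trans _ _ (\int[lam]_x \int[mu]_z F (x, z))%E).
  apply: ge0_le_int => x _; first by apply: integral_ge0 => z _; rewrite lee_fin sqr_ge0.
  rewrite integral_mkcond; apply: ge0_le_int => z _.
    by rewrite patchE; case: ifP => // _; rewrite lee_fin sqr_ge0.
  rewrite patchE; case: ifP => // _; rewrite lee_fin /= real_normK//; exact: num_real.
by rewrite (fubini_tonelli (m1 := lam) (m2 := mu) F mF F0).
Qed.

End energy_identity.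

Lemma lee_of_ltr (R : realType) (x y : \bar R) :
  (forall c : R, (c%:E < x)%E -> (c%:E <= y)%E) -> (x <= y)%E.
Proof.
case: x => [x H|H|_]; last exact: leNye.
  apply/lee_subgt0Pr => e e0; rewrite -EFinB; apply: H.
  by rewrite lte_fin gtrBl.
case: y H => [y H| //|H]; last by have := H 0 (ltry 0).
by have := H (y + 1) (ltry _); rewrite lee_fin gerDl ler10.
Qed.

(** The final potential [x] is not known in advance to be finite, so it enters only through the
    reals [c] below it. *)
Lemma adde_le_of_ltr (R : realType) (x e : \bar R) (v : R) :
  (0 <= x)%E -> (0 <= e)%E ->
  (forall c : R, (c%:E < x)%E -> (e <= (v - c)%:E)%E) -> (x + e <= v%:E)%E.
Proof.
move=> x0 e0 H.
(* [c = -1] is below any [x >= 0] and shows that [e] is finite, so it can be moved to the other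
   side. *)
have := H (- 1) (lt_le_trans _ x0); rewrite lte_fin ltrN10 => /(_ isT).
case: e e0 H => [e _ H _|//|//].
rewrite -leeBrDr// -EFinB; apply: lee_of_ltr => c /H.
by rewrite !lee_fin; lra.
Qed.

Lemma half_min (R : realType) (a b : R) : 0 < a -> 0 < b -> 0 < Num.min a b / 2 < b.
Proof. by move=> a0 b0; case: (ltP a b) => ab; lra. Qed.

(** * Lower semicontinuity of the potential and conclusion *)

Section integral_lsc.
Context {R : realType} (N : nat).
Local Notation X := 'rV[R]_N.
Local Notation lam := (@lebesgue_rV R N).

Lemma integral_lsc (Phi : R -> R) (f : X -> R) (c : \bar R) : continuous Phi ->
  (forall a, 0 <= Phi a) -> measurable_fun setT f ->
  (forall (n : nat) (e : R), 0 < e -> exists g : X -> R, [/\ measurable_fun setT g,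
    integ lam (fun x => `|g x - f x| * \1_(cube n%:R) x),
    \int[lam]_x (`|g x - f x| * \1_(cube n%:R) x) <= e &
    (\int[lam]_x (Phi (g x))%:E <= c)%E]) ->
  (\int[lam]_x (Phi (f x))%:E <= c)%E.
Proof.
move=> cPhi Phi0 mf H.
have mPhi : measurable_fun (setT : set R) Phi by exact: continuous_measurable_fun.
have [|F HF aeF] := @loc_approx R N
    (fun g => measurable_fun setT g /\ (\int[lam]_x (Phi (g x))%:E <= c)%E) f.
  by move=> n e e0; have [g [mg ig Ig gc]] := H n e e0; exists g.
have mFn n : measurable_fun setT (fun x : X => (Phi (F n x))%:E).
  by apply/measurable_EFinP; exact: (measurableT_comp mPhi (proj1 (HF n))).
have mL : measurable_fun setT (fun x : X => limn_einf (fun n => (Phi (F n x))%:E)).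
  apply: (measurableT_comp (@oppe_measurable R setT)).
  apply: (@measurable_fun_limn_esup _ X R setT (fun n x => (- (Phi (F n x))%:E)%E)) => n.
  exact: (measurableT_comp (@oppe_measurable R setT) (mFn n)).
apply: (@le_trans _ _ (\int[lam]_x limn_einf (fun n => (Phi (F n x))%:E))%E).
  apply: ae_ge0_le_integral => //.
  - by move=> x _; rewrite lee_fin.
  - by apply/measurable_EFinP; exact: (measurableT_comp mPhi mf).
  - move=> x _; rewrite limn_einf_lim; apply: lime_ge; first exact: is_cvg_einfs.
    by apply: nearW => k; apply: le_ereal_inf_tmp => _ [j _ <-]; rewrite lee_fin.
  move: aeF; apply: filterS => x Fx _.
  have cF : (fun n => (Phi (F n x))%:E) @ \oo --> (Phi (f x))%:E.
    apply: cvg_EFin; first exact: nearW.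
    exact: (cvg_comp _ _ Fx (cPhi (f x))).
  rewrite is_cvg_limn_einfE; last by apply/cvg_ex; eexists; exact: cF.
  by rewrite (cvg_lim _ cF).
have hF n (x : X) : (setT : set X) x -> (0 <= (Phi (F n x))%:E)%E by rewrite lee_fin.
apply: le_trans (fatou lam measurableT mFn hF) _.
rewrite limn_einf_lim; apply: lime_le; first exact: is_cvg_einfs.
apply: nearW => k; apply: le_trans (ereal_inf_lbound _) (proj2 (HF k)).
by exists k => //=.
Qed.

End integral_lsc.

Section energy_inequality.
Context {R : realType} (N : nat).
Local Notation X := 'rV[R]_N.
Local Notation TR := (measurableTypeR R).
Local Notation leb := (@lebesgue_measure R).
Local Notation lam := (@lebesgue_rV R N).
Local Notation P := (lam \x leb)%E.
Variables (T : R) (phi : R -> R) (mu : {sigma_finite_measure set X -> \bar R}).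
Variables (u0 : X -> R) (u : X * R -> R).
Hypothesis phi_cont : continuous phi.
Hypothesis phi_nd : {homo phi : a b / a <= b}.
Hypothesis phi0 : phi 0 = 0.
Hypothesis mu_even : forall A : set X, measurable A -> mu (-%R @^-1` A) = mu A.
Hypothesis mu_mw : integ mu (@mw R N).
Hypothesis u0_L1 : in_L1 lam setT u0.
Hypothesis u0_Linfty : in_Linfty lam setT u0.
Hypothesis u_class : solution_class T u.
Hypothesis u_sol : distributional_solution mu phi T u0 u.

(** By contraposition: if every left neighbourhood of [tau] held an integrable slice with potential
    below [c], these slices would converge locally to the one at [tau], and lower semicontinuity
    would give a potential at most [c] there. *)
Lemma slice_lower_bound (M tau c : R) (Phi : R -> R) : 0 <= M -> 0 < tau <= T ->
  C_L1_loc T u -> continuous Phi -> (forall a, 0 <= Phi a) ->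
  (forall f : X -> R, integ lam f -> (forall x, `|f x| <= M) -> integ lam (fun x => Phi (f x))) ->
  (c%:E < \int[lam]_x (Phi (clip M (u (x, tau))))%:E)%E ->
  exists2 d : R, 0 < d < tau & forall t, tau - d <= t < tau ->
    integ lam (fun x => ubar T M u (x, t)) -> c <= \int[lam]_x Phi (ubar T M u (x, t)).
Proof.
move=> M0 /andP[tau0 tT] u_c cPhi Phi_ge0 Phi_integ.
have tauI : tau \in `[0, T] by rewrite in_itv/= (ltW tau0).
have mct := clip_measurable M (u_slice_measurable u_c tauI).
apply: contraPP => H; apply/negP; rewrite -leNgt.
apply: (integral_lsc cPhi Phi_ge0 mct) => n e e0.
have [d d0 Hd] := clip_cont M0 u_c n tauI e0.
apply: contrapT => H2; apply: H; exists (Num.min d tau / 2); first exact: half_min.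
move=> t /andP[t1 t2] it; rewrite leNgt; apply/negP => Ic; apply: H2.
have /andP[t0 td] : (0 < t) && (`|t - tau| < d).
  move: (half_min tau0 d0) (half_min d0 tau0) t1 t2; rewrite minC.
  by move=> /andP[h1 h2] /andP[h3 h4] h5 h6; rewrite ltr_distl; apply/andP; split; [|apply/andP; split]; lra.
have tI : t \in `[0, T] by rewrite in_itv/= (ltW t0)/=; exact: ltW (lt_le_trans t2 tT).
have tt : 0 < t < T by rewrite t0; exact: lt_le_trans t2 tT.
have ubE x : ubar T M u (x, t) = clip M (u (x, t)) by exact: ubarE.
have mcs := clip_measurable M (u_slice_measurable u_c tI).
exists (fun x => clip M (u (x, t))); split.
- exact: mcs.
- apply: (integMb (C := M + M)).
  + by apply: measurableT_comp => //; exact: measurable_funB.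
  + by move=> x; rewrite normr_id (le_trans (ler_normB _ _))// lerD// clip_bound.
  + by apply: integ_indic; [exact: cube_measurable|exact: cube_fin].
- exact: Hd.
- have it' : integ lam (fun x => clip M (u (x, t))).
    by move: it; congr integ; apply/funext.
  rewrite -Int_EFin; last by apply: Phi_integ => // x; exact: clip_bound.
  rewrite lee_fin; apply: ltW; move: Ic; congr (_ < _).
  by apply: eq_Int => x; rewrite ubE.
Qed.

Lemma energy_inequality (tau : R) : tau \in `]0, T] ->
  (\int[lam]_x (primitive0 phi (u (x, tau)))%:E + energy_upto mu tau (phi \o u)
   <= \int[lam]_x (primitive0 phi (u0 x))%:E)%E.
Proof.
rewrite in_itv/= => tauT; have [tau0 tT] := andP tauT.
have tauI : tau \in `[0, T] by rewrite in_itv/= (ltW tau0).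
have [u_L1 [_ [M1 uM1]] u_cont] := u_class.
have [_ [M2 u0M2]] := u0_Linfty.
(* One nonnegative bound for both [u] and [u0]. *)
pose M := Num.max 0 (Num.max M1 M2).
have M0 : 0 <= M by rewrite le_max lexx.
have u_bd : {ae P, forall p : X * TR, QT T p -> `|u p| <= M}.
  move: uM1; apply: filterS => p h Q; rewrite (le_trans (h Q))// /M !le_max lexx.
  by rewrite orbT.
pose v0 x := clip M (u0 x).
have v0E : {ae lam, forall x : X, u0 x = v0 x}.
  move: u0M2; apply: filterS => x h; rewrite /v0 clip_id// (le_trans (h I))// /M !le_max lexx.
  by rewrite !orbT.
(* The datum is bounded only almost everywhere; its clipped version [v0] is bounded everywhere and
   has the same convolutions and the same potential. *)
have iu0 : integ lam u0 := u0_L1; have mu0 := integ_meas iu0.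
have mv0 : measurable_fun setT v0 by exact: clip_measurable.
have iv0 := integ_ae mu0 mv0 v0E iu0.
have v0M x : `|v0 x| <= M by exact: clip_bound.
have conv0 d y : conv d u0 y = conv d v0 y.
  have mk := measurableT_comp (@kap_measurable R N d) (measurable_addmx (- y)).
  apply: Int_ae; [exact: measurable_funM|exact: measurable_funM|].
  by move: v0E; apply: filterS => x ->.
have weq0 := weak_equation mu_even mu_mw phi_cont phi_nd phi0 M0 u_L1 u_bd u_cont u_sol.
have weq t d y : 0 < t < T ->
    conv d (fun x => ubar T M u (x, t)) y - conv d v0 y =
    \int[lam]_x (\int[leb]_r (phi (ubar T M u (x, r)) * ((0 < r)%R && (r < t)%R)%:R) *
      ell mu (kap d) (x - y)).
  by move=> tt; rewrite -conv0; exact: weq0.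
pose Phi := primitive0 phi.
have cPhi : continuous Phi by exact: primitive0_continuous.
have Phi_ge0 a : 0 <= Phi a by exact: primitive0_ge0.
have mPhi : measurable_fun (setT : set R) Phi by exact: continuous_measurable_fun.
have Phi_cx a b : phi a * (b - a) <= Phi b - Phi a by exact: primitive0_convex.
have Phi_bd a : `|a| <= M -> `|Phi a| <= phisup phi M * `|a| by exact: primitive0_bound.
have Phi_integ (f : X -> R) : integ lam f -> (forall x, `|f x| <= M) ->
    integ lam (fun x => Phi (f x)).
  move=> fi fM; apply: (integ_dom _ _ (integZ (phisup phi M) (integ_norm fi))).
    exact: (measurableT_comp mPhi (integ_meas fi)).
  by move=> x; exact: Phi_bd.
have F0E : (\int[lam]_x (Phi (u0 x))%:E = (\int[lam]_x Phi (v0 x))%:E)%E.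
  rewrite Int_EFin; last exact: Phi_integ.
  apply: ae_eq_integral => //.
  - by apply/measurable_EFinP; exact: (measurableT_comp mPhi mu0).
  - by apply/measurable_EFinP; exact: (measurableT_comp mPhi mv0).
  - by move: v0E; apply: filterS => x ->.
have mut := u_slice_measurable u_cont tauI.
have mct := clip_measurable M mut.
have FtE : (\int[lam]_x (Phi (u (x, tau)))%:E = \int[lam]_x (Phi (clip M (u (x, tau))))%:E)%E.
  apply: ae_eq_integral => //.
  - by apply/measurable_EFinP; exact: (measurableT_comp mPhi mut).
  - by apply/measurable_EFinP; exact: (measurableT_comp mPhi mct).
  - by have := u_clip M0 u_bd u_cont tauT; apply: filterS => x <-.
have mphi : measurable_fun (setT : set R) phi by exact: continuous_measurable_fun.
have EU : (energy_upto mu tau (phi \o u) <=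
    \int[leb]_(t in `]0%R, tau[) ((2^-1)%:E * EE mu (fun x => phi (u (x, t)))))%E.
  apply: ge0_le_int => t /=; rewrite in_itv/= => /andP[t0 tt].
    rewrite /energy; apply: mule_ge0; first by rewrite lee_fin.
    by apply: integral_ge0 => x _; apply: integral_ge0 => z _; rewrite lee_fin exprn_ge0.
  apply: energy_EE.
  have tI : t \in `[0, T] by rewrite in_itv/= (ltW t0)/=; exact: ltW (lt_le_trans tt tT).
  exact: (measurableT_comp mphi (u_slice_measurable u_cont tI)).
have good := ub_good M0 u_L1.
(* For each real [c] below the final potential, the slices just before [tau] have potential at least
   [c], and the truncated estimate bounds the energy by the initial potential minus [c]. *)
have key c : (c%:E < \int[lam]_x (Phi (u (x, tau)))%:E)%E ->
    (energy_upto mu tau (phi \o u) <= (\int[lam]_x Phi (v0 x) - c)%:E)%E.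
  move=> cF; apply: le_trans EU _.
  move: cF; rewrite FtE.
  move=> /(slice_lower_bound M0 tauT u_cont cPhi Phi_ge0 Phi_integ)[d dt Hd].
  apply: (truncated_energy mu_mw phi_cont phi_nd phi0 M0 u_L1 u_bd u_cont iv0 v0M weq
    mPhi Phi_cx Phi_bd tauT dt).
  by move: good; apply: filterS => t gt_ tt; exact: Hd.
have E0 : (0 <= energy_upto mu tau (phi \o u))%E.
  apply: integral_ge0 => t _; rewrite /energy; apply: mule_ge0; first by rewrite lee_fin.
  by apply: integral_ge0 => x _; apply: integral_ge0 => z _; rewrite lee_fin exprn_ge0.
have Et0 : (0 <= \int[lam]_x (Phi (u (x, tau)))%:E)%E.
  by apply: integral_ge0 => x _; rewrite lee_fin.
by rewrite F0E; exact: adde_le_of_ltr.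
Qed.

End energy_inequality.

Lemma sigma_finite_pack d (Y : measurableType d) (R : realType)
    (mu : {measure set Y -> \bar R}) : sigma_finite setT mu ->
  exists nu : {sigma_finite_measure set Y -> \bar R}, mu = nu.
Proof.
case: mu => mu c H.
pose m : {measure set Y -> \bar R} := Measure.Pack c.
pose f := Measure_isSigmaFinite.Build _ _ _ m H.
pose nu : {sigma_finite_measure set Y -> \bar R} := HB.pack mu m f.
by exists nu.
Qed.

Theorem theorem2p19 (R : realType) (N : nat) (hN : (0 < N)%N)
  (T : R) (hT : 0 < T)
  (phi : R -> R) (phi_cont : continuous phi)
  (phi_nd : {homo phi : a b / a <= b}) (phi0 : phi 0 = 0)
  (mu : {measure set 'rV[R]_N -> \bar R})
  (mu_radon : radon_punctured mu) (mu_even : even_measure mu)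
  (mu_levy : levy_integrable mu)
  (u0 : 'rV[R]_N -> R)
  (u0_L1 : in_L1 (lebesgue_rV N) setT u0)
  (u0_Linfty : in_Linfty (lebesgue_rV N) setT u0)
  (u : 'rV[R]_N * R -> R) (u_class : solution_class T u)
  (u_sol : distributional_solution mu phi T u0 u)
  (tau : R) (htau : tau \in `]0, T]) :
  (\int[lebesgue_rV N]_x (primitive0 phi (u (x, tau)))%:E +
     energy_upto mu tau (phi \o u)
   <= \int[lebesgue_rV N]_x (primitive0 phi (u0 x))%:E)%E.
Proof.
(* The exchanges of the [x] and [z] integrals require a sigma-finite measure, which the Levy
   condition provides. *)
have [nu muE] := sigma_finite_pack (levy_sigma_finite mu_radon mu_levy).
move: mu_even mu_levy u_sol; rewrite muE => nu_even nu_levy nu_sol.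
exact: (energy_inequality phi_cont phi_nd phi0 (even_preimage nu_even)
  (levy_mw_integ nu_levy) u0_L1 u0_Linfty u_class nu_sol htau).
Qed.
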